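(* Let $0<\alpha,\beta,\gamma<2$ with $\alpha\beta\gamma<2$, let $\mu$ be any complex number, let $\varepsilon>0$, and let $\eta$ be a real number satisfying $$\frac{\pi\alpha\beta\gamma}{2}<\eta\le\min(\pi,\pi\alpha\beta\gamma).$$ Put $$\varepsilon_\alpha:=\varepsilon^{\frac1{\beta\gamma}},\quad \varepsilon_\beta:=\varepsilon^{\frac1{\alpha\gamma}},\quad \varepsilon_\gamma:=\varepsilon^{\frac1{\alpha\beta}},\quad \eta_\alpha:=\frac{\eta}{\beta\gamma},\quad \eta_\beta:=\frac{\eta}{\alpha\gamma},\quad \eta_\gamma:=\frac{\eta}{\alpha\beta}.$$ If $x\in\Omega^{(+)}(\varepsilon_\alpha;\eta_\alpha)$, $y\in\Omega^{(+)}(\varepsilon_\beta;\eta_\beta)$ and $z\in\Omega^{(+)}(\varepsilon_\gamma;\eta_\gamma)$, then $$\begin{aligned}E_{\alpha,\beta,\gamma}(x,y,z;\mu)={}&\frac1\alpha\,\frac{e^{x^{1/\alpha}}\,x^{\frac{\beta+\gamma+1-\mu}{\alpha}}}{(x^{\beta/\alpha}-y)(x^{\gamma/\alpha}-z)}+\frac1\beta\,\frac{e^{y^{1/\beta}}\,y^{\frac{\alpha+\gamma+1-\mu}{\beta}}}{(y^{\alpha/\beta}-x)(y^{\gamma/\beta}-z)}+\frac1\gamma\,\frac{e^{z^{1/\gamma}}\,z^{\frac{\alpha+\beta+1-\mu}{\gamma}}}{(z^{\alpha/\gamma}-x)(z^{\beta/\gamma}-y)}\\&+\frac{1}{2\pi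 i}\,\frac{1}{\alpha\beta\gamma}\int_{\omega(\varepsilon;\eta)}\frac{e^{s^{1/(\alpha\beta\gamma)}}\,s^{\frac{\alpha+\beta+\gamma+1-\mu}{\alpha\beta\gamma}-1}}{\left(s^{1/(\beta\gamma)}-x\right)\left(s^{1/(\alpha\gamma)}-y\right)\left(s^{1/(\alpha\beta)}-z\right)}\,ds.\end{aligned}$$
   Context: The three-variable Mittag-Leffler function is $$E_{\alpha,\beta,\gamma}(x,y,z;\mu)=\sum_{n,m,p=0}^{\infty}\frac{x^n y^m z^p}{\Gamma(n\alpha+m\beta+p\gamma+\mu)},\qquad \alpha,\beta,\gamma>0,\ \mu,x,y,z\in\mathbb{C},$$ with $1/\Gamma$ understood as the entire reciprocal Gamma function (zero at the poles of $\Gamma$). Hankel contour: for $\varepsilon>0$ and $\eta>0$, $\omega(\varepsilon;\eta)$ is the path, oriented in the direction of non-decreasing $\arg s$, consisting of the two rays $S_{\pm\eta}=\{\arg s=\pm\eta,\ |s|\ge\varepsilon\}$ and the circular arc $\{|s|=\varepsilon,\ -\eta\le\arg s\le\eta\}$. That is, it comes in from infinity along $\arg s=-\eta$, follows the arc counterclockwise, and goes out to infinity along $\arg s=\eta$. If $\eta=\pi$ it is the keyhole path around the negative real axis, i.e. the ray $(-\infty,-\varepsilon]$ traversed in both directions (with $\arg s=-\pi$ incoming and $\arg s=\pi$ outgoing) together with the circle $|s|=\varepsilon$. For $0<\eta<\pi$ the contour divides the complex plane into two unbounded regions, $\Omega^{(-)}(\varepsilon;\eta)$ to the left of the contour and $\Omega^{(+)}(\varepsilon;\eta)$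 to the right. Explicitly, with $\arg s\in(-\pi,\pi]$, $\Omega^{(-)}(\varepsilon;\eta)=\{|s|<\varepsilon\}\cup\{s\neq0:\ |\arg s|>\eta\}$ and $\Omega^{(+)}(\varepsilon;\eta)=\{|s|>\varepsilon,\ |\arg s|<\eta\}$; these formulas are used as the definition also when $\eta\ge\pi$. In contour integrals, powers are $s^a=\exp(a(\ln|s|+i\arg s))$ with $\arg s\in[-\eta,\eta]$ the argument along the contour; powers of $x,y,z$ are principal values.
   Formalization: Added: the denominators of the three explicit terms are nonzero; and if η_α>π, no argument of x other than the principal one lies in [-η_α,η_α] (likewise y with η_β, z with η_γ), since otherwise the integrand has a further pole on the contour or to its right and the formula fails. *)

(* Defs.v *)
From Stdlib Require Import Reals ZArith.
From Coquelicot Require Import Coquelicot.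
Open Scope R_scope.

Definition Cexp (z : C) : C :=
  (exp (Re z) * cos (Im z), exp (Re z) * sin (Im z)).

(* Principal argument, in (-PI, PI]; Carg 0 has no meaning. *)
Definition Carg (z : C) : R :=
  if Rle_dec 0 (Im z) then acos (Re z / Cmod z) else - acos (Re z / Cmod z).

(* The power s^a of a point s = r e^{i theta} of the Riemann surface of the
   logarithm: theta is any real number and is not reduced modulo 2 PI. *)
Definition polar_power (r theta : R) (a : C) : C := Cexp (a * (ln r, theta)).

Definition Cpower (z a : C) : C := polar_power (Cmod z) (Carg z) a.

Definition CLim (u : nat -> C) : C :=
  (real (Lim_seq (fun n => Re (u n))), real (Lim_seq (fun n => Im (u n)))).

Definition CSeries (a : nat -> C) : C :=
  (Series (fun n => Re (a n)), Series (fun n => Im (a n))).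

(* z (z + 1) ... (z + n) *)
Fixpoint rising (z : C) (n : nat) : C :=
  match n with
  | O => z
  | S m => (rising z m * (z + INR n))%C
  end.

(* 1 / Gamma by Gauss's formula
     1 / Gamma(z) = lim_n  z (z + 1) ... (z + n) / (n! n^z),
   valid for every complex z; it vanishes at 0, -1, -2, ... *)
Definition rGamma (z : C) : C :=
  CLim (fun n => (rising z n / (INR (fact n) * polar_power (INR n) 0 z))%C).

(* The triple series converges absolutely for alpha, beta, gamma > 0, so it may
   be summed as a repeated series. *)
Definition mittag_leffler3 (alpha beta gamma : R) (x y z mu : C) : C :=
  CSeries (fun n => CSeries (fun m => CSeries (fun p =>
    (x ^ n * y ^ m * z ^ p *
     rGamma (INR n * alpha + INR m * beta + INR p * gamma + mu))%C))).

Definition Omega_plus (eps eta : R) (s : C) : Prop :=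
  eps < Cmod s /\ Rabs (Carg s) < eta.

(* No argument of z other than the principal one lies in [-eta, eta].  For z in
   Omega_plus eps eta this is automatic when eta <= PI.  When eta > PI the image
   of the Hankel contour under a power map overlaps itself, and the condition
   says that z lies to its right on one sheet only. *)
Definition single_sheet (eta : R) (z : C) : Prop :=
  forall k : Z, k <> 0%Z -> eta < Rabs (Carg z + 2 * PI * IZR k).

Definition ray_integral (eps : R) (f : R -> C) : C :=
  RInt_gen (V := C_R_CompleteNormedModule) f
    (at_point eps) (Rbar_locally p_infty).

(* Integral over the Hankel contour omega(eps; eta) of the function whose value
   at s = r e^{i theta}, theta being the argument along the contour, is
   F r theta.  The first ray is traversed from infinity, hence the sign. *)
Definition hankel_integral (eps eta : R) (F : R -> R -> C) : C :=
  (- ray_integral eps (fun r => F r (- eta)%R * Cexp (Ci * (- eta)%R))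
   + RInt (V := C_R_CompleteNormedModule)
       (fun theta => F eps theta * (Ci * eps * Cexp (Ci * theta)))
       (- eta) eta
   + ray_integral eps (fun r => F r eta * Cexp (Ci * eta)))%C.

(* Main.v *)
Require Import Defs.
From Stdlib Require Import Reals ZArith Lra Lia Psatz.
From Coquelicot Require Import Coquelicot.
Open Scope R_scope.

(** Put lam = alpha beta gamma and th = eta / lam, so that PI/2 < th <= PI.
    Under s = t^lam the contour omega(eps; eta) becomes a Hankel contour of
    opening angle th, and the integral becomes that of
      e^t t^(alpha + beta + gamma - mu) / ((t^alpha - x) (t^beta - y) (t^gamma - z)).
    The substitution t = e^u then removes all branches: powers of t are entire
    functions of u, an argument is just an ordinate, and the contour is the
    boundary of the half-strip Re u >= a, |Im u| <= th.  Changing the radius of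
    the Hankel contour means moving the left side of the half-strip, and what
    this costs is an integral around a rectangle.

    When the left side is far to the right, x e^(-alpha u), y e^(-beta u) and
    z e^(-gamma u) have modulus at most 1/2 on the contour.  The three
    denominators expand into geometric series, and each term of the resulting
    triple series is an instance of Hankel's formula for 1/Gamma; this is the
    Mittag-Leffler function ([mittag_leffler3_hankel]).  Moving the left side back
    to ln eps / lam sweeps a rectangle which contains exactly the three poles
    ln x / alpha, ln y / beta and ln z / gamma, all simple, and their residues are
    the three explicit terms ([rint_ml], [ml_log_form]).

    Hankel's formula is derived from Gauss's product, which is how 1/Gamma is
    given here.  The integral of e^((1-w)u) (1 - e^u/N)^(-N) over the contour can
    be computed exactly: integration by parts lowers the exponent and raises w,
    until one simple pole at u = ln N remains, and the outcome is a Gauss product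
    ([gauss_kernel_value]).  These integrands tend to exp(e^u + (1-w)u) with an
    error at most K/N times the integrable weight e^(-Re u), so the integrals
    converge too ([gauss_kernel_error_tame], [rGamma_hankel]).

    Cauchy's formula for a rectangle is proved by a homotopy: the integral of
    h(p + s (u - p)) / (u - p) around the rectangle is independent of s in [0, 1],
    because its derivative in s is the integral of an exact form
    ([cauchy_rect]).  To see that the poles are simple, e^w - 1 is written as
    w E(w) with E entire and without zeros for |Im w| < 2 PI; each denominator is
    then a linear factor times a holomorphic unit on the strip
    ([pole_factor]). *)

(** * Continuity and the exponential function on C *)

Lemma norm_C_Cmod (z : C_R_NormedModule) : norm z = Cmod z.
Proof.
  unfold norm; simpl; unfold prod_norm, Cmod, norm; simpl; unfold abs; simpl.
  rewrite !Rmult_1_r, <- !Rabs_mult, !Rabs_right; try nra; reflexivity.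
Qed.

(** Continuity of a map to C always refers to the uniform structure of R * R. *)
Notation contC := (@continuous _ C_UniformSpace).

Lemma contC_pair {U : UniformSpace} (f g : U -> R) (x : U) :
  continuous f x -> continuous g x -> contC (fun y => (f y, g y) : C) x.
Proof.
  intros hf hg.
  apply (continuous_comp_2 f g (fun a b => (a, b) : C)); auto.
  apply (continuous_ext (fun p => p)); [now intros [a b] | apply continuous_id].
Qed.

Lemma contC_Re {U : UniformSpace} (f : U -> C) (x : U) :
  contC f x -> continuous (fun y => Re (f y)) x.
Proof.
  intros hf. apply (continuous_comp f (fun z : C => Re z)); auto.
  apply (continuous_fst (U := R_UniformSpace) (V := R_UniformSpace)).
Qed.

Lemma contC_Im {U : UniformSpace} (f : U -> C) (x : U) :
  contC f x -> continuous (fun y => Im (f y)) x.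
Proof.
  intros hf. apply (continuous_comp f (fun z : C => Im z)); auto.
  apply (continuous_snd (U := R_UniformSpace) (V := R_UniformSpace)).
Qed.

Lemma cont_Rmult {U : UniformSpace} (f g : U -> R) (x : U) :
  continuous f x -> continuous g x -> continuous (fun y => f y * g y) x.
Proof. intros; now apply (continuous_mult (K := R_AbsRing)). Qed.

Lemma cont_Rplus {U : UniformSpace} (f g : U -> R) (x : U) :
  continuous f x -> continuous g x -> continuous (fun y => f y + g y) x.
Proof. intros; now apply (continuous_plus (V := R_NormedModule)). Qed.

Lemma cont_Ropp {U : UniformSpace} (f : U -> R) (x : U) :
  continuous f x -> continuous (fun y => - f y) x.
Proof. intros; now apply (continuous_opp (V := R_NormedModule)). Qed.

Lemma cont_Rminus {U : UniformSpace} (f g : U -> R) (x : U) :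
  continuous f x -> continuous g x -> continuous (fun y => f y - g y) x.
Proof. intros; now apply (continuous_minus (V := R_NormedModule)). Qed.

Lemma contC_plus {U : UniformSpace} (f g : U -> C) (x : U) :
  contC f x -> contC g x -> contC (fun y => (f y + g y)%C) x.
Proof. intros; now apply (continuous_plus (V := C_R_NormedModule)). Qed.

Lemma contC_opp {U : UniformSpace} (f : U -> C) (x : U) :
  contC f x -> contC (fun y => (- f y)%C) x.
Proof. intros; now apply (continuous_opp (V := C_R_NormedModule)). Qed.

Lemma contC_minus {U : UniformSpace} (f g : U -> C) (x : U) :
  contC f x -> contC g x -> contC (fun y => (f y - g y)%C) x.
Proof. intros; apply contC_plus; auto; now apply contC_opp. Qed.

Lemma contC_mult {U : UniformSpace} (f g : U -> C) (x : U) :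
  contC f x -> contC g x -> contC (fun y => (f y * g y)%C) x.
Proof.
  intros hf hg.
  apply (contC_pair (fun y => Re (f y) * Re (g y) - Im (f y) * Im (g y))
                    (fun y => Re (f y) * Im (g y) + Im (f y) * Re (g y)));
    [apply cont_Rminus | apply cont_Rplus]; apply cont_Rmult;
    now (apply contC_Re || apply contC_Im).
Qed.

Lemma contC_inv {U : UniformSpace} (f : U -> C) (x : U) :
  contC f x -> f x <> 0 -> contC (fun y => (/ f y)%C) x.
Proof.
  intros hf h0.
  assert (hd : continuous (fun y => / (Re (f y) ^ 2 + Im (f y) ^ 2)) x).
  { apply (continuous_comp (fun y => Re (f y) ^ 2 + Im (f y) ^ 2) Rinv);
      [|apply continuous_Rinv].
    - simpl. apply cont_Rplus; apply cont_Rmult;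
        try (apply cont_Rmult; try apply continuous_const);
        now (apply contC_Re || apply contC_Im).
    - intros e. apply h0. apply Cmod_eq_0. unfold Cmod.
      fold (Re (f x)) (Im (f x)). now rewrite e, sqrt_0. }
  apply (contC_pair (fun y => Re (f y) / (Re (f y) ^ 2 + Im (f y) ^ 2))
           (fun y => - Im (f y) / (Re (f y) ^ 2 + Im (f y) ^ 2)));
    apply cont_Rmult; auto; try apply cont_Ropp;
    now (apply contC_Re || apply contC_Im).
Qed.

Lemma contC_RtoC {U : UniformSpace} (f : U -> R) (x : U) :
  continuous f x -> contC (fun y => RtoC (f y)) x.
Proof. intros; apply contC_pair; auto; apply continuous_const. Qed.

Lemma contC_Cexp {U : UniformSpace} (f : U -> C) (x : U) :
  contC f x -> contC (fun y => Cexp (f y)) x.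
Proof.
  intros hf. apply contC_pair; apply cont_Rmult.
  - apply (continuous_comp _ exp); [|apply continuous_exp]. now apply contC_Re.
  - apply (continuous_comp _ cos); [|apply continuous_cos]. now apply contC_Im.
  - apply (continuous_comp _ exp); [|apply continuous_exp]. now apply contC_Re.
  - apply (continuous_comp _ sin); [|apply continuous_sin]. now apply contC_Im.
Qed.

Lemma Cexp_plus (a b : C) : Cexp (a + b) = (Cexp a * Cexp b)%C.
Proof.
  unfold Cexp, Cmult, Re, Im; simpl. rewrite exp_plus, cos_plus, sin_plus.
  f_equal; ring.
Qed.

Lemma Cexp_0 : Cexp 0 = 1.
Proof. unfold Cexp; simpl. rewrite exp_0, cos_0, sin_0. unfold RtoC. f_equal; ring. Qed.

Lemma Cmod_Cexp (z : C) : Cmod (Cexp z) = exp (Re z).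
Proof.
  unfold Cmod, Cexp; simpl.
  replace (_ + _) with (Rsqr (exp (Re z))).
  - apply sqrt_Rsqr. left; apply exp_pos.
  - unfold Rsqr. generalize (sin2_cos2 (Im z)); unfold Rsqr. intros h.
    transitivity (exp (Re z) * exp (Re z) * (sin (Im z) * sin (Im z) + cos (Im z) * cos (Im z))).
    + rewrite h; ring.
    + ring.
Qed.

Lemma Cexp_nz (z : C) : Cexp z <> 0.
Proof.
  intros h. assert (h' := exp_pos (Re z)). rewrite <- Cmod_Cexp, h, Cmod_0 in h'. lra.
Qed.

Lemma Cexp_opp (z : C) : Cexp (- z) = (/ Cexp z)%C.
Proof.
  assert (h : (Cexp (- z) * Cexp z)%C = 1).
  { rewrite <- Cexp_plus, <- Cexp_0. f_equal. ring. }
  rewrite <- (Cmult_1_l (/ Cexp z)), <- h. field. apply Cexp_nz.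
Qed.

Lemma Cexp_minus (a b : C) : Cexp (a - b) = (Cexp a / Cexp b)%C.
Proof. unfold Cminus. now rewrite Cexp_plus, Cexp_opp. Qed.

Lemma Cexp_nat (n : nat) (z : C) : Cexp (INR n * z) = (Cexp z ^ n)%C.
Proof.
  induction n as [|n IH].
  - simpl. rewrite Cmult_0_l. apply Cexp_0.
  - rewrite S_INR, RtoC_plus, Cmult_plus_distr_r, Cexp_plus, IH, Cmult_1_l.
    simpl. ring.
Qed.

Lemma Cexp_real (x : R) : Cexp x = exp x.
Proof. unfold Cexp, RtoC; simpl. rewrite cos_0, sin_0. f_equal; ring. Qed.

(** Dividing the increment by s - t leaves a continuous function: all complex
    derivatives below come in this form. *)
Lemma is_derive_factor (F psi : R -> C) (t : R) :
  contC psi t -> (forall s, F s = (F t + RtoC (s - t) * psi s)%C) ->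
  is_derive (V := C_R_NormedModule) F t (psi t).
Proof.
  intros hc hF. split.
  - apply is_linear_scal_l.
  - intros x hx. apply (@is_filter_lim_locally_unique R_AbsRing (AbsRing_NormedModule R_AbsRing)) in hx. subst x.
    intros eps.
    assert (h := proj1 (filterlim_locally (F := locally t) (U := C_R_NormedModule) psi (psi t)) hc).
    assert (he : 0 < eps / sqrt 2).
    { apply Rdiv_lt_0_compat; [apply cond_pos | apply Rlt_sqrt2_0]. }
    specialize (h (mkposreal _ he)). revert h. apply filter_imp. intros s h.
    apply (C_NormedModule_mixin_compat2 _ _ (mkposreal _ he)) in h. simpl in h.
    rewrite !norm_C_Cmod.
    match goal with |- Cmod ?X <= _ =>
      assert (e : X = (RtoC (s - t) * (psi s - psi t))%C) end.
    { rewrite (hF s). unfold minus, plus, opp, scal; simpl.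
      unfold prod_plus, prod_opp, prod_scal; simpl.
      unfold Cminus, Cplus, Copp, Cmult, plus, opp, scal; simpl.
      unfold mult; simpl. apply injective_projections; simpl; ring. }
    rewrite e, Cmod_mult, Cmod_R, Rmult_comm. apply Rmult_le_compat.
    + apply Cmod_ge_0.
    + apply Rabs_pos.
    + left. replace (pos eps) with (sqrt 2 * (eps / sqrt 2)); [exact h|].
      field. apply Rgt_not_eq, Rlt_sqrt2_0.
    + apply Rle_refl.
Qed.

(** * Taylor remainders of the exponential *)

Notation RIC := (@RInt C_R_CompleteNormedModule).
Notation isRIC := (@is_RInt C_R_NormedModule).
Notation derC := (@is_derive R_AbsRing C_R_NormedModule).

(** Equations in the carrier of a normed module built on C are restated in C
    itself, where ring and field apply. *)
Ltac asC := match goal with |- ?a = ?b => change (@eq C a b) end.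

Lemma derC_pair (f g : R -> R) (t df dg : R) :
  is_derive f t df -> is_derive g t dg ->
  derC (fun s => (f s, g s) : C) t (df, dg).
Proof.
  intros hf hg.
  assert (h := is_derive_plus _ _ _ _ _
    (is_derive_scal_l (V := C_R_NormedModule) f t df (RtoC 1) hf)
    (is_derive_scal_l (V := C_R_NormedModule) g t dg Ci hg)).
  replace ((df, dg) : C) with (plus (scal df (RtoC 1 : C_R_NormedModule)) (scal dg (Ci : C_R_NormedModule)) : C).
  - revert h. apply is_derive_ext. intros s. rewrite !scal_R_Cmult.
    apply injective_projections; unfold plus; simpl; unfold plus; simpl; ring.
  - rewrite !scal_R_Cmult.
    apply injective_projections; unfold plus; simpl; unfold plus; simpl; ring.
Qed.

Lemma derC_Rmult (f : R -> R) (t df : R) (k : C) :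
  is_derive f t df -> derC (fun s => (RtoC (f s) * k)%C) t (RtoC df * k)%C.
Proof.
  intros hf. rewrite <- (scal_R_Cmult df k).
  apply (is_derive_ext (fun s => scal (f s) (k : C_R_NormedModule))).
  - intros s; apply scal_R_Cmult.
  - now apply (is_derive_scal_l (V := C_R_NormedModule)).
Qed.

Lemma derC_Rid (t : R) (k : C) : derC (fun s => (RtoC s * k)%C) t k.
Proof.
  assert (h : is_derive (fun s : R => s) t 1) by (auto_derive; auto).
  apply derC_Rmult with (k := k) in h. now rewrite Cmult_1_l in h.
Qed.

Lemma derC_minus (f g : R -> C) (t : R) (df dg : C) :
  derC f t df -> derC g t dg -> derC (fun s => (f s - g s)%C) t (df - dg)%C.
Proof. apply (is_derive_minus (V := C_R_NormedModule)). Qed.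

Lemma increment_bound (F dF : R -> C) (K : R) :
  (forall s, 0 <= s <= 1 -> derC F s (dF s)) ->
  (forall s, contC dF s) ->
  (forall s, 0 <= s <= 1 -> Cmod (dF s) <= K) ->
  Cmod (F 1 - F 0) <= K.
Proof.
  intros hd hc hb.
  assert (hI : is_RInt (V := C_R_CompleteNormedModule) dF 0 1 (minus (F 1 : C_R_NormedModule) (F 0))).
  { apply (is_RInt_derive (V := C_R_CompleteNormedModule)).
    - intros s hs. rewrite Rmin_left, Rmax_right in hs by lra. now apply hd.
    - intros s _. apply hc. }
  assert (h := norm_RInt_le_const (V := C_R_NormedModule) dF 0 1 _ K ltac:(lra)
    (fun s hs => eq_ind_r (fun x => x <= K) (hb s hs) (norm_C_Cmod (dF s))) hI).
  rewrite norm_C_Cmod in h. rewrite Rminus_0_r, Rmult_1_l in h. exact h.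
Qed.

Lemma derC_Cexp_line (v : C) (t : R) :
  derC (fun s => Cexp (RtoC s * v)) t (v * Cexp (RtoC t * v))%C.
Proof.
  destruct v as [a b].
  apply (is_derive_ext (fun s => (exp (s * a) * cos (s * b), exp (s * a) * sin (s * b)) : C)).
  - intros s. unfold Cexp, Re, Im; simpl. f_equal; f_equal; f_equal; ring.
  - replace ((a, b) * Cexp (t * (a, b)))%C with
     ((a * exp (t * a) * cos (t * b) - b * exp (t * a) * sin (t * b),
       a * exp (t * a) * sin (t * b) + b * exp (t * a) * cos (t * b)) : C).
    + apply derC_pair; auto_derive; auto; ring.
    + unfold Cexp, Cmult, Re, Im; simpl.
      replace (t * a - 0 * b) with (t * a) by ring.
      replace (t * b + 0 * a) with (t * b) by ring.
      f_equal; ring.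
Qed.

Lemma contC_Cexp_line (v : C) (t : R) : contC (fun s : R => Cexp (RtoC s * v)) t.
Proof.
  apply contC_Cexp, contC_mult; [|apply continuous_const].
  apply contC_RtoC, continuous_id.
Qed.

(** The maximum of |e^(sv)| over the segment 0 <= s <= 1. *)
Definition emax (v : C) : R := Rmax 1 (exp (Re v)).

Lemma emax_pos (v : C) : 0 < emax v.
Proof. unfold emax. apply Rlt_le_trans with 1; [lra | apply Rmax_l]. Qed.

Lemma emax_scale (s : R) (v : C) : 0 <= s <= 1 -> exp (Re (s * v)) <= emax v.
Proof.
  intros hs. rewrite re_scal_l. unfold emax.
  destruct (Rle_dec 0 (Re v)) as [h|h].
  - apply Rle_trans with (exp (Re v)); [|apply Rmax_r].
    destruct (Req_dec (s * Re v) (Re v)) as [->|h']; [lra|].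
    left; apply exp_increasing. nra.
  - apply Rle_trans with 1; [|apply Rmax_l]. rewrite <- exp_0.
    destruct (Req_dec (s * Re v) 0) as [->|h']; [lra|].
    left; apply exp_increasing. nra.
Qed.

Lemma emax_le_scale (s : R) (v : C) : 0 <= s <= 1 -> emax (s * v) <= emax v.
Proof.
  intros hs. unfold emax at 1. apply Rmax_lub; [apply Rmax_l | now apply emax_scale].
Qed.

(** This remainder and the next two are increments over [0, 1] of functions of s
    with e^(sv) in place of e^v; differentiating in s produces v times the
    preceding remainder at sv. *)
Lemma Cexp_taylor1 (v : C) : Cmod (Cexp v - 1) <= Cmod v * emax v.
Proof.
  assert (h := increment_bound (fun s => Cexp (RtoC s * v)) (fun s => v * Cexp (RtoC s * v))%C
     (Cmod v * emax v)).
  simpl in h. rewrite Cmult_1_l, Cmult_0_l, Cexp_0 in h. apply h.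
  - intros s _; apply derC_Cexp_line.
  - intros s; apply contC_mult; [apply continuous_const | apply contC_Cexp_line].
  - intros s hs. rewrite Cmod_mult, Cmod_Cexp.
    apply Rmult_le_compat_l; [apply Cmod_ge_0 | now apply emax_scale].
Qed.

Lemma Cmod_scale_le (s : R) (v : C) : 0 <= s <= 1 -> Cmod (s * v) <= Cmod v.
Proof.
  intros hs. rewrite Cmod_mult, Cmod_R, Rabs_right by lra.
  assert (h := Cmod_ge_0 v). nra.
Qed.

Lemma Cexp_taylor2 (v : C) : Cmod (Cexp v - 1 - v) <= Cmod v ^ 2 * emax v.
Proof.
  assert (h := increment_bound (fun s => Cexp (RtoC s * v) - RtoC s * v)%C
     (fun s => v * Cexp (RtoC s * v) - v)%C (Cmod v ^ 2 * emax v)).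
  simpl in h. rewrite Cmult_1_l, Cmult_0_l, Cexp_0 in h.
  replace (Cexp v - 1 - v)%C with (Cexp v - v - (1 - 0))%C by ring. apply h.
  - intros s _. apply derC_minus; [apply derC_Cexp_line|].
    apply derC_Rid.
  - intros s; apply contC_minus; [|apply continuous_const].
    apply contC_mult; [apply continuous_const | apply contC_Cexp_line].
  - intros s hs.
    replace (v * Cexp (s * v) - v)%C with (v * (Cexp (s * v) - 1))%C by ring.
    rewrite Cmod_mult, Rmult_assoc. 
    apply Rmult_le_compat_l; [apply Cmod_ge_0|].
    eapply Rle_trans; [apply Cexp_taylor1|]. rewrite Rmult_1_r.
    apply Rmult_le_compat; try apply Cmod_ge_0; [left; apply emax_pos| |].
    + now apply Cmod_scale_le.
    + now apply emax_le_scale.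
Qed.

Lemma Cexp_taylor3 (v : C) :
  Cmod (Cexp v - 1 - v - v * v / 2) <= Cmod v ^ 3 * emax v.
Proof.
  assert (h := increment_bound (fun s => Cexp (RtoC s * v) - RtoC s * v - RtoC (s * s / 2) * (v * v))%C
     (fun s => v * Cexp (RtoC s * v) - v - RtoC s * (v * v))%C (Cmod v ^ 3 * emax v)).
  simpl in h. rewrite Cmult_1_l, Cmult_0_l, Cexp_0 in h.
  replace (Cexp v - 1 - v - v * v / 2)%C with
   (Cexp v - v - RtoC (1 * 1 / 2) * (v * v) - (1 - 0 - RtoC (0 * 0 / 2) * (v * v)))%C.
  2:{ rewrite !RtoC_div, !RtoC_mult by lra. field. }
  apply h.
  - intros s _. apply derC_minus; [apply derC_minus; [apply derC_Cexp_line|]|].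
    + apply derC_Rid.
    + apply (derC_Rmult (fun s => s * s / 2)). auto_derive; auto; field.
  - intros s; apply contC_minus; [apply contC_minus; [|apply continuous_const]|].
    apply contC_mult; [apply continuous_const | apply contC_Cexp_line].
    apply contC_mult; [|apply continuous_const]. apply contC_RtoC, continuous_id.
  - intros s hs.
    replace (v * Cexp (s * v) - v - s * (v * v))%C with (v * (Cexp (s * v) - 1 - s * v))%C by ring.
    rewrite Cmod_mult, Rmult_assoc.
    apply Rmult_le_compat_l; [apply Cmod_ge_0|].
    eapply Rle_trans; [apply Cexp_taylor2|]. rewrite Rmult_1_r.
    apply Rmult_le_compat; try apply pow2_ge_0; [left; apply emax_pos| |].
    + replace (Cmod v * Cmod v) with (Cmod v ^ 2) by ring.
      apply pow_incr; split; [apply Cmod_ge_0 | now apply Cmod_scale_le].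
    + now apply emax_le_scale.
Qed.

(** The entire function E(w) = (e^w - 1) / w, which is what remains of e^w - 1
    when its zero at the origin is divided out. *)
Definition exp_quot (w : C) : C := if Ceq_dec w 0 then 1 else ((Cexp w - 1) / w)%C.

(** The divided difference (E(w) - E(0)) / w.  Its continuity at 0 gives both the
    differentiability of E at 0 and the continuity of E' there. *)
Definition exp_quot2 (w : C) : C := if Ceq_dec w 0 then (1 / 2)%C else ((exp_quot w - 1) / w)%C.

Lemma exp_quot_0 : exp_quot 0 = 1.
Proof. unfold exp_quot. destruct (Ceq_dec 0 0); tauto. Qed.

Lemma exp_quot_spec (w : C) : (w * exp_quot w)%C = (Cexp w - 1)%C.
Proof.
  unfold exp_quot. destruct (Ceq_dec w 0) as [->|h].
  - rewrite Cexp_0. ring.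
  - field. exact h.
Qed.

Lemma exp_quot2_spec (w : C) : exp_quot w = (1 + w * exp_quot2 w)%C.
Proof.
  unfold exp_quot2. destruct (Ceq_dec w 0) as [->|h].
  - rewrite exp_quot_0. ring.
  - field. exact h.
Qed.

Lemma contC_lipschitz (f : C -> C) (z : C) (K : R) :
  (forall w, Cmod (w - z) <= 1 -> Cmod (f w - f z) <= K * Cmod (w - z)) ->
  @continuous C_UniformSpace C_UniformSpace f z.
Proof.
  intros h. apply (proj2 (filterlim_locally (U := C_UniformSpace) _ _)). intros eps.
  set (K' := Rmax K 1).
  assert (hK : 0 < K') by (apply Rlt_le_trans with 1; [lra | apply Rmax_r]).
  assert (hd : 0 < Rmin 1 (eps / K') / sqrt 2).
  { apply Rdiv_lt_0_compat; [apply Rmin_pos; [lra|]| apply Rlt_sqrt2_0].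
    apply Rdiv_lt_0_compat; [apply cond_pos | exact hK]. }
  exists (mkposreal _ hd). intros w hw.
  apply (C_NormedModule_mixin_compat2 z w) in hw. simpl in hw.
  replace (sqrt 2 * _) with (Rmin 1 (eps / K')) in hw
    by (field; apply Rgt_not_eq, Rlt_sqrt2_0).
  apply C_NormedModule_mixin_compat1.
  change (Cmod (w - z) < Rmin 1 (eps / K')) in hw.
  change (Cmod (f w - f z) < eps).
  assert (h1 := Rmin_l 1 (eps / K')). assert (h2 := Rmin_r 1 (eps / K')).
  apply Rle_lt_trans with (K' * Cmod (w - z)).
  - eapply Rle_trans; [apply h; lra|].
    apply Rmult_le_compat_r; [apply Cmod_ge_0 | apply Rmax_l].
  - replace (pos eps) with (K' * (eps / K')) by (field; lra).
    apply Rmult_lt_compat_l; lra.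
Qed.

(** At w, exp_quot2 differs from its value at 0 by the third Taylor remainder of
    the exponential divided by w^2, hence by O(w). *)
Lemma contC_exp_quot2_0 : @continuous C_UniformSpace C_UniformSpace exp_quot2 (RtoC 0).
Proof.
  apply contC_lipschitz with (exp 1). intros w hw.
  assert (hw0 : (w - 0)%C = w) by ring. rewrite hw0 in *.
  unfold exp_quot2 at 2. destruct (Ceq_dec 0 0) as [_|h]; [|tauto].
  destruct (Ceq_dec w 0) as [->|h0].
  { unfold exp_quot2. destruct (Ceq_dec 0 0) as [_|h]; [|tauto].
    unfold Cminus. rewrite Cplus_opp_r, Cmod_0. lra. }
  assert (hp := proj1 (Cmod_gt_0 w) h0).
  replace (exp_quot2 w - 1 / 2)%C with ((Cexp w - 1 - w - w * w / 2) / (w * w))%C.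
  2:{ unfold exp_quot2, exp_quot. destruct (Ceq_dec w 0); [tauto|]. field. auto. }
  rewrite Cmod_div by now apply Cmult_neq_0. rewrite Cmod_mult.
  apply Rmult_le_reg_r with (Cmod w * Cmod w); [nra|].
  unfold Rdiv. rewrite Rmult_assoc, Rinv_l, Rmult_1_r by nra.
  eapply Rle_trans; [apply Cexp_taylor3|].
  replace (exp 1 * Cmod w * (Cmod w * Cmod w)) with (Cmod w ^ 3 * exp 1) by ring.
  apply Rmult_le_compat_l; [apply pow_le; lra|].
  unfold emax. apply Rmax_lub.
  - rewrite <- exp_0 at 1. left; apply exp_increasing; lra.
  - assert (hr : Re w <= 1).
    { apply Rle_trans with (Rabs (Re w)); [apply Rle_abs|].
      apply Rle_trans with (Cmod w); [apply re_le_Cmod | lra]. }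
    destruct (Rle_lt_or_eq_dec _ _ hr) as [h| ->]; [left; now apply exp_increasing | lra].
Qed.

Lemma contC_exp_quot_0 : @continuous C_UniformSpace C_UniformSpace exp_quot (RtoC 0).
Proof.
  apply (continuous_ext (fun w => 1 + w * exp_quot2 w)%C).
  - intros w. symmetry. apply exp_quot2_spec.
  - apply contC_plus; [apply continuous_const|].
    apply contC_mult; [apply continuous_id | apply contC_exp_quot2_0].
Qed.

(** * Complex derivatives *)

Notation contCC := (@continuous C_UniformSpace C_UniformSpace).

(** Caratheodory's form of the complex derivative.  With it the rules of
    differentiation reduce to algebraic identities between continuous factors. *)
Definition diffC (f : C -> C) (z l : C) : Prop :=
  exists phi : C -> C, contCC phi z /\ phi z = l /\
    forall w, f w = (f z + (w - z) * phi w)%C.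

(** Continuity of the derivative is part of the definition because integrals will
    be differentiated under the integral sign. *)
Definition holo (D : C -> Prop) (f : C -> C) : Prop :=
  exists f' : C -> C, forall z, D z -> diffC f z (f' z) /\ contCC f' z.

Lemma diffC_cont (f : C -> C) (z l : C) : diffC f z l -> contCC f z.
Proof.
  intros (phi & hc & _ & h).
  apply (continuous_ext (fun w => f z + (w - z) * phi w)%C).
  - intros w; symmetry; apply h.
  - apply contC_plus; [apply continuous_const|].
    apply contC_mult; auto. apply contC_minus; [apply continuous_id | apply continuous_const].
Qed.

Lemma holo_cont (D : C -> Prop) (f : C -> C) (z : C) : holo D f -> D z -> contCC f z.
Proof. intros [f' h] hz. destruct (h z hz) as [h1 _]. exact (diffC_cont _ _ _ h1). Qed.

Lemma holo_const (D : C -> Prop) (c : C) : holo D (fun _ => c).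
Proof.
  exists (fun _ => RtoC 0). intros z _. split; [|apply continuous_const].
  exists (fun _ => RtoC 0). split; [apply continuous_const|].
  split; [reflexivity|]. intros w; ring.
Qed.

Lemma holo_id (D : C -> Prop) : holo D (fun z => z).
Proof.
  exists (fun _ => RtoC 1). intros z _. split; [|apply continuous_const].
  exists (fun _ => RtoC 1). split; [apply continuous_const|].
  split; [reflexivity|]. intros w; ring.
Qed.

Lemma holo_plus (D : C -> Prop) (f g : C -> C) :
  holo D f -> holo D g -> holo D (fun z => f z + g z)%C.
Proof.
  intros [f' hf] [g' hg]. exists (fun z => f' z + g' z)%C. intros z hz.
  destruct (hf z hz) as [(p & p1 & p2 & p3) hf'].
  destruct (hg z hz) as [(q & q1 & q2 & q3) hg'].
  split; [|now apply contC_plus].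
  exists (fun w => p w + q w)%C. split; [now apply contC_plus|].
  split; [now rewrite p2, q2|]. intros w. rewrite (p3 w), (q3 w). ring.
Qed.

Lemma diffC_mult (f g : C -> C) (z l m : C) :
  diffC f z l -> diffC g z m -> diffC (fun w => f w * g w)%C z (l * g z + f z * m)%C.
Proof.
  intros hf hg. assert (cg := diffC_cont _ _ _ hg).
  destruct hf as (p & p1 & p2 & p3), hg as (q & q1 & q2 & q3).
  exists (fun w => p w * g w + f z * q w)%C. split; [|split].
  - apply contC_plus; apply contC_mult; auto. apply continuous_const.
  - now rewrite p2, q2.
  - intros w. rewrite (p3 w), (q3 w). ring.
Qed.

Lemma holo_mult (D : C -> Prop) (f g : C -> C) :
  holo D f -> holo D g -> holo D (fun z => f z * g z)%C.
Proof.
  intros hF hG. assert (cf := fun z => holo_cont D f z hF).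
  assert (cg := fun z => holo_cont D g z hG).
  destruct hF as [f' hf], hG as [g' hg]. exists (fun z => f' z * g z + f z * g' z)%C.
  intros z hz. destruct (hf z hz) as [hf1 hf2]. destruct (hg z hz) as [hg1 hg2].
  split; [now apply diffC_mult | apply contC_plus; now apply contC_mult; auto].
Qed.

Lemma contC_neq0 (f : C -> C) (z : C) : contCC f z -> f z <> 0 ->
  locally (z : C_UniformSpace) (fun w => f w <> 0).
Proof.
  intros cf h0.
  assert (h1 := proj1 (filterlim_locally (U := C_UniformSpace) _ _) cf).
  assert (hp := proj1 (Cmod_gt_0 _) h0).
  assert (he : 0 < Cmod (f z) / sqrt 2) by (apply Rdiv_lt_0_compat; [auto|apply Rlt_sqrt2_0]).
  specialize (h1 (mkposreal _ he)). revert h1. apply filter_imp. intros w hw e.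
  apply (C_NormedModule_mixin_compat2 (f z) (f w)) in hw. simpl in hw.
  replace (sqrt 2 * _) with (Cmod (f z)) in hw by (field; apply Rgt_not_eq, Rlt_sqrt2_0).
  change (Cmod (f w - f z) < Cmod (f z)) in hw. rewrite e in hw.
  replace (0 - f z)%C with (- f z)%C in hw by ring. rewrite Cmod_opp in hw. lra.
Qed.

Lemma diffC_inv (f : C -> C) (z l : C) :
  diffC f z l -> f z <> 0 -> diffC (fun w => / f w)%C z (- l * / (f z * f z))%C.
Proof.
  intros hf h0. assert (cf := diffC_cont _ _ _ hf).
  destruct hf as (p & p1 & p2 & p3).
  exists (fun w => if Ceq_dec (f w) 0 then ((/ f w - / f z) / (w - z))%C
                   else (- p w * / (f w * f z))%C).
  split; [|split].
  - apply (continuous_ext_loc _ (fun w => - p w * / (f w * f z))%C).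
    + generalize (contC_neq0 f z cf h0). apply filter_imp. intros w hw.
      destruct (Ceq_dec (f w) 0); tauto.
    + apply contC_mult; [now apply contC_opp|]. apply contC_inv.
      * apply contC_mult; auto. apply continuous_const.
      * now apply Cmult_neq_0.
  - destruct (Ceq_dec (f z) 0); [tauto|]. now rewrite p2.
  - intros w. destruct (Ceq_dec (f w) 0) as [e|hw].
    + destruct (Ceq_dec w z) as [->|hwz]; [tauto|]. rewrite e.
      set (i := (/ 0)%C). set (j := (/ f z)%C). field. now apply Cminus_eq_contra.
    + replace (/ f w)%C with (/ f z + (f z - f w) * / (f w * f z))%C by (field; auto).
      rewrite (p3 w) at 1. ring.
Qed.

Lemma holo_inv (D : C -> Prop) (f : C -> C) :
  holo D f -> (forall z, f z = 0 -> ~ D z) -> holo D (fun z => / f z)%C.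
Proof.
  intros hF hn0. assert (cf := fun z => holo_cont D f z hF).
  assert (hn : forall z, D z -> f z <> 0) by (intros z hz e; exact (hn0 z e hz)).
  destruct hF as [f' hf]. exists (fun z => - f' z * / (f z * f z))%C.
  intros z hz. destruct (hf z hz) as [hf1 hf2]. split.
  - now apply diffC_inv; auto.
  - apply contC_mult; [now apply contC_opp|].
    apply contC_inv; [apply contC_mult; auto | apply Cmult_neq_0; auto].
Qed.

Lemma holo_div (D : C -> Prop) (f g : C -> C) :
  holo D f -> holo D g -> (forall z, g z = 0 -> ~ D z) -> holo D (fun z => f z / g z)%C.
Proof. intros; apply holo_mult; auto. now apply holo_inv. Qed.

Lemma holo_opp (D : C -> Prop) (f : C -> C) : holo D f -> holo D (fun z => - f z)%C.
Proof.
  intros [f' hf]. exists (fun z => - f' z)%C. intros z hz.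
  destruct (hf z hz) as [(p & p1 & p2 & p3) hf'].
  split; [|now apply contC_opp].
  exists (fun w => - p w)%C. split; [now apply contC_opp|].
  split; [now rewrite p2|]. intros w. rewrite (p3 w). ring.
Qed.

Lemma holo_minus (D : C -> Prop) (f g : C -> C) :
  holo D f -> holo D g -> holo D (fun z => f z - g z)%C.
Proof. intros; apply holo_plus; auto. now apply holo_opp. Qed.

Lemma holo_comp (D D' : C -> Prop) (f g : C -> C) :
  holo D g -> holo D' f -> (forall z, D z -> D' (g z)) -> holo D (fun z => f (g z)).
Proof.
  intros hG [f' hf] hD. assert (cg := fun z => holo_cont D g z hG).
  destruct hG as [g' hg]. exists (fun z => f' (g z) * g' z)%C.
  intros z hz. specialize (cg z hz).
  destruct (hg z hz) as [(q & q1 & q2 & q3) hg'].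
  destruct (hf (g z) (hD z hz)) as [(p & p1 & p2 & p3) hf'].
  split; [|apply contC_mult; auto; now apply (continuous_comp g f')].
  exists (fun w => p (g w) * q w)%C. split; [|split].
  - apply contC_mult; auto. now apply (continuous_comp g p).
  - now rewrite p2, q2.
  - intros w. rewrite (p3 (g w)), (q3 w) at 1. ring.
Qed.

Lemma diffC_Cexp (z : C) : diffC Cexp z (Cexp z).
Proof.
  exists (fun w => Cexp z * exp_quot (w - z))%C. split; [|split].
  - apply contC_mult; [apply continuous_const|].
    apply (continuous_comp (fun w => w - z)%C exp_quot).
    + apply contC_minus; [apply continuous_id | apply continuous_const].
    + replace (z - z)%C with (RtoC 0) by ring. apply contC_exp_quot_0.
  - replace (z - z)%C with (RtoC 0) by ring. rewrite exp_quot_0. ring.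
  - intros w. rewrite (Cmult_comm (Cexp z)), Cmult_assoc, exp_quot_spec.
    rewrite Cexp_minus. field. apply Cexp_nz.
Qed.

Lemma holo_Cexp_all : holo (fun _ => True) Cexp.
Proof.
  exists Cexp. intros z _. split; [apply diffC_Cexp | apply contC_Cexp, continuous_id].
Qed.

Lemma holo_Cexp (D : C -> Prop) (f : C -> C) : holo D f -> holo D (fun z => Cexp (f z)).
Proof. intros hf. exact (holo_comp D _ Cexp f hf holo_Cexp_all (fun _ _ => I)). Qed.

Lemma locally_neq (z c : C) : z <> c -> locally (z : C_UniformSpace) (fun w => w <> c).
Proof.
  intros h. generalize (contC_neq0 (fun w => w - c)%C z
    (contC_minus _ _ _ (continuous_id _) (continuous_const _ _)) (Cminus_eq_contra _ _ h)).
  apply filter_imp. intros w hw ->. apply hw. ring.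
Qed.

Lemma Cmult_reg_l (w a b : C) : w <> 0 -> (w * a)%C = (w * b)%C -> a = b.
Proof.
  intros hw h. replace a with (w * a / w)%C by (field; exact hw). rewrite h.
  field. exact hw.
Qed.

(** From w E(w) = e^w - 1 one gets w E'(w) = e^w - E(w), so that E' is E minus the
    divided difference of E at 0; this formula has no singularity at 0. *)
Lemma exp_quot_diff (z : C) : diffC exp_quot z (exp_quot z - exp_quot2 z)%C.
Proof.
  destruct (Ceq_dec z 0) as [->|h].
  - exists exp_quot2. split; [apply contC_exp_quot2_0|]. split.
    + rewrite exp_quot_0. unfold exp_quot2. destruct (Ceq_dec 0 0); [|tauto]. field.
    + intros w. rewrite exp_quot_0, (exp_quot2_spec w). ring.
  - pose (q := fun w => ((Cexp z * exp_quot (w - z) - exp_quot z) / w)%C).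
    assert (hq : contCC q z).
    { apply contC_mult; [|apply contC_inv; auto; apply continuous_id].
      apply contC_minus; [|apply continuous_const].
      apply contC_mult; [apply continuous_const|].
      apply (continuous_comp (fun w => w - z)%C exp_quot).
      - apply contC_minus; [apply continuous_id | apply continuous_const].
      - replace (z - z)%C with (RtoC 0) by ring. apply contC_exp_quot_0. }
    exists (fun w => if Ceq_dec w 0 then ((exp_quot 0 - exp_quot z) / (0 - z))%C else q w).
    split; [|split].
    + apply (continuous_ext_loc _ q); [|exact hq].
      generalize (locally_neq z 0 h). apply filter_imp. intros w hw.
      destruct (Ceq_dec w 0); tauto.
    + destruct (Ceq_dec z 0); [tauto|]. unfold q.
      replace (z - z)%C with (RtoC 0) by ring. rewrite exp_quot_0.
      replace (Cexp z) with (1 + z * exp_quot z)%C by (rewrite exp_quot_spec; ring).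
      rewrite (exp_quot2_spec z). field. exact h.
    + intros w. destruct (Ceq_dec w 0) as [->|hw]; unfold q.
      * field. intros e. apply h. replace z with (- (0 - z))%C by ring. 
        unfold Cminus in *. rewrite e. ring.
      * apply (Cmult_reg_l w); [exact hw|]. rewrite exp_quot_spec.
        replace (w * (exp_quot z + (w - z) * ((Cexp z * exp_quot (w - z) - exp_quot z) / w)))%C
          with (z * exp_quot z + Cexp z * ((w - z) * exp_quot (w - z)))%C by (field; exact hw).
        rewrite !exp_quot_spec, Cexp_minus. field. apply Cexp_nz.
Qed.

Lemma contC_exp_quot (z : C) : contCC exp_quot z.
Proof. exact (diffC_cont _ _ _ (exp_quot_diff z)). Qed.

Lemma contC_exp_quot2 (z : C) : contCC exp_quot2 z.
Proof.
  destruct (Ceq_dec z 0) as [->|h]; [apply contC_exp_quot2_0|].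
  apply (continuous_ext_loc _ (fun w => (exp_quot w - 1) / w)%C).
  - generalize (locally_neq z 0 h). apply filter_imp. intros w hw.
    unfold exp_quot2. destruct (Ceq_dec w 0); tauto.
  - apply contC_mult.
    + apply contC_minus; [apply contC_exp_quot | apply continuous_const].
    + apply contC_inv; auto. apply continuous_id.
Qed.

Lemma holo_exp_quot_all : holo (fun _ => True) exp_quot.
Proof.
  exists (fun z => exp_quot z - exp_quot2 z)%C. intros z _. split; [apply exp_quot_diff|].
  apply contC_minus; [apply contC_exp_quot | apply contC_exp_quot2].
Qed.

Lemma holo_exp_quot (D : C -> Prop) (f : C -> C) : holo D f -> holo D (fun z => exp_quot (f z)).
Proof. intros hf. exact (holo_comp D _ exp_quot f hf holo_exp_quot_all (fun _ _ => I)). Qed.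

(** The zeros of e^w - 1 are the multiples of 2 PI i, and the one at 0 has been
    divided out. *)
Lemma exp_quot_nz (w : C) : Rabs (Im w) < 2 * PI -> exp_quot w <> 0.
Proof.
  intros hw. unfold exp_quot. destruct (Ceq_dec w 0) as [_|h].
  { intros e; apply (f_equal fst) in e; simpl in e; lra. }
  intros e. assert (e1 : Cexp w = 1).
  { replace (Cexp w) with (1 + w * ((Cexp w - 1) / w))%C by (field; exact h).
    rewrite e. ring. }
  apply h. assert (hr : Re w = 0).
  { apply exp_inv. rewrite <- Cmod_Cexp, e1, Cmod_1, exp_0. reflexivity. }
  assert (hc : cos (Im w) = 1).
  { apply (f_equal fst) in e1. unfold Cexp in e1; simpl in e1. rewrite hr, exp_0 in e1. lra. }
  assert (hi : Im w = 0).
  { replace (Im w) with (2 * (Im w / 2)) in hc by field.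
    rewrite cos_2a_sin in hc.
    assert (hs : sin (Im w / 2) = 0) by nra.
    destruct (Rtotal_order (Im w) 0) as [hl|[he|hl]]; [|exact he|].
    - rewrite Rabs_left in hw by lra.
      assert (hp := sin_gt_0 (- (Im w / 2)) ltac:(lra) ltac:(lra)). rewrite sin_neg in hp. lra.
    - rewrite Rabs_right in hw by lra.
      assert (hp := sin_gt_0 (Im w / 2) ltac:(lra) ltac:(lra)). lra. }
  apply injective_projections; [exact hr | exact hi].
Qed.

Lemma derC_line (f : C -> C) (g : R -> C) (t : R) (v l : C) :
  diffC f (g t) l -> (forall s, g s = (g t + RtoC (s - t) * v)%C) ->
  derC (fun s => f (g s)) t (v * l)%C.
Proof.
  intros (phi & hc & hl & h) hg.
  assert (hgc : contC g t).
  { apply (continuous_ext (fun s => g t + RtoC (s - t) * v)%C); [now intros s; rewrite <- hg|].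
    apply contC_plus; [apply continuous_const|].
    apply contC_mult; [|apply continuous_const]. apply contC_RtoC.
    apply cont_Rminus; [apply continuous_id | apply continuous_const]. }
  rewrite <- hl.
  apply (is_derive_factor (fun s => f (g s)) (fun s => v * phi (g s))%C).
  - apply contC_mult; [apply continuous_const|]. now apply (continuous_comp g phi).
  - intros s. rewrite (h (g s)), (hg s) at 1.  ring.
Qed.

(** * Integrals of complex-valued functions *)

Lemma derC_Re (f : R -> C) (t : R) (l : C) :
  derC f t l -> is_derive (fun s => Re (f s)) t (Re l).
Proof.
  intros h.
  unfold is_derive.
  apply (filterdiff_ext_lin (K := R_AbsRing) (U := R_NormedModule) (V := R_NormedModule) _
    (fun y : R => fst (scal y (l : C_R_NormedModule)))).
  - apply (filterdiff_comp' f (fun z : C_R_NormedModule => fst z) t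
      (fun y : R => scal y (l : C_R_NormedModule)) (fun z => fst z)); [exact h|].
    apply filterdiff_linear, is_linear_fst.
  - intros y. reflexivity.
Qed.

Lemma derC_Im (f : R -> C) (t : R) (l : C) :
  derC f t l -> is_derive (fun s => Im (f s)) t (Im l).
Proof.
  intros h.
  unfold is_derive.
  apply (filterdiff_ext_lin (K := R_AbsRing) (U := R_NormedModule) (V := R_NormedModule) _
    (fun y : R => snd (scal y (l : C_R_NormedModule)))).
  - apply (filterdiff_comp' f (fun z : C_R_NormedModule => snd z) t
      (fun y : R => scal y (l : C_R_NormedModule)) (fun z => snd z)); [exact h|].
    apply filterdiff_linear, is_linear_snd.
  - intros y. reflexivity.
Qed.

Notation exRIC := (@ex_RInt C_R_NormedModule).

Lemma exRIC_cont (f : R -> C) (a b : R) :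
  a <= b -> (forall t, a <= t <= b -> contC f t) -> exRIC f a b.
Proof.
  intros hab h. apply (ex_RInt_continuous (V := C_R_CompleteNormedModule)).
  intros t. rewrite Rmin_left, Rmax_right by lra. apply h.
Qed.

Lemma isRIC_RIC (f : R -> C) (a b : R) : exRIC f a b -> isRIC f a b (RIC f a b).
Proof. apply (RInt_correct (V := C_R_CompleteNormedModule)). Qed.

Lemma RIC_unique (f : R -> C) (a b : R) (l : C) : isRIC f a b l -> RIC f a b = l.
Proof. apply (is_RInt_unique (V := C_R_CompleteNormedModule)). Qed.

Lemma RIC_pair (f : R -> C) (a b : R) : exRIC f a b ->
  RIC f a b = (RInt (fun t => Re (f t)) a b, RInt (fun t => Im (f t)) a b).
Proof.
  intros h. apply isRIC_RIC in h. symmetry. apply injective_projections; simpl.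
  - apply (is_RInt_unique (V := R_CompleteNormedModule)).
    apply (is_RInt_fct_extend_fst (U := R_NormedModule) (V := R_NormedModule) f _ _ _ h).
  - apply (is_RInt_unique (V := R_CompleteNormedModule)).
    apply (is_RInt_fct_extend_snd (U := R_NormedModule) (V := R_NormedModule) f _ _ _ h).
Qed.

Lemma RIC_ext (f g : R -> C) (a b : R) :
  a <= b -> (forall t, a <= t <= b -> f t = g t) -> RIC f a b = RIC g a b.
Proof.
  intros hab h. apply (RInt_ext (V := C_R_CompleteNormedModule)).
  intros t. rewrite Rmin_left, Rmax_right by lra. intros ht. apply h; lra.
Qed.

Lemma isRIC_scal (f : R -> C) (a b : R) (k l : C) :
  isRIC f a b l -> isRIC (fun t => (k * f t)%C) a b (k * l)%C.
Proof.
  intros h.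
  assert (h1 := is_RInt_fct_extend_fst (U := R_NormedModule) (V := R_NormedModule) f _ _ _ h).
  assert (h2 := is_RInt_fct_extend_snd (U := R_NormedModule) (V := R_NormedModule) f _ _ _ h).
  apply (is_RInt_fct_extend_pair (U := R_NormedModule) (V := R_NormedModule)).
  - apply (is_RInt_minus (V := R_NormedModule)); now apply (is_RInt_scal (V := R_NormedModule)).
  - apply (is_RInt_plus (V := R_NormedModule)); now apply (is_RInt_scal (V := R_NormedModule)).
Qed.

Lemma isRIC_plus (f g : R -> C) (a b : R) (l m : C) :
  isRIC f a b l -> isRIC g a b m -> isRIC (fun t => (f t + g t)%C) a b (l + m)%C.
Proof. apply (is_RInt_plus (V := C_R_NormedModule)). Qed.

Lemma RIC_scal (f : R -> C) (a b : R) (k : C) :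
  exRIC f a b -> RIC (fun t => (k * f t)%C) a b = (k * RIC f a b)%C.
Proof. intros h. apply RIC_unique, isRIC_scal, isRIC_RIC, h. Qed.

Lemma RIC_plus (f g : R -> C) (a b : R) :
  exRIC f a b -> exRIC g a b ->
  RIC (fun t => (f t + g t)%C) a b = (RIC f a b + RIC g a b)%C.
Proof. intros hf hg. apply RIC_unique, isRIC_plus; now apply isRIC_RIC. Qed.

Lemma RIC_bound (f : R -> C) (a b M : R) :
  a <= b -> exRIC f a b -> (forall t, a <= t <= b -> Cmod (f t) <= M) ->
  Cmod (RIC f a b) <= (b - a) * M.
Proof.
  intros hab he hb. rewrite <- norm_C_Cmod.
  apply (norm_RInt_le_const (V := C_R_NormedModule) f a b _ M hab).
  - intros t ht. rewrite norm_C_Cmod. now apply hb.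
  - now apply isRIC_RIC.
Qed.

Lemma derC_Cmult_l (f : R -> C) (t : R) (k l : C) :
  derC f t l -> derC (fun s => (k * f s)%C) t (k * l)%C.
Proof.
  intros h. assert (h1 := derC_Re _ _ _ h). assert (h2 := derC_Im _ _ _ h).
  apply (derC_pair (fun s => Re k * Re (f s) - Im k * Im (f s)) (fun s => Re k * Im (f s) + Im k * Re (f s))).
  - apply (is_derive_minus (V := R_NormedModule)); now apply is_derive_scal.
  - apply (is_derive_plus (V := R_NormedModule)); now apply is_derive_scal.
Qed.

(** The derivative is prescribed on a neighbourhood of {s0} x [a, b], so that it
    coincides with the one computed by Derive wherever continuity is tested. *)
Lemma is_derive_RInt_param_near (f df : R -> R -> R) (s0 a b del : R) :
  a <= b -> 0 < del ->
  (forall s t, Rabs (s - s0) < del -> a - del < t < b + del ->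
     is_derive (fun s => f s t) s (df s t)) ->
  (forall t, a <= t <= b ->
     @continuous (prod_UniformSpace R_UniformSpace R_UniformSpace) R_UniformSpace
       (fun q : R * R => df (fst q) (snd q)) (s0, t)) ->
  (forall s t, Rabs (s - s0) < del -> a <= t <= b -> continuous (f s) t) ->
  is_derive (fun s => RInt (f s) a b) s0 (RInt (df s0) a b).
Proof.
  intros hab hdel hd hdc hc.
  assert (hnear : locally s0 (fun s => Rabs (s - s0) < del)).
  { exists (mkposreal _ hdel). intros s hs. exact hs. }
  assert (h0 : Rabs (s0 - s0) < del) by (rewrite Rminus_diag, Rabs_R0; exact hdel).
  rewrite (RInt_ext (V := R_CompleteNormedModule) (df s0) (fun t => Derive (fun u => f u t) s0)).
  2:{ intros t. rewrite Rmin_left, Rmax_right by lra. intros ht. symmetry.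
      apply is_derive_unique, hd; auto; lra. }
  apply (is_derive_RInt_param f).
  - revert hnear. apply filter_imp. intros s hs t. rewrite Rmin_left, Rmax_right by lra.
    intros ht. exists (df s t). apply hd; auto; lra.
  - intros t. rewrite Rmin_left, Rmax_right by lra. intros ht.
    apply (proj2 (continuity_2d_pt_filterlim _ _ _)).
    change (@continuous (prod_UniformSpace R_UniformSpace R_UniformSpace) R_UniformSpace
       (fun q : R * R => Derive (fun z => f z (snd q)) (fst q)) (s0, t)).
    apply (continuous_ext_loc _ (fun q : R * R => df (fst q) (snd q))); [|now apply hdc].
    exists (mkposreal _ hdel). intros [s u] [h1 h2]. simpl in *.
    unfold ball in h1, h2; simpl in h1, h2.
    unfold AbsRing_ball, abs, minus, plus, opp in h1, h2; simpl in h1, h2.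
    apply Rabs_def2 in h2. symmetry. apply is_derive_unique, hd; [exact h1 | lra].
  - revert hnear. apply filter_imp. intros s hs. apply (ex_RInt_continuous (V := R_CompleteNormedModule)).
    intros t. rewrite Rmin_left, Rmax_right by lra. intros ht. now apply hc.
Qed.

Lemma derC_RIC_param (f df : R -> R -> C) (s0 a b del : R) :
  a <= b -> 0 < del ->
  (forall s t, Rabs (s - s0) < del -> a - del < t < b + del ->
     derC (fun s => f s t) s (df s t)) ->
  (forall t, a <= t <= b -> contC (fun q : R * R => df (fst q) (snd q)) (s0, t)) ->
  (forall s t, Rabs (s - s0) < del -> a <= t <= b -> contC (f s) t) ->
  derC (fun s => RIC (f s) a b) s0 (RIC (df s0) a b).
Proof.
  intros hab hdel hd hdc hc.
  rewrite RIC_pair.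
  2:{ apply exRIC_cont; auto. intros t ht.
      apply (continuous_comp (fun t : R => (s0, t) : C) (fun q : R * R => df (fst q) (snd q)));
        [apply contC_pair; [apply continuous_const | apply continuous_id] | now apply hdc]. }
  apply (is_derive_ext_loc
    (fun s => (RInt (fun t => Re (f s t)) a b, RInt (fun t => Im (f s t)) a b) : C)).
  { exists (mkposreal _ hdel). intros s hs. symmetry. apply RIC_pair, exRIC_cont; auto. }
  apply derC_pair.
  - apply (is_derive_RInt_param_near (fun s t => Re (f s t)) (fun s t => Re (df s t)) s0 a b del); auto.
    + intros s t hs ht. apply (derC_Re (fun s => f s t)). now apply hd.
    + intros t ht. now apply contC_Re, hdc.
    + intros s t hs ht. now apply contC_Re, hc.
  - apply (is_derive_RInt_param_near (fun s t => Im (f s t)) (fun s t => Im (df s t)) s0 a b del); auto.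
    + intros s t hs ht. apply (derC_Im (fun s => f s t)). now apply hd.
    + intros t ht. now apply contC_Im, hdc.
    + intros s t hs ht. now apply contC_Im, hc.
Qed.

Lemma RtoC_nz (r : R) : r <> 0 -> RtoC r <> 0.
Proof. intros h e. apply h. now apply RtoC_inj. Qed.

(** Knowing s l = 0 settles the derivative for s <> 0 only; at s = 0 mere
    differentiability is used, for continuity. *)
Lemma homotopy_const (F : R -> C) :
  (forall s, 0 <= s <= 1 -> exists l : C, derC F s l /\ (s * l)%C = 0) -> F 1 = F 0.
Proof.
  intros h.
  assert (hc : forall s, 0 < s < 1 -> derC F s (RtoC 0)).
  { intros s hs. destruct (h s ltac:(lra)) as [l [h1 h2]].
    replace (RtoC 0) with l; [exact h1|].
    apply (Cmult_reg_l s); [apply RtoC_nz; lra|]. rewrite h2. ring. }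
  apply injective_projections.
  - destruct (MVT_gen (fun s => Re (F s)) 0 1 (fun _ => 0)) as [x [_ hx]].
    + intros s. rewrite Rmin_left, Rmax_right by lra. intros hs. exact (derC_Re _ _ _ (hc s hs)).
    + intros s. rewrite Rmin_left, Rmax_right by lra. intros hs.
      destruct (h s hs) as [l [h1 _]]. apply derC_Re in h1.
      apply continuity_pt_filterlim. apply (ex_derive_continuous (V := R_NormedModule)). now exists (Re l).
    + unfold Re in hx. lra.
  - destruct (MVT_gen (fun s => Im (F s)) 0 1 (fun _ => 0)) as [x [_ hx]].
    + intros s. rewrite Rmin_left, Rmax_right by lra. intros hs. exact (derC_Im _ _ _ (hc s hs)).
    + intros s. rewrite Rmin_left, Rmax_right by lra. intros hs.
      destruct (h s hs) as [l [h1 _]]. apply derC_Im in h1.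
      apply continuity_pt_filterlim. apply (ex_derive_continuous (V := R_NormedModule)). now exists (Im l).
    + unfold Im in hx. lra.
Qed.

(** * Cauchy's formula on a rectangle *)

Definition hint (f : C -> C) (y a b : R) : C := RIC (fun r => f (r, y)) a b.
Definition vint (f : C -> C) (x c d : R) : C := (Ci * RIC (fun t => f (x, t)) c d)%C.

(** The boundary of [a, b] x [c, d] is traversed counterclockwise. *)
Definition rint (f : C -> C) (a b c d : R) : C :=
  (hint f c a b + vint f b c d - hint f d a b - vint f a c d)%C.

Definition on_rect (a b c d : R) (u : C) : Prop :=
  a <= Re u <= b /\ c <= Im u <= d /\ (Re u = a \/ Re u = b \/ Im u = c \/ Im u = d).

Definition open_rect (a b c d : R) (u : C) : Prop := a < Re u < b /\ c < Im u < d.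

(** Scale the path g towards p by the factor s.  The derivative of
    h(p + s (g - p)) / (g - p) in s has no denominator left, and s times it is the
    derivative of h(p + s (g - p)) along the path: the contribution of an edge
    depends on its end points only, and the edges of a rectangle cancel out. *)
Lemma edge_homotopy (D : C -> Prop) (h : C -> C) (p v : C) (g : R -> C) (s0 t0 t1 del : R) :
  t0 <= t1 -> 0 < del -> holo D h ->
  (forall t t', g t' = (g t + RtoC (t' - t) * v)%C) ->
  (forall t, t0 <= t <= t1 -> g t <> p) ->
  (forall s t, Rabs (s - s0) < del -> t0 - del < t < t1 + del -> D (p + s * (g t - p))%C) ->
  exists l : C,
    derC (fun s => v * RIC (fun t => h (p + RtoC s * (g t - p)) / (g t - p)) t0 t1)%C s0 l /\
    (s0 * l)%C = (h (p + s0 * (g t1 - p)) - h (p + s0 * (g t0 - p)))%C.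
Proof.
  intros ht hdel hh hg hp hD. assert (hhc := fun z => holo_cont D h z hh).
  destruct hh as [h' hh].
  assert (hgc : forall t, contC g t).
  { intros t. apply (continuous_ext (fun s => g t + RtoC (s - t) * v)%C); [now intros s; rewrite <- hg|].
    apply contC_plus; [apply continuous_const|].
    apply contC_mult; [|apply continuous_const]. apply contC_RtoC.
    apply cont_Rminus; [apply continuous_id | apply continuous_const]. }
  assert (h00 : Rabs (s0 - s0) < del) by (rewrite Rminus_diag, Rabs_R0; exact hdel).
  exists (v * RIC (fun t => h' (p + RtoC s0 * (g t - p)) * ((g t - p) / (g t - p))) t0 t1)%C.
  split.
  - assert (hd := derC_RIC_param (fun s t => h (p + RtoC s * (g t - p)) / (g t - p))%C
       (fun s t => h' (p + RtoC s * (g t - p)) * ((g t - p) / (g t - p)))%C s0 t0 t1 del ht hdel).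
    match type of hd with _ -> _ -> _ -> ?X => assert (hd' : X) end.
    { apply hd.
      - intros s t hs htt.
        replace (h' (p + s * (g t - p)) * ((g t - p) / (g t - p)))%C
          with (/ (g t - p) * ((g t - p) * h' (p + s * (g t - p))))%C by (unfold Cdiv; ring).
        apply (is_derive_ext (fun s => / (g t - p) * h (p + RtoC s * (g t - p)))%C).
        { intros u. asC. unfold Cdiv. ring. }
        apply derC_Cmult_l.
        apply (derC_line h (fun s => p + RtoC s * (g t - p))%C).
        + apply hh. now apply hD.
        + intros u. rewrite RtoC_minus. ring.
      - intros t htt. apply contC_mult.
        + apply (continuous_comp (fun q : R * R => p + RtoC (fst q) * (g (snd q) - p))%C h').
          * apply contC_plus; [apply continuous_const|]. apply contC_mult.
            -- apply contC_RtoC. apply (continuous_fst (U := R_UniformSpace) (V := R_UniformSpace)).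
            -- apply contC_minus; [|apply continuous_const].
               apply (continuous_comp (fun q : R * R => snd q) g).
               ++ apply (continuous_snd (U := R_UniformSpace) (V := R_UniformSpace)).
               ++ apply hgc.
          * apply hh. apply hD; auto. simpl. lra.
        + assert (hs : contC (fun q : R * R => g (snd q) - p)%C (s0, t)).
          { apply contC_minus; [|apply continuous_const].
            apply (continuous_comp (fun q : R * R => snd q) g).
            - apply (continuous_snd (U := R_UniformSpace) (V := R_UniformSpace)).
            - apply hgc. }
          apply contC_mult; auto. apply contC_inv; auto. simpl. now apply Cminus_eq_contra, hp.
      - intros s t hs htt. apply contC_mult.
        + apply (continuous_comp (fun t => p + RtoC s * (g t - p))%C h).
          * apply contC_plus; [apply continuous_const|]. apply contC_mult; [apply continuous_const|].
            apply contC_minus; [apply hgc | apply continuous_const].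
          * apply hhc. apply hD; auto; lra.
        + apply contC_inv.
          * apply contC_minus; [apply hgc | apply continuous_const].
          * now apply Cminus_eq_contra, hp. }
    now apply derC_Cmult_l.
  - rewrite (RIC_ext _ (fun t => h' (p + RtoC s0 * (g t - p)))%C); auto.
    2:{ intros t htt. field. now apply Cminus_eq_contra, hp. }
    rewrite Cmult_assoc, <- RIC_scal.
    + apply RIC_unique.
      apply (is_RInt_derive (V := C_R_CompleteNormedModule) (fun t => h (p + RtoC s0 * (g t - p)))%C).
      * intros t. rewrite Rmin_left, Rmax_right by lra. intros htt.
        apply (derC_line h (fun t => p + RtoC s0 * (g t - p))%C).
        -- apply hh, hD; auto; lra.
        -- intros u. rewrite (hg t u). ring.
      * intros t. rewrite Rmin_left, Rmax_right by lra. intros htt.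
        apply contC_mult; [apply continuous_const|].
        apply (continuous_comp (fun t => p + RtoC s0 * (g t - p))%C h').
        -- apply contC_plus; [apply continuous_const|]. apply contC_mult; [apply continuous_const|].
           apply contC_minus; [apply hgc | apply continuous_const].
        -- apply hh, hD; auto; lra.
    + apply exRIC_cont; auto. intros t htt.
      apply (continuous_comp (fun t => p + RtoC s0 * (g t - p))%C h').
      * apply contC_plus; [apply continuous_const|]. apply contC_mult; [apply continuous_const|].
        apply contC_minus; [apply hgc | apply continuous_const].
      * apply hh, hD; auto; lra.
Qed.

(** A rectangle contains its images under homotheties of ratio s in [0, 1] centred
    at an inner point; this version, with margins, covers a neighbourhood of
    [0, 1] and slightly longer edges. *)
Lemma homothety_between (a b q t s del m : R) :
  0 < m -> a < b -> 0 < del <= 1 -> del * (b - a + 3) < m -> a <= q <= b ->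
  a - del < t < b + del -> - del < s < 1 + del -> a - m < q + s * (t - q) < b + m.
Proof.
  intros hm hab hd hdm hq ht hs.
  assert (h1 : Rabs (t - q) < b - a + del) by (apply Rabs_def1; lra).
  apply Rabs_def2 in h1.
  split; destruct (Rle_dec 0 (t - q)); destruct (Rle_dec 0 s); nra.
Qed.

(** The integrand is i / (k + i (t - q)), and the antiderivative is the logarithm
    of k + i (t - q) in real coordinates, up to a constant when k < 0. *)
Lemma RIC_log_kernel (k q c d : R) : k <> 0 ->
  isRIC (fun t => ((t - q) / (k ^ 2 + (t - q) ^ 2), k / (k ^ 2 + (t - q) ^ 2)) : C) c d
   (Cminus (/ 2 * ln (k ^ 2 + (d - q) ^ 2), atan ((d - q) / k))
     (/ 2 * ln (k ^ 2 + (c - q) ^ 2), atan ((c - q) / k))).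
Proof.
  intros hk.
  assert (hp : forall t, 0 < k ^ 2 + (t - q) ^ 2).
  { intros t. assert (0 < k ^ 2) by (apply pow2_gt_0; auto). assert (h := pow2_ge_0 (t - q)). lra. }
  apply (is_RInt_derive (V := C_R_CompleteNormedModule)
    (fun t => (/ 2 * ln (k ^ 2 + (t - q) ^ 2), atan ((t - q) / k)) : C)).
  - intros t _. specialize (hp t). apply derC_pair.
    + auto_derive; [lra|]. field. lra.
    + auto_derive; [auto|]. field. simpl in hp. repeat split; nra.
  - intros t _. apply contC_pair.
    + apply (ex_derive_continuous (V := R_NormedModule)). auto_derive. specialize (hp t). simpl in hp. lra.
    + apply (ex_derive_continuous (V := R_NormedModule)). auto_derive. specialize (hp t). simpl in hp. lra.
Qed.

Lemma atan_pair (u v : R) : 0 < u -> 0 < v -> atan (u / v) + atan (v / u) = PI / 2.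
Proof.
  intros hu hv. assert (h : 0 < u / v) by (apply Rdiv_lt_0_compat; auto).
  replace (v / u) with (/ (u / v)) by (field; lra).
  rewrite atan_inv by auto. ring.
Qed.

(** The logarithms of the distances from p to the corners cancel, and at each corner
    two arctangents of inverse ratios add up to PI/2. *)
Lemma rint_inv (a b c d : R) (p : C) :
  a < Re p < b -> c < Im p < d ->
  rint (fun u => / (u - p))%C a b c d = (2 * PI * Ci)%C.
Proof.
  destruct p as [p1 p2]. unfold Re, Im; simpl. intros h1 h2.
  unfold rint, hint, vint.
  assert (hb := RIC_unique _ _ _ _ (RIC_log_kernel (p2 - c) p1 a b ltac:(lra))).
  assert (ht := RIC_unique _ _ _ _ (RIC_log_kernel (p2 - d) p1 a b ltac:(lra))).
  assert (hr := RIC_log_kernel (b - p1) p2 c d ltac:(lra)).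
  assert (hl := RIC_log_kernel (a - p1) p2 c d ltac:(lra)).
  apply (isRIC_scal _ _ _ (- Ci)), RIC_unique in hr.
  apply (isRIC_scal _ _ _ (- Ci)), RIC_unique in hl.
  assert (pos : forall k t, k <> 0 -> k * k + t * t <> 0).
  { intros k t hk. assert (0 < k * k) by nra. nra. }
  rewrite (RIC_ext (fun r => / ((r, c) - (p1, p2)))%C
    (fun t => ((t - p1) / ((p2 - c) ^ 2 + (t - p1) ^ 2), (p2 - c) / ((p2 - c) ^ 2 + (t - p1) ^ 2)) : C));
   [|lra|].
  2:{ intros t _. assert (h := pos (p2 - c) (t - p1) ltac:(lra)).
      unfold Cinv, Cminus, Cplus, Copp; simpl. f_equal; field; nra. }
  rewrite (RIC_ext (fun r => / ((r, d) - (p1, p2)))%C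
    (fun t => ((t - p1) / ((p2 - d) ^ 2 + (t - p1) ^ 2), (p2 - d) / ((p2 - d) ^ 2 + (t - p1) ^ 2)) : C));
   [|lra|].
  2:{ intros t _. assert (h := pos (p2 - d) (t - p1) ltac:(lra)).
      unfold Cinv, Cminus, Cplus, Copp; simpl. f_equal; field; nra. }
  rewrite (RIC_ext (fun t => / ((b, t) - (p1, p2)))%C
    (fun t => Cmult (- Ci) ((t - p2) / ((b - p1) ^ 2 + (t - p2) ^ 2), (b - p1) / ((b - p1) ^ 2 + (t - p2) ^ 2))));
   [|lra|].
  2:{ intros t _. assert (h := pos (b - p1) (t - p2) ltac:(lra)).
      unfold Cinv, Cminus, Cplus, Copp, Cmult, Ci; simpl. f_equal; field; nra. }
  rewrite (RIC_ext (fun t => / ((a, t) - (p1, p2)))%C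
    (fun t => Cmult (- Ci) ((t - p2) / ((a - p1) ^ 2 + (t - p2) ^ 2), (a - p1) / ((a - p1) ^ 2 + (t - p2) ^ 2))));
   [|lra|].
  2:{ intros t _. assert (h := pos (a - p1) (t - p2) ltac:(lra)).
      unfold Cinv, Cminus, Cplus, Copp, Cmult, Ci; simpl. f_equal; field; nra. }
  rewrite hb, ht, hr, hl. clear hb ht hr hl.
  assert (neg : forall u v, v <> 0 -> atan (u / - v) = - atan (u / v)).
  { intros u v hv. rewrite <- atan_opp. f_equal. field. auto. }
  assert (neg' : forall u v, v <> 0 -> atan (- u / v) = - atan (u / v)).
  { intros u v hv. rewrite <- atan_opp. f_equal. field. auto. }
  assert (A1 := atan_pair (b - p1) (p2 - c) ltac:(lra) ltac:(lra)).
  assert (A2 := atan_pair (p1 - a) (p2 - c) ltac:(lra) ltac:(lra)).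
  assert (A3 := atan_pair (b - p1) (d - p2) ltac:(lra) ltac:(lra)).
  assert (A4 := atan_pair (p1 - a) (d - p2) ltac:(lra) ltac:(lra)).
  replace (a - p1) with (- (p1 - a)) in * by ring.
  replace (c - p2) with (- (p2 - c)) in * by ring.
  replace (p2 - d) with (- (d - p2)) in * by ring.
  replace ((- (p1 - a)) ^ 2) with ((p1 - a) ^ 2) by ring.
  replace ((- (p2 - c)) ^ 2) with ((p2 - c) ^ 2) by ring.
  replace ((- (d - p2)) ^ 2) with ((d - p2) ^ 2) by ring.
  rewrite !neg, !neg' by lra.
  rewrite (Rplus_comm ((b - p1) ^ 2) ((d - p2) ^ 2)), (Rplus_comm ((b - p1) ^ 2) ((p2 - c) ^ 2)).
  rewrite (Rplus_comm ((p1 - a) ^ 2) ((d - p2) ^ 2)), (Rplus_comm ((p1 - a) ^ 2) ((p2 - c) ^ 2)).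
  unfold Cminus, Cplus, Copp, Cmult, Ci, RtoC; simpl.
  apply injective_projections; simpl; lra.
Qed.

Lemma C_pair_line_h (y t t' : R) : (t', y) = ((t, y) + RtoC (t' - t) * 1)%C.
Proof. unfold Cplus, Cmult, RtoC; simpl. f_equal; ring. Qed.

Lemma C_pair_line_v (x t t' : R) : (x, t') = ((x, t) + RtoC (t' - t) * Ci)%C.
Proof. unfold Cplus, Cmult, Ci, RtoC; simpl. f_equal; ring. Qed.

Lemma contC_h (f : C -> C) (y t : R) : contCC f (t, y) -> contC (fun r => f (r, y)) t.
Proof.
  intros h. apply (continuous_comp (fun r => (r, y) : C) f); [|exact h].
  apply contC_pair; [apply continuous_id | apply continuous_const].
Qed.

Lemma contC_v (f : C -> C) (x t : R) : contCC f (x, t) -> contC (fun r => f (x, r)) t.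
Proof.
  intros h. apply (continuous_comp (fun r => (x, r) : C) f); [|exact h].
  apply contC_pair; [apply continuous_const | apply continuous_id].
Qed.

Lemma hint_plus (f g : C -> C) (y a b : R) : a <= b ->
  (forall t, a <= t <= b -> contCC f (t, y)) -> (forall t, a <= t <= b -> contCC g (t, y)) ->
  hint (fun u => f u + g u)%C y a b = (hint f y a b + hint g y a b)%C.
Proof.
  intros hab hf hg. apply RIC_plus; apply exRIC_cont; auto; intros; apply contC_h; auto.
Qed.

Lemma vint_plus (f g : C -> C) (y a b : R) : a <= b ->
  (forall t, a <= t <= b -> contCC f (y, t)) -> (forall t, a <= t <= b -> contCC g (y, t)) ->
  vint (fun u => f u + g u)%C y a b = (vint f y a b + vint g y a b)%C.
Proof.
  intros hab hf hg. unfold vint. rewrite <- Cmult_plus_distr_l. f_equal.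
  apply RIC_plus; apply exRIC_cont; auto; intros; apply contC_v; auto.
Qed.

Lemma hint_scal (f : C -> C) (k : C) (y a b : R) : a <= b ->
  (forall t, a <= t <= b -> contCC f (t, y)) ->
  hint (fun u => k * f u)%C y a b = (k * hint f y a b)%C.
Proof. intros hab hf. apply RIC_scal, exRIC_cont; auto; intros; apply contC_h; auto. Qed.

Lemma vint_scal (f : C -> C) (k : C) (y a b : R) : a <= b ->
  (forall t, a <= t <= b -> contCC f (y, t)) ->
  vint (fun u => k * f u)%C y a b = (k * vint f y a b)%C.
Proof.
  intros hab hf. unfold vint. rewrite RIC_scal; [ring|].
  apply exRIC_cont; auto; intros; apply contC_v; auto.
Qed.

Lemma hint_ext (f g : C -> C) (y a b : R) : a <= b ->
  (forall t, a <= t <= b -> f (t, y) = g (t, y)) -> hint f y a b = hint g y a b.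
Proof. intros. now apply RIC_ext. Qed.

Lemma vint_ext (f g : C -> C) (y a b : R) : a <= b ->
  (forall t, a <= t <= b -> f (y, t) = g (y, t)) -> vint f y a b = vint g y a b.
Proof. intros. unfold vint. f_equal. now apply RIC_ext. Qed.

Ltac onr := unfold on_rect, Re, Im; simpl; lra.

Lemma rint_ext (f g : C -> C) (a b c d : R) : a <= b -> c <= d ->
  (forall u, on_rect a b c d u -> f u = g u) -> rint f a b c d = rint g a b c d.
Proof.
  intros hab hcd h. unfold rint.
  rewrite (hint_ext f g c a b), (hint_ext f g d a b), (vint_ext f g a c d), (vint_ext f g b c d);
    auto; intros t ht; apply h; onr.
Qed.

Lemma rint_plus (f g : C -> C) (a b c d : R) : a <= b -> c <= d ->
  (forall u, on_rect a b c d u -> contCC f u) -> (forall u, on_rect a b c d u -> contCC g u) ->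
  rint (fun u => f u + g u)%C a b c d = (rint f a b c d + rint g a b c d)%C.
Proof.
  intros hab hcd hf hg. unfold rint.
  rewrite !hint_plus, !vint_plus; try ring; auto; intros t ht; (apply hf || apply hg); onr.
Qed.

Lemma rint_scal (f : C -> C) (k : C) (a b c d : R) : a <= b -> c <= d ->
  (forall u, on_rect a b c d u -> contCC f u) ->
  rint (fun u => k * f u)%C a b c d = (k * rint f a b c d)%C.
Proof.
  intros hab hcd hf. unfold rint.
  rewrite !hint_scal, !vint_scal; try ring; auto; intros t ht; apply hf; onr.
Qed.

(** Shrinking the rectangle towards p inside h alone does not change the integral.
    Before shrinking (s = 1) it is the left-hand side; at s = 0 it is h(p) times the
    integral of 1/(u - p). *)
Lemma cauchy_rect (h : C -> C) (m a b c d : R) (p : C) :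
  0 < m -> a < Re p < b -> c < Im p < d ->
  holo (open_rect (a - m) (b + m) (c - m) (d + m)) h ->
  rint (fun u => h u / (u - p))%C a b c d = (2 * PI * Ci * h p)%C.
Proof.
  intros hm hp1 hp2 hh.
  assert (hab : a < b) by lra. assert (hcd : c < d) by lra.
  assert (hpn : forall u, on_rect a b c d u -> u <> p).
  { intros u [h1 [h2 h3]] ->. lra. }
  set (F := fun s : R => rint (fun u => h (p + RtoC s * (u - p)) / (u - p))%C a b c d).
  assert (hF : F 1 = F 0).
  { apply homotopy_const. intros s0 hs0.
    (* del is small enough for both sides in homothety_between *)
    set (L := (b - a) + (d - c) + 3).
    set (del := Rmin 1 (m / (2 * L))).
    assert (hL : 0 < L) by (unfold L; lra).
    assert (hmL : 0 < m / (2 * L)) by (apply Rdiv_lt_0_compat; lra).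
    assert (hdel : 0 < del <= 1) by (unfold del; split; [apply Rmin_pos; lra | apply Rmin_l]).
    assert (hdL : del * L < m).
    { apply Rle_lt_trans with (m / (2 * L) * L).
      - apply Rmult_le_compat_r; [lra|]. apply Rmin_r.
      - replace (m / (2 * L) * L) with (m / 2) by (field; lra). lra. }
    assert (hd1 : del * (b - a + 3) < m) by (unfold L in hdL; nra).
    assert (hd2 : del * (d - c + 3) < m) by (unfold L in hdL; nra).
    assert (hD : forall s x y, Rabs (s - s0) < del -> a - del < x < b + del -> c - del < y < d + del ->
       open_rect (a - m) (b + m) (c - m) (d + m) (p + RtoC s * ((x, y) - p))%C).
    { intros s x y hs hx hy. apply Rabs_def2 in hs. destruct p as [p1 p2]. unfold open_rect, Re, Im in *; simpl in *.
      replace (p1 + (s * (x + - p1) - 0 * (y + - p2))) with (p1 + s * (x - p1)) by ring.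
      replace (p2 + (s * (y + - p2) + 0 * (x + - p1))) with (p2 + s * (y - p2)) by ring.
      split; apply homothety_between with del; lra. }
    destruct (edge_homotopy _ h p 1 (fun t => (t, c)) s0 a b del ltac:(lra) ltac:(lra) hh)
      as [l1 [d1 e1]].
    { intros; apply C_pair_line_h. } { intros t ht; apply hpn; onr. }
    { intros s t hs ht. apply hD; lra. }
    destruct (edge_homotopy _ h p 1 (fun t => (t, d)) s0 a b del ltac:(lra) ltac:(lra) hh)
      as [l2 [d2 e2]].
    { intros; apply C_pair_line_h. } { intros t ht; apply hpn; onr. }
    { intros s t hs ht. apply hD; lra. }
    destruct (edge_homotopy _ h p Ci (fun t => (a, t)) s0 c d del ltac:(lra) ltac:(lra) hh)
      as [l3 [d3 e3]].
    { intros; apply C_pair_line_v. } { intros t ht; apply hpn; onr. }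
    { intros s t hs ht. apply hD; lra. }
    destruct (edge_homotopy _ h p Ci (fun t => (b, t)) s0 c d del ltac:(lra) ltac:(lra) hh)
      as [l4 [d4 e4]].
    { intros; apply C_pair_line_v. } { intros t ht; apply hpn; onr. }
    { intros s t hs ht. apply hD; lra. }
    exists (l1 + l4 - l2 - l3)%C. split.
    - apply derC_minus; [apply derC_minus|exact d3].
      + apply (is_derive_plus (V := C_R_NormedModule)); [|exact d4].
        revert d1. apply is_derive_ext. intros s. apply Cmult_1_l.
      + revert d2. apply is_derive_ext. intros s. apply Cmult_1_l.
    - transitivity (s0 * l1 + s0 * l4 - s0 * l2 - s0 * l3)%C; [ring|].
      rewrite e1, e2, e3, e4. ring. }
  transitivity (F 1).
  { unfold F. apply rint_ext; [lra|lra|]. intros u _.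
    replace (p + RtoC 1 * (u - p))%C with u by ring. reflexivity. }
  rewrite hF. unfold F.
  rewrite (rint_ext _ (fun u => h p * / (u - p))%C); try lra.
  2:{ intros u _. replace (p + RtoC 0 * (u - p))%C with p by ring. reflexivity. }
  rewrite rint_scal; try lra.
  - rewrite rint_inv by lra. ring.
  - intros u hu. apply contC_inv.
    + apply contC_minus; [apply continuous_id | apply continuous_const].
    + now apply Cminus_eq_contra, hpn.
Qed.

(** Partial fractions reduce this to one simple pole at a time. *)
Lemma cauchy_rect3 (h : C -> C) (m a b c d : R) (p q r : C) :
  0 < m -> a < Re p < b -> c < Im p < d -> a < Re q < b -> c < Im q < d ->
  a < Re r < b -> c < Im r < d -> p <> q -> p <> r -> q <> r ->
  holo (open_rect (a - m) (b + m) (c - m) (d + m)) h ->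
  rint (fun u => h u / ((u - p) * (u - q) * (u - r)))%C a b c d =
  (2 * PI * Ci * (h p / ((p - q) * (p - r)) + h q / ((q - p) * (q - r))
     + h r / ((r - p) * (r - q))))%C.
Proof.
  intros hm hp1 hp2 hq1 hq2 hr1 hr2 hpq hpr hqr hh.
  assert (hpn : forall u, on_rect a b c d u -> u <> p) by (intros u [h1 [h2 h3]] ->; lra).
  assert (hqn : forall u, on_rect a b c d u -> u <> q) by (intros u [h1 [h2 h3]] ->; lra).
  assert (hrn : forall u, on_rect a b c d u -> u <> r) by (intros u [h1 [h2 h3]] ->; lra).
  assert (npq := Cminus_eq_contra _ _ hpq). assert (npr := Cminus_eq_contra _ _ hpr).
  assert (nqr := Cminus_eq_contra _ _ hqr).
  assert (nqp := Cminus_eq_contra _ _ (not_eq_sym hpq)). assert (nrp := Cminus_eq_contra _ _ (not_eq_sym hpr)).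
  assert (nrq := Cminus_eq_contra _ _ (not_eq_sym hqr)).
  assert (hc : forall v, (forall u, on_rect a b c d u -> u <> v) ->
     forall u, on_rect a b c d u -> contCC (fun u => h u / (u - v))%C u).
  { intros v hv u hu. apply contC_mult.
    - apply (holo_cont _ _ _ hh). destruct hu as [h1 [h2 _]]. split; lra.
    - apply contC_inv; [|now apply Cminus_eq_contra, hv].
      apply contC_minus; [apply continuous_id | apply continuous_const]. }
  rewrite (rint_ext _ (fun u => / ((p - q) * (p - r)) * (h u / (u - p))
     + (/ ((q - p) * (q - r)) * (h u / (u - q)) + / ((r - p) * (r - q)) * (h u / (u - r))))%C); try lra.
  2:{ intros u hu.
      assert (n1 := Cminus_eq_contra _ _ (hpn u hu)). assert (n2 := Cminus_eq_contra _ _ (hqn u hu)).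
      assert (n3 := Cminus_eq_contra _ _ (hrn u hu)).
      field. repeat split; auto. }
  assert (hk : forall k v, (forall u, on_rect a b c d u -> u <> v) ->
     forall u, on_rect a b c d u -> contCC (fun u => k * (h u / (u - v)))%C u).
  { intros k v hv u hu. apply contC_mult; [apply continuous_const | now apply hc]. }
  rewrite rint_plus; try lra; [|now apply hk|].
  2:{ intros u hu. apply contC_plus; now apply hk. }
  rewrite rint_plus; try lra; [|now apply hk|now apply hk].
  rewrite !rint_scal; try lra; try (now apply hc).
  rewrite !(cauchy_rect h m) by auto. field. repeat split; auto.
Qed.

(** * Hankel integrals in the logarithmic coordinate *)

Notation climit f F l := (filterlim f F (@locally C_UniformSpace l)).

Lemma climit_plus {T} {F : (T -> Prop) -> Prop} {FF : Filter F} (f g : T -> C) (l m : C) :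
  climit f F l -> climit g F m -> climit (fun t => f t + g t)%C F (l + m)%C.
Proof.
  intros hf hg. apply (filterlim_comp_2 f g Cplus hf hg).
  apply (filterlim_plus (V := C_R_NormedModule) l m).
Qed.

Lemma climit_scal {T} {F : (T -> Prop) -> Prop} (f : T -> C) (k l : C) :
  climit f F l -> climit (fun t => k * f t)%C F (k * l)%C.
Proof.
  intros hf. apply (filterlim_comp _ _ _ f (fun z => k * z)%C _ _ _ hf).
  apply (contC_mult (fun _ : C_UniformSpace => k) (fun z : C_UniformSpace => z) l).
  - apply continuous_const.
  - apply continuous_id.
Qed.

Lemma climit_mult {T} {F : (T -> Prop) -> Prop} {FF : Filter F} (f g : T -> C) (l m : C) :
  climit f F l -> climit g F m -> climit (fun t => f t * g t)%C F (l * m)%C.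
Proof.
  intros hf hg. apply (filterlim_comp_2 f g Cmult hf hg).
  apply (filterlim_filter_le_1 (F := @locally (prod_UniformSpace C_UniformSpace C_UniformSpace) (l, m))).
  { intros P [eps hP]. exists (ball l eps) (ball m eps); try apply locally_ball.
    intros x y hx hy. apply hP. split; assumption. }
  apply (contC_mult (fun z : prod_UniformSpace C_UniformSpace C_UniformSpace => fst z) (fun z => snd z) (l, m)).
  - apply (continuous_fst (U := C_UniformSpace) (V := C_UniformSpace)).
  - apply (continuous_snd (U := C_UniformSpace) (V := C_UniformSpace)).
Qed.

Lemma climit_minus {T} {F : (T -> Prop) -> Prop} {FF : Filter F} (f g : T -> C) (l m : C) :
  climit f F l -> climit g F m -> climit (fun t => f t - g t)%C F (l - m)%C.
Proof.
  intros hf hg. apply climit_plus; [exact hf|].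
  apply (filterlim_comp _ _ _ g Copp _ _ _ hg). apply (filterlim_opp (V := C_R_NormedModule) m).
Qed.

Lemma climit_const {T} {F : (T -> Prop) -> Prop} {FF : Filter F} (l : C) :
  climit (fun _ : T => l) F l.
Proof. apply filterlim_const. Qed.

Lemma climit_unique {T} {F : (T -> Prop) -> Prop} {FF : ProperFilter F} (f : T -> C) (l m : C) :
  climit f F l -> climit f F m -> l = m.
Proof. apply (filterlim_locally_unique (V := C_R_NormedModule)). Qed.

Lemma climit_le {T} {F : (T -> Prop) -> Prop} {FF : ProperFilter F} (f : T -> C) (l : C) (K : R) :
  climit f F l -> F (fun t => Cmod (f t) <= K) -> Cmod l <= K.
Proof.
  intros hf hK.
  assert (h : filterlim (fun t => norm (f t : C_R_NormedModule)) F (Rbar_locally (norm (l : C_R_NormedModule)))).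
  { apply (filterlim_comp _ _ _ f (fun z => norm (z : C_R_NormedModule)) _ _ _ hf). 
    apply (filterlim_norm (V := C_R_NormedModule) l). }
  assert (hle := @filterlim_le T F (Proper_StrongProper F FF) (fun t => norm (f t : C_R_NormedModule))
     (fun _ => K) (Finite (norm (l : C_R_NormedModule))) (Finite K)).
  rewrite <- norm_C_Cmod. apply hle.
  - revert hK. apply filter_imp. intros t. now rewrite norm_C_Cmod.
  - exact h.
  - apply filterlim_const.
Qed.

Lemma climit_of_bound {T} {F : (T -> Prop) -> Prop} {FF : Filter F} (f : T -> C) (g : T -> R) (l : C) :
  F (fun t => Cmod (f t - l) <= g t) -> filterlim g F (locally 0) -> climit f F l.
Proof.
  intros hb hg. apply (proj2 (filterlim_locally (U := C_UniformSpace) _ _)). intros eps.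
  assert (h := proj1 (filterlim_locally (U := R_UniformSpace) _ _) hg eps).
  generalize (filter_and _ _ hb h). apply filter_imp. intros t [h1 h2].
  apply C_NormedModule_mixin_compat1. eapply Rle_lt_trans; [exact h1|].
  unfold ball in h2; simpl in h2. unfold AbsRing_ball, abs, minus, plus, opp in h2; simpl in h2.
  rewrite Ropp_0, Rplus_0_r in h2. apply Rabs_def2 in h2. lra.
Qed.

(** With t = e^u, the three sides of the half-strip Re u >= a, |Im u| <= th are the
    rays arg t = th and arg t = -th and the arc |t| = e^a. *)
Definition contour (th a : R) (u : C) : Prop :=
  (a <= Re u /\ (Im u = th \/ Im u = - th)) \/ (Re u = a /\ - th <= Im u <= th).

(** The rays are cut at Re u = b; the lower one is traversed from right to left. *)
Definition hkT (th : R) (f : C -> C) (a b : R) : C :=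
  (- hint f (- th) a b + vint f a (- th) th + hint f th a b)%C.

Definition is_hk (th : R) (f : C -> C) (a : R) (l : C) : Prop :=
  climit (hkT th f a) (Rbar_locally p_infty) l.

(** The weight e^(-Re u) is integrable along the rays, so M alone controls the
    integral over the whole contour. *)
Definition tame (th a : R) (f : C -> C) (M : R) : Prop :=
  forall u, contour th a u -> contCC f u /\ Cmod (f u) <= M * exp (- Re u).

Lemma contour_h (th a r : R) : a <= r -> contour th a (r, th) /\ contour th a (r, (- th)).
Proof. intros h; split; left; unfold Re, Im; simpl; auto. Qed.

Lemma contour_v (th a t : R) : - th <= t <= th -> contour th a (a, t).
Proof. intros h; right; unfold Re, Im; simpl; auto. Qed.

Lemma near_infty (a : R) : Rbar_locally p_infty (fun b => a <= b).
Proof. exists a. intros x hx. lra. Qed.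

Lemma hkT_ext (th a b : R) (f g : C -> C) : 0 <= th -> a <= b ->
  (forall u, contour th a u -> f u = g u) -> hkT th f a b = hkT th g a b.
Proof.
  intros hth hab h. unfold hkT.
  rewrite (hint_ext f g (- th) a b), (hint_ext f g th a b), (vint_ext f g a (- th) th);
    auto; try lra; intros t ht; apply h; (apply contour_h || apply contour_v); lra.
Qed.

Lemma hkT_plus (th a b : R) (f g : C -> C) : 0 <= th -> a <= b ->
  (forall u, contour th a u -> contCC f u) -> (forall u, contour th a u -> contCC g u) ->
  hkT th (fun u => f u + g u)%C a b = (hkT th f a b + hkT th g a b)%C.
Proof.
  intros hth hab hf hg. unfold hkT.
  rewrite !hint_plus, vint_plus; try ring; try lra; intros t ht;
   (apply hf || apply hg); (apply contour_h || apply contour_v); lra.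
Qed.

Lemma hkT_scal (th a b : R) (f : C -> C) (k : C) : 0 <= th -> a <= b ->
  (forall u, contour th a u -> contCC f u) ->
  hkT th (fun u => k * f u)%C a b = (k * hkT th f a b)%C.
Proof.
  intros hth hab hf. unfold hkT.
  rewrite !hint_scal, vint_scal; try ring; try lra; intros t ht;
   apply hf; (apply contour_h || apply contour_v); lra.
Qed.

Lemma is_hk_ext (th a : R) (f g : C -> C) (l : C) : 0 <= th ->
  (forall u, contour th a u -> f u = g u) -> is_hk th f a l -> is_hk th g a l.
Proof.
  intros hth h. apply (filterlim_ext_loc (F := Rbar_locally p_infty) (hkT th f a) (hkT th g a)).
  generalize (near_infty a). apply filter_imp. intros b hb. now apply hkT_ext.
Qed.

Lemma is_hk_scal (th a : R) (f : C -> C) (k l : C) : 0 <= th ->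
  (forall u, contour th a u -> contCC f u) ->
  is_hk th f a l -> is_hk th (fun u => k * f u)%C a (k * l)%C.
Proof.
  intros hth hf h.
  apply (filterlim_ext_loc (F := Rbar_locally p_infty) (fun b => k * hkT th f a b)%C).
  - generalize (near_infty a). apply filter_imp. intros b hb. symmetry. now apply hkT_scal.
  - now apply climit_scal.
Qed.

Lemma is_hk_plus (th a : R) (f g : C -> C) (l m : C) : 0 <= th ->
  (forall u, contour th a u -> contCC f u) -> (forall u, contour th a u -> contCC g u) ->
  is_hk th f a l -> is_hk th g a m -> is_hk th (fun u => f u + g u)%C a (l + m)%C.
Proof.
  intros hth hf hg h1 h2.
  apply (filterlim_ext_loc (F := Rbar_locally p_infty) (fun b => hkT th f a b + hkT th g a b)%C).
  - generalize (near_infty a). apply filter_imp. intros b hb. symmetry. now apply hkT_plus.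
  - now apply climit_plus.
Qed.

Lemma is_hk_minus (th a : R) (f g : C -> C) (l m : C) : 0 <= th ->
  (forall u, contour th a u -> contCC f u) -> (forall u, contour th a u -> contCC g u) ->
  is_hk th f a l -> is_hk th g a m -> is_hk th (fun u => f u - g u)%C a (l - m)%C.
Proof.
  intros hth hf hg h1 h2.
  apply (is_hk_ext _ _ (fun u => f u + (- (1)) * g u)%C); auto.
  { intros u _. ring. }
  replace (l - m)%C with (l + (- (1)) * m)%C by ring.
  apply is_hk_plus; auto.
  - intros u hu. apply contC_mult; [apply continuous_const | now apply hg].
  - now apply is_hk_scal.
Qed.

Lemma is_hk_unique (th a : R) (f : C -> C) (l m : C) : is_hk th f a l -> is_hk th f a m -> l = m.
Proof. apply climit_unique. Qed.

Lemma hint_exp_bound (f : C -> C) (y a b M : R) : a <= b ->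
  (forall r, a <= r <= b -> contCC f (r, y) /\ Cmod (f (r, y)) <= M * exp (- r)) ->
  Cmod (hint f y a b) <= M * exp (- a).
Proof.
  intros hab h.
  assert (hM : 0 <= M).
  { destruct (h a ltac:(lra)) as [_ h1]. assert (h2 := Cmod_ge_0 (f (a, y))).
    assert (h3 := exp_pos (- a)). nra. }
  apply Rle_trans with (M * exp (- a) - M * exp (- b)).
  2:{ assert (h3 := exp_pos (- b)). nra. }
  rewrite <- norm_C_Cmod.
  apply (norm_RInt_le (V := C_R_NormedModule) (fun r => f (r, y)) (fun r => M * exp (- r)) a b); auto.
  - intros r hr. rewrite norm_C_Cmod. now apply h.
  - apply isRIC_RIC, exRIC_cont; auto. intros t ht. apply contC_h. now apply h.
  - replace (M * exp (- a) - M * exp (- b)) with (minus (- M * exp (- b)) (- M * exp (- a)))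
      by (unfold minus, plus, opp; simpl; ring).
    apply (is_RInt_derive (V := R_CompleteNormedModule) (fun r => - M * exp (- r))).
    + intros r _. auto_derive; auto. ring.
    + intros r _. apply (ex_derive_continuous (V := R_NormedModule)). auto_derive; auto.
Qed.

Lemma hint_Chasles (f : C -> C) (y a b c : R) : a <= b -> b <= c ->
  (forall r, a <= r <= c -> contCC f (r, y)) ->
  hint f y a c = (hint f y a b + hint f y b c)%C.
Proof.
  intros hab hbc h. symmetry.
  apply (RInt_Chasles (V := C_R_CompleteNormedModule) (fun r => f (r, y)) a b c);
    apply exRIC_cont; auto; intros t ht; apply contC_h, h; lra.
Qed.

Lemma exp_neg_small (K : R) (eps : R) : 0 < eps -> exists b, forall r, b <= r -> K * exp (- r) < eps.
Proof.
  intros he. exists (Rabs K / eps + 1). intros r hr.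
  assert (h0 := Rabs_pos K). assert (hd : 0 <= Rabs K / eps) by (apply Rdiv_le_0_compat; auto).
  assert (h1 : 1 + r <= exp r) by (left; apply exp_ineq1; lra).
  apply Rle_lt_trans with (Rabs K * exp (- r)).
  { apply Rmult_le_compat_r; [left; apply exp_pos | apply Rle_abs]. }
  rewrite exp_Ropp. apply Rmult_lt_reg_r with (exp r); [apply exp_pos|].
  rewrite Rmult_assoc, Rinv_l, Rmult_1_r by (apply Rgt_not_eq, exp_pos).
  replace (Rabs K) with (eps * (Rabs K / eps)) by (field; lra).
  apply Rmult_lt_compat_l; lra.
Qed.

Lemma ray_converges (f : C -> C) (y a M : R) :
  (forall r, a <= r -> contCC f (r, y) /\ Cmod (f (r, y)) <= M * exp (- r)) ->
  exists l : C, climit (hint f y a) (Rbar_locally p_infty) l.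
Proof.
  intros h. apply (filterlim_locally_cauchy (U := C_R_CompleteNormedModule)).
  intros eps. destruct (exp_neg_small (M + M) eps (cond_pos eps)) as [b hb].
  set (B := Rmax a b).
  assert (h1 := Rmax_l a b). assert (h2 := Rmax_r a b). fold B in h1, h2.
  exists (fun r => B <= r). split; [apply near_infty|].
  intros u v hu hv. apply C_NormedModule_mixin_compat1.
  assert (hh : forall w, B <= w -> Cmod (hint f y a w - hint f y a B) <= M * exp (- B)).
  { intros w hw. rewrite (hint_Chasles f y a B w) by (auto; intros; apply h; lra).
    replace (hint f y a B + hint f y B w - hint f y a B)%C with (hint f y B w) by ring.
    apply hint_exp_bound; auto. intros r hr. apply h. lra. }
  change (Cmod (hint f y a v - hint f y a u) < eps).
  replace (hint f y a v - hint f y a u)%C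
   with ((hint f y a v - hint f y a B) + - (hint f y a u - hint f y a B))%C by ring.
  eapply Rle_lt_trans; [apply Cmod_triangle|]. rewrite Cmod_opp.
  assert (h3 := hh u hu). assert (h4 := hh v hv).
  assert (h5 := hb B h2). lra.
Qed.

Lemma is_hk_of_rays (th a : R) (f : C -> C) (l m : C) :
  climit (hint f (- th) a) (Rbar_locally p_infty) l ->
  climit (hint f th a) (Rbar_locally p_infty) m ->
  is_hk th f a (- l + vint f a (- th) th + m)%C.
Proof.
  intros h1 h2. apply climit_plus; [|exact h2]. apply climit_plus; [|apply climit_const].
  apply (filterlim_comp _ _ _ _ Copp _ _ _ h1). apply (filterlim_opp (V := C_R_NormedModule) l).
Qed.

Lemma tame_converges (th a M : R) (f : C -> C) : tame th a f M -> exists l, is_hk th f a l.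
Proof.
  intros h.
  destruct (ray_converges f (- th) a M) as [l1 h1].
  { intros r hr. exact (h _ (proj2 (contour_h th a r hr))). }
  destruct (ray_converges f th a M) as [l2 h2].
  { intros r hr. exact (h _ (proj1 (contour_h th a r hr))). }
  eexists. exact (is_hk_of_rays th a f l1 l2 h1 h2).
Qed.

Lemma hkT_bound (th a b M : R) (f : C -> C) : 0 <= th -> a <= b -> tame th a f M ->
  Cmod (hkT th f a b) <= (2 + 2 * th) * exp (- a) * M.
Proof.
  intros hth hab h. unfold hkT.
  assert (h1 : Cmod (hint f (- th) a b) <= M * exp (- a)).
  { apply hint_exp_bound; auto. intros r hr. apply h, contour_h; lra. }
  assert (h2 : Cmod (hint f th a b) <= M * exp (- a)).
  { apply hint_exp_bound; auto. intros r hr. apply h, contour_h; lra. }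
  assert (h3 : Cmod (vint f a (- th) th) <= (th - - th) * (M * exp (- a))).
  { unfold vint. rewrite Cmod_mult, Cmod_Ci, Rmult_1_l. apply RIC_bound; try lra.
    - apply exRIC_cont; try lra. intros t ht. apply contC_v. now apply h, contour_v.
    - intros t ht. now apply (h (a, t)), contour_v. }
  eapply Rle_trans; [apply Cmod_triangle|].
  eapply Rle_trans; [apply Rplus_le_compat_r, Cmod_triangle|]. rewrite Cmod_opp. lra.
Qed.

(** As the bound is linear in M, a sequence of tame functions with M tending to 0
    has integrals tending to 0; this serves as dominated convergence. *)
Lemma is_hk_bound (th a M : R) (f : C -> C) (l : C) : 0 <= th -> tame th a f M ->
  is_hk th f a l -> Cmod l <= (2 + 2 * th) * exp (- a) * M.
Proof.
  intros hth h hl. apply (climit_le (hkT th f a) l _ hl).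
  generalize (near_infty a). apply filter_imp. intros b hb. now apply hkT_bound.
Qed.

Lemma hkT_rint (th a b : R) (f : C -> C) :
  hkT th f a b = (vint f b (- th) th - rint f a b (- th) th)%C.
Proof. unfold hkT, rint. ring. Qed.

(** The piece of the contour left of Re u = a and the new left side bound the
    rectangle between the two abscissas. *)
Lemma hkT_split (th a0 a b : R) (f : C -> C) : a0 <= a -> a <= b ->
  (forall u, contour th a0 u -> contCC f u) ->
  hkT th f a0 b = (hkT th f a b - rint f a0 a (- th) th)%C.
Proof.
  intros h1 h2 h. unfold hkT, rint.
  rewrite (hint_Chasles f th a0 a b), (hint_Chasles f (- th) a0 a b); auto; try ring;
    intros r hr; apply h, contour_h; lra.
Qed.

Lemma is_hk_move (th a0 a : R) (f : C -> C) (l : C) : a0 <= a ->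
  (forall u, contour th a0 u -> contCC f u) ->
  is_hk th f a l -> is_hk th f a0 (l - rint f a0 a (- th) th)%C.
Proof.
  intros h1 h hl.
  apply (filterlim_ext_loc (F := Rbar_locally p_infty) (fun b => hkT th f a b - rint f a0 a (- th) th)%C).
  - generalize (near_infty a). apply filter_imp. intros b hb. symmetry. now apply hkT_split.
  - apply climit_minus; [exact hl | apply climit_const].
Qed.

(** Indexed by the number of terms, whereas sum_n counts one more. *)
Fixpoint csum (c : nat -> C) (N : nat) : C :=
  match N with O => RtoC 0 | S k => (csum c k + c k)%C end.

Lemma csum_Re (c : nat -> C) (N : nat) : sum_n (fun n => Re (c n)) N = Re (csum c (S N)).
Proof.
  induction N as [|N IH].
  - rewrite sum_O. simpl. unfold Re; simpl. ring.
  - rewrite sum_Sn, IH. reflexivity.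
Qed.

Lemma csum_Im (c : nat -> C) (N : nat) : sum_n (fun n => Im (c n)) N = Im (csum c (S N)).
Proof.
  induction N as [|N IH].
  - rewrite sum_O. simpl. unfold Im; simpl. ring.
  - rewrite sum_Sn, IH. reflexivity.
Qed.

Lemma Im_le_Cmod (z : C) : Rabs (Im z) <= Cmod z.
Proof. eapply Rle_trans; [apply Rmax_r | apply Rmax_Cmod]. Qed.

Lemma CSeries_geom (c : nat -> C) (l : C) (K q : R) : 0 <= q < 1 ->
  (forall N, Cmod (l - csum c N) <= K * q ^ N) -> CSeries c = l.
Proof.
  intros hq h.
  assert (hlim : is_lim_seq (fun N => K * q ^ S N) 0).
  { replace (Finite 0) with (Rbar_mult K 0) by (simpl; f_equal; ring).
    apply is_lim_seq_scal_l. apply (is_lim_seq_incr_1 (fun n => q ^ n)).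
    apply is_lim_seq_geom. rewrite Rabs_right; lra. }
  assert (main : forall (pr : C -> R), (forall z, Rabs (pr z) <= Cmod z) ->
     (forall z w, pr (z - w)%C = pr z - pr w) ->
     (forall N, sum_n (fun n => pr (c n)) N = pr (csum c (S N))) ->
     Series (fun n => pr (c n)) = pr l).
  { intros pr h1 h2 h3. apply is_series_unique.
    assert (hs : is_lim_seq (sum_n (fun n => pr (c n))) (pr l)).
    { apply is_lim_seq_ext with (fun N => pr l - pr (l - csum c (S N))%C).
      { intros N. rewrite h2, h3. ring. }
      replace (Finite (pr l)) with (Rbar_minus (pr l) 0) by (simpl; f_equal; ring).
      apply is_lim_seq_minus'; [apply is_lim_seq_const|].
      apply is_lim_seq_abs_0. apply is_lim_seq_le_le with (fun _ => 0) (fun N => K * q ^ S N); auto.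
      - intros N. split; [apply Rabs_pos|]. eapply Rle_trans; [apply h1 | apply h].
      - apply is_lim_seq_const. }
    exact hs. }
  apply injective_projections; simpl.
  - apply (main Re); [apply re_le_Cmod | reflexivity | apply csum_Re].
  - apply (main Im); [apply Im_le_Cmod | reflexivity | apply csum_Im].
Qed.

Lemma geometric_den (q : R) (w : C) : q < 1 -> Cmod w <= q ->
  1 - q <= Cmod (1 - w) /\ (1 - w)%C <> 0.
Proof.
  intros hq h. assert (ht := Cmod_triangle (1 - w) w).
  replace (1 - w + w)%C with (RtoC 1) in ht by ring. rewrite Cmod_1 in ht.
  assert (h1 : 1 - q <= Cmod (1 - w)) by lra. split; auto. apply Cmod_gt_0. lra.
Qed.

Lemma tame_mult (th a M K : R) (F G : C -> C) : tame th a F M ->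
  (forall u, contour th a u -> contCC G u /\ Cmod (G u) <= K) ->
  tame th a (fun u => F u * G u)%C (M * K).
Proof.
  intros hF hG u hu. destruct (hF u hu) as [f1 f2]. destruct (hG u hu) as [g1 g2]. split.
  - now apply contC_mult.
  - rewrite Cmod_mult. replace (M * K * exp (- Re u)) with (M * exp (- Re u) * K) by ring.
    apply Rmult_le_compat; auto; apply Cmod_ge_0.
Qed.

Lemma tame_geometric (th a M q : R) (F Z : C -> C) : q < 1 -> tame th a F M ->
  (forall u, contour th a u -> contCC Z u /\ Cmod (Z u) <= q) ->
  tame th a (fun u => F u / (1 - Z u))%C (M / (1 - q)).
Proof.
  intros hq hF hZ. apply (tame_mult th a M (/ (1 - q)) F); auto.
  intros u hu. destruct (hZ u hu) as [z1 z2]. destruct (geometric_den q (Z u) hq z2) as [d1 d2]. split.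
  - apply contC_inv; auto. apply contC_minus; auto. apply continuous_const.
  - rewrite Cmod_inv by auto. apply Rinv_le_contravar; lra.
Qed.

Lemma pow_small (th a q : R) (Z : C -> C) (n : nat) :
  (forall u, contour th a u -> contCC Z u /\ Cmod (Z u) <= q) ->
  forall u, contour th a u -> contCC (fun u => Z u ^ n)%C u /\ Cmod (Z u ^ n) <= q ^ n.
Proof.
  intros hZ u hu. destruct (hZ u hu) as [z1 z2]. split.
  - clear z2. induction n as [|n IH]; simpl; [apply continuous_const | now apply contC_mult].
  - rewrite Cmod_pow. apply pow_incr. split; auto. apply Cmod_ge_0.
Qed.

(** After N terms the remainder is F Z^N / (1 - Z), which is tame with a constant
    proportional to q^N. *)
Lemma hk_geometric (th a M q : R) (F Z : C -> C) (c : nat -> C) :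
  0 <= th -> 0 <= q < 1 -> tame th a F M ->
  (forall u, contour th a u -> contCC Z u /\ Cmod (Z u) <= q) ->
  (forall n, is_hk th (fun u => F u * Z u ^ n)%C a (c n)) ->
  is_hk th (fun u => F u / (1 - Z u))%C a (CSeries c).
Proof.
  intros hth hq hF hZ hc.
  assert (hden : forall u, contour th a u -> (1 - Z u)%C <> 0).
  { intros u hu. apply (geometric_den q); [lra | now apply hZ]. }
  assert (hR : forall n, tame th a (fun u => F u * Z u ^ n / (1 - Z u))%C (M * q ^ n / (1 - q))).
  { intros n. apply (tame_geometric th a _ q (fun u => F u * Z u ^ n)%C); auto; [lra|].
    apply tame_mult; auto. now apply pow_small. }
  destruct (tame_converges th a _ _ (tame_geometric th a M q F Z ltac:(lra) hF hZ)) as [l hl].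
  assert (hrem : forall n, is_hk th (fun u => F u * Z u ^ n / (1 - Z u))%C a (l - csum c n)%C).
  { induction n as [|n IH]; simpl csum.
    - replace (l - 0)%C with l by ring. revert hl. apply is_hk_ext; auto.
      intros u _. simpl. unfold Cdiv. ring.
    - replace (l - (csum c n + c n))%C with (l - csum c n - c n)%C by ring.
      apply (is_hk_ext th a (fun u => F u * Z u ^ n / (1 - Z u) - F u * Z u ^ n)%C); auto.
      + intros u hu. simpl. field. now apply hden.
      + apply is_hk_minus; auto.
        * intros u hu. now apply hR.
        * intros u hu. apply contC_mult; [now apply hF | now apply (pow_small th a q Z n hZ)]. }
  replace (CSeries c) with l; [exact hl|]. symmetry.
  apply (CSeries_geom c l ((2 + 2 * th) * exp (- a) * (M / (1 - q))) q hq).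
  intros n. eapply Rle_trans; [exact (is_hk_bound th a _ _ _ hth (hR n) (hrem n))|].
  apply Req_le. unfold Rdiv. ring.
Qed.

(** * Gauss products as contour integrals *)

Lemma diffC_Cexp_lin (k z : C) : diffC (fun w => Cexp (k * w)) z (k * Cexp (k * z))%C.
Proof.
  destruct (diffC_Cexp (k * z)) as (p & p1 & p2 & p3).
  assert (hk : contCC (fun w => k * w)%C z) by (apply contC_mult; [apply continuous_const | apply continuous_id]).
  exists (fun w => k * p (k * w))%C. split; [|split].
  - apply contC_mult; [apply continuous_const|]. now apply (continuous_comp (fun w => k * w)%C p).
  - now rewrite p2.
  - intros w. rewrite (p3 (k * w)%C) at 1. ring.
Qed.

Lemma hint_deriv (f f' : C -> C) (y a b : R) : a <= b ->
  (forall r, a <= r <= b -> diffC f (r, y) (f' (r, y)) /\ contCC f' (r, y)) ->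
  hint f' y a b = (f (b, y) - f (a, y))%C.
Proof.
  intros hab h. apply RIC_unique.
  apply (is_RInt_derive (V := C_R_CompleteNormedModule) (fun r => f (r, y))).
  - intros r. rewrite Rmin_left, Rmax_right by lra. intros hr.
    rewrite <- (Cmult_1_l (f' (r, y))).
    apply (derC_line f (fun r => (r, y) : C)); [now apply h | intros s; apply C_pair_line_h].
  - intros r. rewrite Rmin_left, Rmax_right by lra. intros hr. now apply contC_h, h.
Qed.

Lemma vint_deriv (f f' : C -> C) (x c d : R) : c <= d ->
  (forall t, c <= t <= d -> diffC f (x, t) (f' (x, t)) /\ contCC f' (x, t)) ->
  vint f' x c d = (f (x, d) - f (x, c))%C.
Proof.
  intros hab h. unfold vint. rewrite <- RIC_scal.
  - apply RIC_unique.
    apply (is_RInt_derive (V := C_R_CompleteNormedModule) (fun r => f (x, r))).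
    + intros r. rewrite Rmin_left, Rmax_right by lra. intros hr.
      apply (derC_line f (fun r => (x, r) : C)); [now apply h | intros s; apply C_pair_line_v].
    + intros r. rewrite Rmin_left, Rmax_right by lra. intros hr.
      apply contC_mult; [apply continuous_const|]. now apply contC_v, h.
  - apply exRIC_cont; auto. intros t ht. now apply contC_v, h.
Qed.

(** The primitive telescopes along the three sides, which leaves the two end
    points at Re u = b. *)
Lemma hkT_deriv (th a b : R) (f f' : C -> C) : 0 <= th -> a <= b ->
  (forall u, contour th a u -> diffC f u (f' u) /\ contCC f' u) ->
  hkT th f' a b = (f (b, th) - f (b, (- th)%R))%C.
Proof.
  intros hth hab h. unfold hkT.
  rewrite (hint_deriv f f' th a b), (hint_deriv f f' (- th) a b), (vint_deriv f f' a (- th) th);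
   try lra; try ring; intros t ht; apply h; (apply contour_h || apply contour_v); lra.
Qed.

Lemma Cmod_Cexp_lin (k u : C) : Cmod (Cexp (k * u)) = exp (Re k * Re u - Im k * Im u).
Proof. rewrite Cmod_Cexp. destruct k, u; unfold Re, Im; simpl. reflexivity. Qed.

Lemma Cmod_Cexp_lin_le (k u : C) (th : R) : Rabs (Im u) <= th ->
  Cmod (Cexp (k * u)) <= exp (Rabs (Im k) * th) * exp (Re k * Re u).
Proof.
  intros h. rewrite Cmod_Cexp_lin, <- exp_plus.
  assert (h1 : - (Im k * Im u) <= Rabs (Im k) * th).
  { apply Rle_trans with (Rabs (Im k * Im u)).
    - rewrite <- Rabs_Ropp. apply Rle_abs.
    - rewrite Rabs_mult. apply Rmult_le_compat_l; auto. apply Rabs_pos. }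
  destruct (Req_dec (Re k * Re u - Im k * Im u) (Rabs (Im k) * th + Re k * Re u)) as [->|hn]; [lra|].
  left. apply exp_increasing. lra.
Qed.

Lemma Cmod_Cexp_1m_le (w u : C) (th : R) : Rabs (Im u) <= th ->
  Cmod (Cexp ((1 - w) * u)) <= exp (Rabs (Im w) * th) * exp ((1 - Re w) * Re u).
Proof.
  intros h. assert (h1 := Cmod_Cexp_lin_le (1 - w) u th h).
  replace (Rabs (Im (1 - w))) with (Rabs (Im w)) in h1.
  - replace (1 - Re w) with (Re (1 - w)) by (destruct w; unfold Re; simpl; ring). exact h1.
  - rewrite <- Rabs_Ropp. f_equal. destruct w; unfold Im; simpl. ring.
Qed.

Lemma contour_Im (th a : R) (u : C) : 0 <= th -> contour th a u -> Rabs (Im u) <= th.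
Proof. intros hth [[_ [h|h]]|[_ h]]; apply Rabs_le; lra. Qed.

Lemma contour_Re (th a : R) (u : C) : contour th a u -> a <= Re u.
Proof. intros [[h _]|[h _]]; lra. Qed.

Definition recip (N : R) (u : C) : C := (/ (1 - Cexp u / N))%C.

(** For k = N the power of recip N approximates exp(e^u) as (1 - v/N)^(-N)
    approximates e^v. *)
Definition gauss_kernel (N : R) (k : nat) (w u : C) : C := (Cexp ((1 - w) * u) * recip N u ^ k)%C.

(** The zero of 1 - e^u/N at u = ln N is simple, and exp_quot carries the other
    zeros, which differ from ln N by nonzero multiples of 2 PI i. *)
Lemma recip_den_factor (N : R) (u : C) : 0 < N ->
  (1 - Cexp u / N)%C = (- ((u - ln N) * exp_quot (u - ln N)))%C.
Proof. intros hN. rewrite exp_quot_spec, Cexp_minus, Cexp_real, exp_ln by auto. ring. Qed.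

Lemma exp_quot_ln_nz (N : R) (u : C) : Rabs (Im u) < 2 * PI -> exp_quot (u - ln N) <> 0.
Proof.
  intros h. apply exp_quot_nz. replace (Im (u - ln N)) with (Im u); auto.
  destruct u; unfold Im; simpl. ring.
Qed.

Lemma recip_den_nz (N : R) (u : C) : 0 < N -> Rabs (Im u) < 2 * PI -> u <> ln N ->
  (1 - Cexp u / N)%C <> 0.
Proof.
  intros hN hi hu e. rewrite recip_den_factor in e by auto.
  apply (Cmult_neq_0 _ _ (Cminus_eq_contra _ _ hu) (exp_quot_ln_nz N u hi)).
  replace ((u - ln N) * exp_quot (u - ln N))%C with (- - ((u - ln N) * exp_quot (u - ln N)))%C by ring.
  rewrite e. ring.
Qed.

Lemma Cmod_recip_far (N : R) (u : C) : 0 < N -> 2 * N <= exp (Re u) ->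
  Cmod (recip N u) <= 2 * N * exp (- Re u).
Proof.
  intros hN h.
  assert (hn := RtoC_nz N ltac:(lra)).
  assert (h1 : exp (Re u) / (2 * N) <= Cmod (1 - Cexp u / N)).
  { assert (ht := Cmod_triangle (- (1 - Cexp u / N)) 1).
    replace (- (1 - Cexp u / N) + 1)%C with (Cexp u / N)%C in ht by (field; exact hn).
    rewrite Cmod_opp, Cmod_1, Cmod_div, Cmod_Cexp, Cmod_R, Rabs_right in ht by (auto; lra).
    replace (exp (Re u) / N) with (exp (Re u) / (2 * N) + exp (Re u) / (2 * N)) in ht by (field; lra).
    assert (1 <= exp (Re u) / (2 * N)).
    { apply Rmult_le_reg_r with (2 * N); [lra|]. unfold Rdiv.
      rewrite Rmult_assoc, Rinv_l; lra. }
    lra. }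
  assert (h2 : 0 < exp (Re u) / (2 * N)) by (apply Rdiv_lt_0_compat; [apply exp_pos|lra]).
  unfold recip. rewrite Cmod_inv by (apply Cmod_gt_0; lra).
  replace (2 * N * exp (- Re u)) with (/ (exp (Re u) / (2 * N))).
  - apply Rinv_le_contravar; lra.
  - rewrite exp_Ropp. field. split; [apply Rgt_not_eq, exp_pos | lra].
Qed.

Lemma diffC_recip (N : R) (u : C) : 0 < N -> (1 - Cexp u / N)%C <> 0 ->
  diffC (recip N) u (Cexp u / N * recip N u ^ 2)%C.
Proof.
  intros hN h. assert (h0 := h). assert (hn := RtoC_nz N ltac:(lra)).
  assert (hd : diffC (fun w => 1 - Cexp w / N)%C u (- (Cexp u / N))%C).
  { destruct (diffC_Cexp u) as (p & p1 & p2 & p3).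
    exists (fun w => - (p w / N))%C. split; [|split].
    - apply contC_opp, contC_mult; auto. apply continuous_const.
    - now rewrite p2.
    - intros w. rewrite (p3 w). field. exact hn. }
  apply diffC_inv in hd; [|exact h0].
  replace (Cexp u / N * recip N u ^ 2)%C with
    (- - (Cexp u / N) * / ((1 - Cexp u / N) * (1 - Cexp u / N)))%C; [exact hd|].
  unfold recip. simpl. field. split; [exact hn|].
  intros e. apply h0. replace (1 - Cexp u / N)%C with ((N - Cexp u) / N)%C by (field; exact hn).
  rewrite e. field. exact hn.
Qed.

Lemma diffC_recip_pow (N : R) (k : nat) (u : C) : 0 < N -> (1 - Cexp u / N)%C <> 0 ->
  diffC (fun w => recip N w ^ S k)%C u (INR (S k) * (Cexp u / N) * recip N u ^ S (S k))%C.
Proof.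
  intros hN h. assert (h1 := diffC_recip N u hN h).
  induction k as [|k IH].
  - replace (INR 1 * (Cexp u / N) * recip N u ^ 2)%C with
      (Cexp u / N * recip N u ^ 2 * 1 + recip N u * 0)%C by (simpl; ring).
    change (fun w => (recip N w ^ 1)%C) with (fun w => (recip N w * 1)%C).
    apply (diffC_mult (recip N) (fun _ => RtoC 1)); auto.
    exists (fun _ => RtoC 0). split; [apply continuous_const|]. split; auto. intros w; ring.
  - assert (h2 := diffC_mult _ _ _ _ _ h1 IH).
    replace (INR (S (S k)) * (Cexp u / N) * recip N u ^ S (S (S k)))%C with
     (Cexp u / N * recip N u ^ 2 * recip N u ^ S k
       + recip N u * (INR (S k) * (Cexp u / N) * recip N u ^ S (S k)))%C; [exact h2|].
    rewrite (S_INR (S k)), RtoC_plus. simpl. ring.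
Qed.

Lemma contC_recip_pow (N : R) (k : nat) (u : C) : 0 < N -> (1 - Cexp u / N)%C <> 0 ->
  contCC (fun w => recip N w ^ k)%C u.
Proof.
  intros hN h. destruct k as [|k]; [apply continuous_const|].
  exact (diffC_cont _ _ _ (diffC_recip_pow N k u hN h)).
Qed.

Lemma contC_Cexp_lin (k u : C) : contCC (fun w => Cexp (k * w)) u.
Proof. exact (diffC_cont _ _ _ (diffC_Cexp_lin k u)). Qed.

Lemma gauss_kernel_cont (N : R) (k : nat) (w u : C) : 0 < N -> (1 - Cexp u / N)%C <> 0 ->
  contCC (gauss_kernel N k w) u.
Proof. intros; apply contC_mult; [apply contC_Cexp_lin | now apply contC_recip_pow]. Qed.

Lemma exp_pow_INR (x : R) (k : nat) : exp x ^ k = exp (INR k * x).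
Proof.
  induction k as [|k IH].
  - simpl. now rewrite Rmult_0_l, exp_0.
  - rewrite S_INR. simpl. rewrite IH, <- exp_plus. f_equal. ring.
Qed.

(** Far to the right of the pole, |recip N u| is at most 2 N e^(-Re u). *)
Lemma gauss_kernel_far (N : R) (k : nat) (w u : C) (th : R) :
  0 < N -> Rabs (Im u) <= th -> 2 * N <= exp (Re u) ->
  Cmod (gauss_kernel N k w u) <=
    exp (Rabs (Im w) * th) * (2 * N) ^ k * exp (- (Re w + INR k - 1) * Re u).
Proof.
  intros hN hi h. unfold gauss_kernel. rewrite Cmod_mult, Cmod_pow.
  assert (h1 := Cmod_Cexp_1m_le w u th hi).
  assert (h2 := Cmod_recip_far N u hN h).
  apply Rle_trans with (exp (Rabs (Im w) * th) * exp ((1 - Re w) * Re u) * (2 * N * exp (- Re u)) ^ k).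
  - apply Rmult_le_compat; auto.
    + apply Cmod_ge_0.
    + apply pow_le, Cmod_ge_0.
    + apply pow_incr. split; auto. apply Cmod_ge_0.
  - apply Req_le. rewrite Rpow_mult_distr.
    replace (exp (- (Re w + INR k - 1) * Re u)) with (exp ((1 - Re w) * Re u) * exp (- Re u) ^ k).
    + ring.
    + rewrite exp_pow_INR, <- exp_plus. f_equal. ring.
Qed.

Lemma exp_decay (K s : R) : 0 < s ->
  filterlim (fun b => K * exp (- s * b)) (Rbar_locally p_infty) (locally 0).
Proof.
  intros hs. apply (proj2 (filterlim_locally (U := R_UniformSpace) _ _)). intros eps.
  destruct (exp_neg_small (Rabs K) eps (cond_pos eps)) as [b0 hb].
  exists (b0 / s). intros b hbb.
  unfold ball; simpl; unfold AbsRing_ball, abs, minus, plus, opp; simpl.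
  rewrite Ropp_0, Rplus_0_r, Rabs_mult, (Rabs_right (exp _)) by (left; apply exp_pos).
  replace (- s * b) with (- (s * b)) by ring. apply hb.
  replace b0 with (s * (b0 / s)) by (field; lra). left. now apply Rmult_lt_compat_l.
Qed.

Lemma near_infty_exp (N : R) : Rbar_locally p_infty (fun b => 2 * N <= exp b).
Proof.
  exists (2 * N). intros b hb. destruct (Rle_dec 0 b) as [h|h].
  - destruct (Req_dec b 0) as [->|hn]; [rewrite exp_0; lra|].
    assert (h1 := exp_ineq1 b hn). lra.
  - assert (h1 := exp_pos b). lra.
Qed.

(** The half-strip contains the single pole ln N.  The truncated contour is the right
    side of a rectangle minus its whole boundary; the right side tends to 0 because
    Re w > 0, and Cauchy's formula gives the rest. *)
Lemma gauss_kernel_1 (th a N : R) (w : C) :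
  0 < th <= PI -> 0 < N -> a < ln N -> 0 < Re w ->
  is_hk th (gauss_kernel N 1 w) a (2 * PI * Ci * Cexp ((1 - w) * ln N))%C.
Proof.
  intros hth hN ha hw. assert (hn := RtoC_nz N ltac:(lra)).
  assert (hpi := PI_RGT_0).
  set (h := fun u => (- (Cexp ((1 - w) * u) / exp_quot (u - ln N)))%C).
  assert (hr : forall b, ln N < b ->
     rint (gauss_kernel N 1 w) a b (- th) th = (- (2 * PI * Ci * Cexp ((1 - w) * ln N)))%C).
  { intros b hb. rewrite (rint_ext _ (fun u => h u / (u - ln N))%C); try lra.
    2:{ intros u hu. unfold gauss_kernel, h, recip. simpl. rewrite Cmult_1_r, recip_den_factor by auto.
        assert (he : exp_quot (u - ln N) <> 0).
        { apply exp_quot_ln_nz. destruct hu as [_ [hi _]].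
          apply Rle_lt_trans with th; [apply Rabs_le|]; lra. }
        assert (hul : (u - ln N)%C <> 0).
        { apply Cminus_eq_contra. intros ->. unfold on_rect, Re, Im in hu; simpl in hu. lra. }
        field. auto. }
    rewrite (cauchy_rect h 1).
    - unfold h. replace (ln N - ln N)%C with (RtoC 0) by ring. rewrite exp_quot_0. field.
    - lra.
    - unfold Re; simpl. lra.
    - unfold Im; simpl. lra.
    - apply holo_opp, holo_div.
      + apply holo_Cexp, holo_mult; [apply holo_const | apply holo_id].
      + apply holo_exp_quot, holo_minus; [apply holo_id | apply holo_const].
      + intros u e [_ hi]. revert e. apply exp_quot_ln_nz.
        assert (h3 := PI2_3_2). apply Rabs_def1; lra. }
  apply (climit_of_bound _ (fun b => (th - - th) * (exp (Rabs (Im w) * th) * (2 * N) ^ 1) * exp (- Re w * b))).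
  2:{ now apply exp_decay. }
  assert (hbig : Rbar_locally p_infty (fun b => ln N < b)) by (exists (ln N); auto).
  generalize (filter_and _ _ hbig (near_infty_exp N)). apply filter_imp. intros b [hb1 hb2].
  rewrite hkT_rint, hr by auto.
  replace (vint (gauss_kernel N 1 w) b (- th) th - - (2 * PI * Ci * Cexp ((1 - w) * ln N))
      - 2 * PI * Ci * Cexp ((1 - w) * ln N))%C with (vint (gauss_kernel N 1 w) b (- th) th) by ring.
  unfold vint. rewrite Cmod_mult, Cmod_Ci, Rmult_1_l, Rmult_assoc.
  apply RIC_bound; try lra.
  - apply exRIC_cont; try lra. intros t ht. apply contC_v, gauss_kernel_cont; auto.
    apply recip_den_nz; auto.
    + unfold Im; simpl. apply Rabs_def1; lra.
    + intros e. apply (f_equal Re) in e. unfold Re in e; simpl in e. lra.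
  - intros t ht. replace (- Re w * b) with (- (Re w + INR 1 - 1) * Re (b, t)) by (unfold Re; simpl; ring).
    apply gauss_kernel_far; auto. apply Rabs_le. exact ht.
Qed.

Lemma contour_off_pole (th a N : R) (u : C) : 0 < th <= PI -> 0 < N -> a < ln N ->
  contour th a u -> (1 - Cexp u / N)%C <> 0.
Proof.
  intros hth hN ha hu. assert (hpi := PI_RGT_0).
  assert (hi := contour_Im th a u ltac:(lra) hu).
  apply recip_den_nz; auto; [lra|]. intros ->. unfold contour, Re, Im in hu; simpl in hu.
  destruct hu as [[_ [h|h]]|[h _]]; lra.
Qed.

(** Integration by parts.  The derivative of e^(-wu) (1 - e^u/N)^(-(k+1)) is
    (k+1)/N times the integrand of the conclusion minus w times that of the hypothesis,
    and its integral over the contour is 0. *)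
Lemma gauss_kernel_step (th a N : R) (k : nat) (w l : C) :
  0 < th <= PI -> 0 < N -> a < ln N -> 0 < Re w + INR (S k) ->
  is_hk th (gauss_kernel N (S k) (w + 1)) a l ->
  is_hk th (gauss_kernel N (S (S k)) w) a (RtoC N / INR (S k) * w * l)%C.
Proof.
  intros hth hN ha hw hl.
  assert (hn := RtoC_nz N ltac:(lra)).
  assert (hk := RtoC_nz (INR (S k)) ltac:(apply not_0_INR; lia)).
  set (P := fun u => (Cexp (- w * u) * recip N u ^ S k)%C).
  set (P' := fun u => (INR (S k) / N * gauss_kernel N (S (S k)) w u + - w * gauss_kernel N (S k) (w + 1) u)%C).
  assert (hgc : forall j v u, contour th a u -> contCC (gauss_kernel N j v) u).
  { intros j v u hu. apply gauss_kernel_cont; auto. now apply (contour_off_pole th a). }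
  assert (hP : forall u, contour th a u -> diffC P u (P' u) /\ contCC P' u).
  { intros u hu. assert (h0 := contour_off_pole th a N u hth hN ha hu). split.
    - assert (hd := diffC_mult _ _ _ _ _ (diffC_Cexp_lin (- w) u) (diffC_recip_pow N k u hN h0)).
      replace (P' u) with (- w * Cexp (- w * u) * recip N u ^ S k +
         Cexp (- w * u) * (INR (S k) * (Cexp u / N) * recip N u ^ S (S k)))%C; [exact hd|].
      unfold P', gauss_kernel.
      replace (1 - (w + 1))%C with (- w)%C by ring.
      replace ((1 - w) * u)%C with (- w * u + u)%C by ring. rewrite Cexp_plus.
      field. exact hn.
    - apply contC_plus; apply contC_mult; auto; apply continuous_const. }
  assert (hz : is_hk th P' a 0).
  { apply (climit_of_bound _ (fun b => 2 * (exp (Rabs (Im w) * th) * (2 * N) ^ S k) * exp (- (Re w + INR (S k)) * b))).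
    2:{ now apply exp_decay. }
    generalize (filter_and _ _ (near_infty a) (near_infty_exp N)). apply filter_imp. intros b [hb1 hb2].
    rewrite (hkT_deriv th a b P P') by (auto; lra).
    assert (hb : forall t, - th <= t <= th -> Cmod (P (b, t)) <=
      exp (Rabs (Im w) * th) * (2 * N) ^ S k * exp (- (Re w + INR (S k)) * b)).
    { intros t ht. unfold P.
      assert (hg := gauss_kernel_far N (S k) (w + 1) (b, t) th hN (Rabs_le t th ht) hb2).
      unfold gauss_kernel in hg. replace (1 - (w + 1))%C with (- w)%C in hg by ring.
      replace (Im (w + 1)) with (Im w) in hg by (destruct w; unfold Im; simpl; ring).
      replace (Re (w + 1)) with (Re w + 1) in hg by (destruct w; unfold Re; simpl; ring).
      replace (Re w + 1 + INR (S k) - 1) with (Re w + INR (S k)) in hg by ring. exact hg. }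
    replace (P (b, th) - P (b, - th)%R - 0)%C with (P (b, th) + - P (b, - th)%R)%C by ring.
    eapply Rle_trans; [apply Cmod_triangle|]. rewrite Cmod_opp.
    assert (g1 := hb th ltac:(lra)). assert (g2 := hb (- th) ltac:(lra)). lra. }
  apply (is_hk_ext th a (fun u => N / INR (S k) * (P' u + w * gauss_kernel N (S k) (w + 1) u))%C); [lra| |].
  { intros u _. unfold P'. field. auto. }
  replace (N / INR (S k) * w * l)%C with (N / INR (S k) * (0 + w * l))%C by ring.
  apply is_hk_scal; [lra| |].
  - intros u hu. apply contC_plus; [now apply hP|]. apply contC_mult; auto. apply continuous_const.
  - apply is_hk_plus; try lra; auto.
    + intros u hu. now apply hP.
    + intros u hu. apply contC_mult; auto. apply continuous_const.
    + apply is_hk_scal; auto; lra.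
Qed.

Lemma Re_plus_1 (w : C) : Re (w + 1) = Re w + 1.
Proof. reflexivity. Qed.

Lemma rising_shift (w : C) (k : nat) : rising w (S k) = (w * rising (w + 1) k)%C.
Proof.
  revert w. induction k as [|k IH]; intros w.
  - simpl. ring.
  - change (rising w (S (S k))) with (rising w (S k) * (w + INR (S (S k))))%C.
    rewrite IH. change (rising (w + 1) (S k)) with (rising (w + 1) k * (w + 1 + INR (S k)))%C.
    rewrite (S_INR (S k)), RtoC_plus. ring.
Qed.

Lemma fact_nz (n : nat) : RtoC (INR (fact n)) <> 0.
Proof. apply RtoC_nz, INR_fact_neq_0. Qed.

(** After k + 1 integrations by parts the exponent is 1 and w has become w + k + 1.
    For N = k + 2 the value is 2 PI i times a Gauss product, up to a factor which
    tends to 1. *)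
Lemma gauss_kernel_value (th a N : R) (k : nat) (w : C) :
  0 < th <= PI -> 0 < N -> a < ln N -> 0 < Re w + INR (S k) ->
  is_hk th (gauss_kernel N (S (S k)) w) a
    (2 * PI * Ci * (rising w k / INR (fact (S k)) * Cexp ((1 - w) * ln N)))%C.
Proof.
  intros hth hN ha. assert (hn := RtoC_nz N ltac:(lra)).
  assert (hN1 : forall w, (RtoC N * Cexp ((1 - (w + 1)) * ln N))%C = Cexp ((1 - w) * ln N)).
  { intros v. replace ((1 - v) * ln N)%C with (ln N + (1 - (v + 1)) * ln N)%C by ring.
    rewrite Cexp_plus, Cexp_real, exp_ln by auto. reflexivity. }
  revert w. induction k as [|k IH]; intros w hw.
  - replace (2 * PI * Ci * (rising w 0 / INR (fact 1) * Cexp ((1 - w) * ln N)))%C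
     with (RtoC N / INR 1 * w * (2 * PI * Ci * Cexp ((1 - (w + 1)) * ln N)))%C.
    + apply gauss_kernel_step; auto. apply gauss_kernel_1; auto.
    + rewrite <- (hN1 w). simpl. field.
  - assert (hf : RtoC (INR (fact (S (S k)))) = (INR (S (S k)) * INR (fact (S k)))%C).
    { rewrite <- RtoC_mult, <- mult_INR. reflexivity. }
    assert (hf0 := fact_nz (S k)).
    assert (hS := RtoC_nz (INR (S (S k))) ltac:(apply not_0_INR; lia)).
    rewrite rising_shift, hf, <- (hN1 w).
    replace (2 * PI * Ci * (w * rising (w + 1) k / (INR (S (S k)) * INR (fact (S k))) *
       (N * Cexp ((1 - (w + 1)) * ln N))))%C with
     (RtoC N / INR (S (S k)) * w * (2 * PI * Ci * (rising (w + 1) k / INR (fact (S k)) * Cexp ((1 - (w + 1)) * ln N))))%C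
      by (field; auto).
    apply gauss_kernel_step; auto. apply IH.
    rewrite S_INR in hw. rewrite Re_plus_1. lra.
Qed.

(** * From Gauss products to Hankel's formula for 1/Gamma *)

Lemma exp_le_mono (x y : R) : x <= y -> exp x <= exp y.
Proof. intros [h| ->]; [left; now apply exp_increasing | apply Rle_refl]. Qed.

Lemma Cpow_diff_bound (x y : C) (m : R) (n : nat) : Cmod x <= m -> Cmod y <= m ->
  Cmod (x ^ S n - y ^ S n) <= INR (S n) * Cmod (x - y) * m ^ n.
Proof.
  intros hx hy. assert (hm : 0 <= m) by (eapply Rle_trans; [apply Cmod_ge_0 | exact hx]).
  induction n as [|n IH].
  - replace (x ^ 1 - y ^ 1)%C with (x - y)%C by (simpl; ring). simpl. lra.
  - replace (x ^ S (S n) - y ^ S (S n))%C with (x * (x ^ S n - y ^ S n) + (x - y) * y ^ S n)%C by (simpl; ring).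
    eapply Rle_trans; [apply Cmod_triangle|]. rewrite !Cmod_mult, Cmod_pow.
    apply Rle_trans with (m * (INR (S n) * Cmod (x - y) * m ^ n) + Cmod (x - y) * m ^ S n).
    + apply Rplus_le_compat.
      * apply Rmult_le_compat; auto; apply Cmod_ge_0.
      * apply Rmult_le_compat_l; [apply Cmod_ge_0|]. apply pow_incr. split; auto. apply Cmod_ge_0.
    + apply Req_le. rewrite (S_INR (S n)). simpl. ring.
Qed.

(** 1/(1 - v) and e^v agree up to second order at 0. *)
Lemma one_minus_exp_bound (v : C) : Cmod (1 - (1 - v) * Cexp v) <= 2 * Cmod v ^ 2 * emax v.
Proof.
  replace (1 - (1 - v) * Cexp v)%C with (v * (Cexp v - 1) + - (Cexp v - 1 - v))%C by ring.
  eapply Rle_trans; [apply Cmod_triangle|]. rewrite Cmod_opp, Cmod_mult.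
  assert (h1 := Cexp_taylor1 v). assert (h2 := Cexp_taylor2 v). assert (h0 := Cmod_ge_0 v).
  assert (Cmod v * Cmod (Cexp v - 1) <= Cmod v * (Cmod v * emax v)) by (apply Rmult_le_compat_l; auto).
  simpl in *. lra.
Qed.

(** In the coordinate t = e^u this is e^t t^(-w) dt/du, the integrand of Hankel's
    formula for 1/Gamma(w). *)
Definition hankel_kernel (w u : C) : C := Cexp (Cexp u + (1 - w) * u).

Lemma hankel_kernel_cont (w u : C) : contCC (hankel_kernel w) u.
Proof.
  apply contC_Cexp, contC_plus; [apply contC_Cexp, continuous_id|].
  apply contC_mult; [apply continuous_const | apply continuous_id].
Qed.

(** The two functions are n+1-st powers of 1/(1 - v) and e^v with
    v = e^u/(n+1), up to the factor e^((1-w)u); the bases differ by O(v^2). *)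
Lemma gauss_kernel_error (w u : C) (n : nat) (th m B : R) :
  Rabs (Im u) <= th -> (1 - Cexp u / INR (S n))%C <> 0 ->
  Cmod (recip (INR (S n)) u) <= m -> exp (Re (Cexp u / INR (S n))) <= m ->
  emax (Cexp u / INR (S n)) <= B ->
  Cmod (gauss_kernel (INR (S n)) (S n) w u - hankel_kernel w u) <=
  exp (Rabs (Im w) * th) * exp ((1 - Re w) * Re u) * (2 * exp (Re u) ^ 2 * B / INR (S n) * m ^ S n).
Proof.
  intros hi h0 hm1 hm2 hB. set (N := INR (S n)) in *.
  assert (hN : 0 < N) by (apply lt_0_INR; lia). assert (hn := RtoC_nz N ltac:(lra)).
  assert (he : hankel_kernel w u = (Cexp ((1 - w) * u) * Cexp (Cexp u / N) ^ S n)%C).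
  { unfold hankel_kernel. rewrite Cplus_comm, Cexp_plus. f_equal. rewrite <- Cexp_nat. f_equal.
    fold N. field. exact hn. }
  rewrite he. unfold gauss_kernel.
  replace (Cexp ((1 - w) * u) * recip N u ^ S n - Cexp ((1 - w) * u) * Cexp (Cexp u / N) ^ S n)%C
    with (Cexp ((1 - w) * u) * (recip N u ^ S n - Cexp (Cexp u / N) ^ S n))%C by ring.
  rewrite Cmod_mult. apply Rmult_le_compat; try apply Cmod_ge_0.
  - exact (Cmod_Cexp_1m_le w u th hi).
  - eapply Rle_trans; [apply (Cpow_diff_bound _ _ m n); auto; rewrite Cmod_Cexp; auto|].
    fold N. set (v := (Cexp u / N)%C) in *.
    assert (hv : Cmod v = exp (Re u) / N).
    { unfold v. rewrite Cmod_div, Cmod_Cexp, Cmod_R, Rabs_right; auto; lra. }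
    assert (hd : Cmod (recip N u - Cexp v) <= m * (2 * (exp (Re u) / N) ^ 2 * B)).
    { replace (recip N u - Cexp v)%C with (recip N u * (1 - (1 - v) * Cexp v))%C.
      2:{ unfold recip. fold v. field. exact h0. }
      rewrite Cmod_mult. apply Rmult_le_compat; try apply Cmod_ge_0; auto.
      eapply Rle_trans; [apply one_minus_exp_bound|]. rewrite hv.
      apply Rmult_le_compat_l; auto. assert (h2 := pow2_ge_0 (exp (Re u) / N)). lra. }
    assert (hm : 0 <= m) by (eapply Rle_trans; [apply Cmod_ge_0 | exact hm1]).
    apply Rle_trans with (N * (m * (2 * (exp (Re u) / N) ^ 2 * B)) * m ^ n).
    + apply Rmult_le_compat_r; [now apply pow_le|]. apply Rmult_le_compat_l; lra.
    + apply Req_le. simpl. field. lra.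
Qed.

(** Uniformly in N >= j, (1 + c rho/N)^N grows at least like rho^j: group the N
    factors into j blocks of length N/j and apply Bernoulli's inequality to each. *)
Lemma pow_growth (c rho : R) (j N : nat) : 0 < c -> 0 < rho -> (1 <= j <= N)%nat ->
  (c * rho / (2 * INR j)) ^ j <= (1 + c * rho / INR N) ^ N.
Proof.
  intros hc hr hj.
  assert (hN : 0 < INR N) by (apply lt_0_INR; lia).
  assert (hjp : 0 < INR j) by (apply lt_0_INR; lia).
  set (q := (N / j)%nat).
  assert (hq1 : (j * q <= N)%nat) by (apply Nat.Div0.mul_div_le).
  assert (hq2 : (N < j * S q)%nat) by (apply Nat.mul_succ_div_gt; lia).
  assert (hq3 : (1 <= q)%nat) by (apply Nat.div_le_lower_bound; lia).
  set (x := c * rho / INR N).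
  assert (hx : 0 < x) by (apply Rdiv_lt_0_compat; auto; now apply Rmult_lt_0_compat).
  apply Rle_trans with ((1 + x) ^ (q * j)).
  2:{ apply Rle_pow; [lra | lia]. }
  rewrite pow_mult. apply pow_incr. split.
  - apply Rdiv_le_0_compat; [nra | lra].
  - apply Rle_trans with (1 + INR q * x); [|now apply poly].
    assert (h : INR N <= 2 * INR j * INR q).
    { replace 2 with (INR 2) by (simpl; ring). rewrite <- !mult_INR. apply le_INR. nia. }
    apply Rle_trans with (INR q * x); [|lra]. unfold x.
    apply Rmult_le_reg_r with (2 * INR j * INR N); [nra|].
    replace (c * rho / (2 * INR j) * (2 * INR j * INR N)) with (c * rho * INR N) by (field; lra).
    replace (INR q * (c * rho / INR N) * (2 * INR j * INR N)) with (c * rho * (2 * INR j * INR q)) by (field; lra).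
    apply Rmult_le_compat_l; nra.
Qed.

Lemma pow_growth_exp (c rho : R) (j : nat) : 0 < c -> 0 < rho -> (1 <= j)%nat ->
  (c * rho / (2 * INR j)) ^ j <= exp (c * rho).
Proof.
  intros hc hr hj. assert (hjp : 0 < INR j) by (apply lt_0_INR; lia).
  assert (hx : 0 <= c * rho / INR j) by (apply Rdiv_le_0_compat; nra).
  apply Rle_trans with ((1 + c * rho / INR j) ^ j); [apply pow_growth; auto; lia|].
  replace (c * rho) with (INR j * (c * rho / INR j)) at 2 by (field; lra).
  rewrite <- exp_pow_INR. apply pow_incr. split; [lra|]. apply exp_ineq1_le.
Qed.

(** On the rays |e^((1-w)u)| is of size e^((1-s)r) with s = Re w, and the error bound
    brings a further e^(2r); the decay of (1 + c e^r/N)^(-N), or of e^(-c e^r) in the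
    limit, beats both and leaves e^(-r). *)
Lemma ray_constant (c s : R) : 0 < c -> exists (j : nat) (K : R), (1 <= j)%nat /\ 0 < K /\
  (forall (N : nat) r, (j <= N)%nat -> 0 <= r ->
     exp ((3 - s) * r) * / (1 + c * exp r / INR N) ^ N <= K * exp (- r)) /\
  (forall r, 0 <= r -> exp ((3 - s) * r) * exp (- (c * exp r)) <= K * exp (- r)).
Proof.
  intros hc.
  (* with j >= 4 - s the power e^(j r) absorbs e^((3-s) r) and leaves e^(-r) *)
  destruct (INR_unbounded (Rmax 1 (4 - s))) as [j hj].
  assert (hj1 := Rmax_l 1 (4 - s)). assert (hj2 := Rmax_r 1 (4 - s)).
  assert (hjn : (1 <= j)%nat) by (apply INR_le; simpl; lra).
  assert (hjp : 0 < INR j) by lra.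
  exists j, (/ (c / (2 * INR j)) ^ j).
  assert (hK : 0 < (c / (2 * INR j)) ^ j) by (apply pow_lt, Rdiv_lt_0_compat; lra).
  split; [exact hjn|]. split; [now apply Rinv_0_lt_compat|].
  assert (key : forall r X, 0 <= r -> (c * exp r / (2 * INR j)) ^ j <= X ->
    exp ((3 - s) * r) * / X <= / (c / (2 * INR j)) ^ j * exp (- r)).
  { intros r X hr hX.
    replace (c * exp r / (2 * INR j)) with (c / (2 * INR j) * exp r) in hX by (field; lra).
    rewrite Rpow_mult_distr, exp_pow_INR in hX.
    assert (h1 : / X <= / ((c / (2 * INR j)) ^ j * exp (INR j * r))).
    { apply Rinv_le_contravar; auto. apply Rmult_lt_0_compat; auto. apply exp_pos. }
    apply Rle_trans with (exp ((3 - s) * r) * / ((c / (2 * INR j)) ^ j * exp (INR j * r))).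
    - apply Rmult_le_compat_l; auto. left; apply exp_pos.
    - rewrite Rinv_mult, <- exp_Ropp.
      replace (exp ((3 - s) * r) * (/ (c / (2 * INR j)) ^ j * exp (- (INR j * r))))
        with (/ (c / (2 * INR j)) ^ j * exp ((3 - s) * r + - (INR j * r))) by (rewrite exp_plus; ring).
      apply Rmult_le_compat_l; [left; now apply Rinv_0_lt_compat|].
      apply exp_le_mono. nra. }
  split.
  - intros N r hN hr. apply key; auto. apply pow_growth; auto. apply exp_pos.
  - intros r hr. rewrite exp_Ropp. apply key; auto. apply pow_growth_exp; auto. apply exp_pos.
Qed.

Lemma Re_Cexp (u : C) : Re (Cexp u) = exp (Re u) * cos (Im u).
Proof. reflexivity. Qed.

Lemma Re_div_real (z : C) (N : R) : N <> 0 -> Re (z / N) = Re z / N.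
Proof. intros h. destruct z; unfold Re; simpl. field. exact h. Qed.

Lemma Re_le_Cmod (z : C) : Re z <= Cmod z.
Proof. eapply Rle_trans; [apply Rle_abs | apply re_le_Cmod]. Qed.

Lemma cos_contour (th a : R) (u : C) : contour th a u -> Re u <> a -> cos (Im u) = cos th.
Proof.
  intros [[_ [h|h]]|[h _]] hn; [now rewrite h | rewrite h; apply cos_neg | tauto].
Qed.

(** An opening angle above PI/2 makes cos th negative, so that e^(e^u) decays doubly
    exponentially along the rays. *)
Lemma hankel_kernel_tame (th a : R) (w : C) : PI / 2 < th <= PI -> 0 <= a ->
  exists M, tame th a (hankel_kernel w) M.
Proof.
  intros hth ha. assert (hpi := PI_RGT_0).
  assert (hc : 0 < - cos th) by (assert (h := cos_lt_0 th ltac:(lra) ltac:(lra)); lra).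
  destruct (ray_constant (- cos th) (Re w) hc) as (j & K & hj & hK & _ & hray).
  set (A := exp (Rabs (Im w) * th)).
  set (M2 := exp ((1 - Re w) * a) * exp (exp a) * exp a).
  exists (A * (K + M2)). intros u hu. split; [apply hankel_kernel_cont|].
  assert (hi := contour_Im th a u ltac:(lra) hu). assert (hre := contour_Re th a u hu).
  unfold hankel_kernel. rewrite Cexp_plus, Cmod_mult, Cmod_Cexp, Re_Cexp.
  assert (h1 := Cmod_Cexp_1m_le w u th hi).
 fold A in h1.
  assert (hA : 0 < A) by apply exp_pos.
  assert (hM2 : 0 < M2) by (unfold M2; repeat apply Rmult_lt_0_compat; apply exp_pos).
  assert (her := exp_pos (- Re u)). set (r := Re u) in *.
  assert (hl : exp (exp r * cos (Im u)) * exp ((1 - Re w) * r) <= (K + M2) * exp (- r)).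
  { destruct (Req_dec r a) as [e|hne].
    - rewrite e. replace ((K + M2) * exp (- a)) with (K * exp (- a) + exp (exp a) * exp ((1 - Re w) * a)).
      + assert (hcos := COS_bound (Im u)). assert (hea := exp_pos a).
        assert (0 <= K * exp (- a)) by (apply Rmult_le_pos; [lra | left; apply exp_pos]).
        apply Rle_trans with (exp (exp a) * exp ((1 - Re w) * a)); [|lra].
        apply Rmult_le_compat_r; [left; apply exp_pos|]. apply exp_le_mono. nra.
      + unfold M2. rewrite exp_Ropp. field. apply Rgt_not_eq, exp_pos.
    - rewrite (cos_contour th a u hu hne).
      apply Rle_trans with (K * exp (- r)).
      2:{ apply Rmult_le_compat_r; lra. }
      eapply Rle_trans; [|apply (hray r); lra].
      rewrite (Rmult_comm (exp (exp r * _))). apply Rmult_le_compat; try (left; apply exp_pos).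
      + apply exp_le_mono. nra.
      + apply exp_le_mono. lra. }
  apply Rle_trans with (exp (exp r * cos (Im u)) * (A * exp ((1 - Re w) * r))).
  - apply Rmult_le_compat_l; auto. left; apply exp_pos.
  - replace (A * (K + M2) * exp (- r)) with (A * ((K + M2) * exp (- r))) by ring.
    replace (exp (exp r * cos (Im u)) * (A * exp ((1 - Re w) * r)))
      with (A * (exp (exp r * cos (Im u)) * exp ((1 - Re w) * r))) by ring.
    apply Rmult_le_compat_l; lra.
Qed.

(** On the rays v = e^u/N has a negative real part, and both |1/(1 - v)| and |e^v|
    are at most 1/(1 + c e^r/N) with c = - cos th.  On the left side |e^u| is fixed
    and both are at most exp(2 e^a/N). *)
Lemma gauss_kernel_error_tame (th a : R) (w : C) : PI / 2 < th <= PI -> 0 <= a ->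
  exists (n0 : nat) (K : R), forall n, (n0 <= n)%nat -> a < ln (INR (S n)) ->
    tame th a (fun u => gauss_kernel (INR (S n)) (S n) w u - hankel_kernel w u)%C (K / INR (S n)).
Proof.
  intros hth ha. assert (hpi := PI_RGT_0).
  assert (hc : 0 < - cos th) by (assert (h := cos_lt_0 th ltac:(lra) ltac:(lra)); lra).
  destruct (ray_constant (- cos th) (Re w) hc) as (j & K & hj & hK & hray & _).
  destruct (INR_unbounded (2 * exp a)) as [n1 hn1].
  set (A := exp (Rabs (Im w) * th)).
  set (M2 := exp ((1 - Re w) * a) * (2 * exp a ^ 2 * exp (exp a)) * exp (2 * exp a) * exp a).
  exists (j + n1)%nat, (A * (2 * K + M2)). intros n hn hln u hu.
  set (N := INR (S n)) in *.
  assert (hN1 : 1 <= N) by (apply (le_INR 1); lia).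
  assert (hN2 : 2 * exp a <= N).
  { apply Rle_trans with (INR n1); [lra|]. apply le_INR. lia. }
  assert (hoff := contour_off_pole th a N u ltac:(lra) ltac:(lra) hln hu).
  split.
  { apply contC_minus; [apply gauss_kernel_cont; auto; lra | apply hankel_kernel_cont]. }
  assert (hi := contour_Im th a u ltac:(lra) hu). assert (hre := contour_Re th a u hu).
  assert (hv : Cmod (Cexp u / N) = exp (Re u) / N).
  { rewrite Cmod_div, Cmod_Cexp, Cmod_R, Rabs_right; auto; try lra. apply RtoC_nz; lra. }
  assert (hRe : Re (Cexp u / N) = exp (Re u) * cos (Im u) / N) by (rewrite Re_div_real by lra; now rewrite Re_Cexp).
  assert (hA : 0 < A) by apply exp_pos.
  assert (hM2 : 0 < M2).
  { unfold M2; repeat apply Rmult_lt_0_compat; try apply exp_pos; lra. }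
  assert (her := exp_pos (- Re u)). set (r := Re u) in *. assert (hep := exp_pos r).
  assert (goal : exists m B, Cmod (recip N u) <= m /\ exp (Re (Cexp u / N)) <= m /\ emax (Cexp u / N) <= B /\
     exp ((1 - Re w) * r) * (2 * exp r ^ 2 * B * m ^ S n) <= (2 * K + M2) * exp (- r)).
  { destruct (Req_dec r a) as [e|hne].
    - rewrite e in *.
      assert (hx : 0 <= exp a / N <= / 2).
      { split; [apply Rdiv_le_0_compat; lra|]. apply Rmult_le_reg_r with N; [lra|].
        unfold Rdiv. rewrite Rmult_assoc, Rinv_l by lra. lra. }
      assert (hxa : exp a / N <= exp a).
      { apply Rmult_le_reg_r with N; [lra|]. unfold Rdiv. rewrite Rmult_assoc, Rinv_l by lra. nra. }
      exists (exp (2 * (exp a / N))), (exp (exp a)). repeat split.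
      + assert (hinv : / (1 - exp a / N) <= exp (2 * (exp a / N))).
        { rewrite <- (Rinv_inv (exp (2 * (exp a / N)))). apply Rinv_le_contravar; [apply Rinv_0_lt_compat, exp_pos|].
          apply Rmult_le_reg_r with (exp (2 * (exp a / N))); [apply exp_pos|].
          rewrite Rinv_l by (apply Rgt_not_eq, exp_pos).
          assert (h := exp_ineq1_le (2 * (exp a / N))). nra. }
        eapply Rle_trans; [|exact hinv]. unfold recip. rewrite Cmod_inv by auto.
        apply Rinv_le_contravar; [lra|].
        assert (ht := Cmod_triangle (1 - Cexp u / N) (Cexp u / N)).
        replace (1 - Cexp u / N + Cexp u / N)%C with (RtoC 1) in ht by ring.
        rewrite Cmod_1, hv in ht. lra.
      + apply exp_le_mono. eapply Rle_trans; [apply Re_le_Cmod|]. rewrite hv. lra.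
      + unfold emax. apply Rmax_lub.
        * rewrite <- exp_0. apply exp_le_mono. lra.
        * apply exp_le_mono. eapply Rle_trans; [apply Re_le_Cmod|]. rewrite hv. lra.
      + rewrite (exp_pow_INR (2 * (exp a / N)) (S n)). fold N. replace (N * (2 * (exp a / N))) with (2 * exp a) by (field; lra).
        replace ((2 * K + M2) * exp (- a)) with (2 * K * exp (- a) + M2 * exp (- a)) by ring.
        replace (M2 * exp (- a)) with (exp ((1 - Re w) * a) * (2 * exp a ^ 2 * exp (exp a) * exp (2 * exp a))).
        2:{ unfold M2. rewrite exp_Ropp. field. lra. }
        assert (hk2 : 0 < K * exp (- a)) by (apply Rmult_lt_0_compat; auto). lra.
    - assert (hcos := cos_contour th a u hu hne). rewrite hcos in *.
      set (c := - cos th) in *. replace (cos th) with (- c) in * by (unfold c; ring).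
      assert (hx : 0 < c * exp r / N) by (apply Rdiv_lt_0_compat; [now apply Rmult_lt_0_compat|lra]).
      exists (/ (1 + c * exp r / N)), 1. repeat split.
      + unfold recip. rewrite Cmod_inv by auto. apply Rinv_le_contravar; [lra|].
        eapply Rle_trans; [|apply Re_le_Cmod].
        change (Re (1 - Cexp u / N)) with (1 - Re (Cexp u / N)). rewrite hRe.
        apply Req_le. unfold Rdiv; ring.
      + rewrite hRe. replace (exp r * - c / N) with (- (c * exp r / N)) by (unfold Rdiv; ring).
        rewrite exp_Ropp. apply Rinv_le_contravar; [lra|]. apply exp_ineq1_le.
      + unfold emax. apply Rmax_lub; [lra|]. replace 1 with (exp 0) by apply exp_0. apply exp_le_mono. rewrite hRe.
        replace (exp r * - c / N) with (- (c * exp r / N)) by (unfold Rdiv; ring). lra.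
      + rewrite pow_inv.
        assert (h := hray (S n) r ltac:(lia) ltac:(lra)). fold N in h.
        replace (exp ((1 - Re w) * r) * (2 * exp r ^ 2 * 1 * / (1 + c * exp r / N) ^ S n))
          with (2 * (exp ((3 - Re w) * r) * / (1 + c * exp r / N) ^ S n)).
        * apply Rle_trans with (2 * (K * exp (- r))); [lra|]. nra.
        * replace ((3 - Re w) * r) with ((1 - Re w) * r + INR 2 * r) by (simpl; ring).
          rewrite exp_plus, <- exp_pow_INR. ring. }
  destruct goal as (m & B & g1 & g2 & g3 & g4).
  eapply Rle_trans; [apply (gauss_kernel_error w u n th m B); auto|]. fold N A r.
  apply Rle_trans with (A * (exp ((1 - Re w) * r) * (2 * exp r ^ 2 * B * m ^ S n)) / N).
  - apply Req_le. field. lra.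
  - replace (A * (2 * K + M2) / N * exp (- r)) with (A * ((2 * K + M2) * exp (- r)) / N) by (field; lra).
    apply Rmult_le_compat_r; [left; apply Rinv_0_lt_compat; lra|]. apply Rmult_le_compat_l; lra.
Qed.

Lemma CLim_climit (u : nat -> C) (l : C) : climit u eventually l -> CLim u = l.
Proof.
  intros h. apply injective_projections; simpl.
  - rewrite (is_lim_seq_unique _ (Re l)); [reflexivity|].
    apply (filterlim_comp _ _ _ u Re _ _ _ h).
    apply (continuous_fst (U := R_UniformSpace) (V := R_UniformSpace)).
  - rewrite (is_lim_seq_unique _ (Im l)); [reflexivity|].
    apply (filterlim_comp _ _ _ u Im _ _ _ h).
    apply (continuous_snd (U := R_UniformSpace) (V := R_UniformSpace)).
Qed.

Lemma lim_inv_S : is_lim_seq (fun n => / INR (S n)) 0.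
Proof.
  apply (is_lim_seq_incr_1 (fun n => / INR n)).
  replace (Finite 0) with (Rbar_inv p_infty) by reflexivity.
  apply is_lim_seq_inv; [apply is_lim_seq_INR | discriminate].
Qed.

Lemma lim_scal_0 (u : nat -> R) (K : R) : is_lim_seq u 0 -> is_lim_seq (fun n => K * u n) 0.
Proof.
  intros h. replace (Finite 0) with (Rbar_mult K 0) by (simpl; f_equal; ring).
  now apply is_lim_seq_scal_l.
Qed.

Lemma climit_real (u : nat -> R) (f : R -> C) (l : R) :
  is_lim_seq u l -> contC f l -> climit (fun n => f (u n)) eventually (f l).
Proof. intros hu hf. exact (filterlim_comp _ _ _ u f _ _ _ hu hf). Qed.

Lemma ln_ratio_bound (n : nat) : 0 <= ln (INR (S (S (S n)))) - ln (INR (S n)) <= 2 * / INR (S n).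
Proof.
  assert (hp : 0 < INR (S n)) by (apply lt_0_INR; lia).
  assert (hx : 0 < 2 * / INR (S n)) by (apply Rmult_lt_0_compat; [lra | now apply Rinv_0_lt_compat]).
  replace (ln (INR (S (S (S n)))) - ln (INR (S n))) with (ln (1 + 2 * / INR (S n))).
  - split.
    + rewrite <- ln_1. apply ln_le; lra.
    + rewrite <- (ln_exp (2 * / INR (S n))) at 2. apply ln_le; [lra|]. apply exp_ineq1_le.
  - replace (INR (S (S (S n)))) with (INR (S n) * (1 + 2 * / INR (S n))).
    + rewrite ln_mult; lra.
    + rewrite !(S_INR (S _)). field. lra.
Qed.

(** The integrals of the approximants with N = n + 2 tend to the integral L of the
    kernel.  They equal 2 PI i times the Gauss quotient at n, multiplied by factors
    (n+2)/(n+1) and (n/(n+2))^w which tend to 1. *)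
Lemma rGamma_hankel (th a : R) (w : C) : PI / 2 < th <= PI -> 0 <= a ->
  is_hk th (hankel_kernel w) a (2 * PI * Ci * rGamma w)%C.
Proof.
  intros hth ha. assert (hpi := PI_RGT_0).
  destruct (hankel_kernel_tame th a w hth ha) as [M hM].
  destruct (tame_converges th a M _ hM) as [L hL].
  set (v := fun n => (2 * PI * Ci * (rising w n / INR (fact (S n)) * Cexp ((1 - w) * ln (INR (S (S n))))))%C).
  assert (hv : climit v eventually L).
  { destruct (gauss_kernel_error_tame th a w hth ha) as (n0 & K & hK).
    apply (climit_of_bound _ (fun n => (2 + 2 * th) * exp (- a) * (K / INR (S (S n))))).
    2:{ change (is_lim_seq (fun n => (2 + 2 * th) * exp (- a) * (K / INR (S (S n)))) (Finite 0)).
        apply (is_lim_seq_ext (fun n => (2 + 2 * th) * exp (- a) * K * / INR (S (S n)))).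
        - intros n. unfold Rdiv. ring.
        - apply lim_scal_0. apply (is_lim_seq_incr_1 (fun n => / INR (S n))). apply lim_inv_S. }
    destruct (INR_unbounded (exp a)) as [n1 hn1].
    destruct (INR_unbounded (- Re w)) as [n2 hn2].
    exists (n0 + n1 + n2)%nat. intros n hn.
    assert (hN : 0 < INR (S (S n))) by (apply lt_0_INR; lia).
    assert (hln : a < ln (INR (S (S n)))).
    { rewrite <- (ln_exp a). apply ln_increasing; [apply exp_pos|].
      apply Rlt_le_trans with (INR n1); [lra|]. apply le_INR. lia. }
    apply (is_hk_bound th a _ (fun u => gauss_kernel (INR (S (S n))) (S (S n)) w u - hankel_kernel w u)%C); [lra| |].
    - apply hK; auto; lia.
    - apply is_hk_minus; auto; try lra.
      + intros u hu. apply gauss_kernel_cont; auto. apply (contour_off_pole th a); auto; lra.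
      + intros u hu. apply hankel_kernel_cont.
      + apply gauss_kernel_value; auto; try lra.
        assert (INR n2 <= INR (S n)) by (apply le_INR; lia). lra. }
  replace (2 * PI * Ci * rGamma w)%C with L; [exact hL|].
  unfold rGamma. rewrite (CLim_climit _ (/ (2 * PI * Ci) * (L * 1))%C).
  { field. split; [apply Ci_nz | apply RtoC_nz; lra]. }
  apply (filterlim_ext_loc (F := eventually)
    (fun n => / (2 * PI * Ci) * (v n * (RtoC (1 - / INR (S (S n))) * Cexp (RtoC (ln (INR (S (S n))) - ln (INR n)) * w))))%C).
  { exists 1%nat. intros n hn. unfold v, polar_power.
    assert (hn0 : 0 < INR n) by (apply lt_0_INR; lia).
    assert (hN : 0 < INR (S (S n))) by (apply lt_0_INR; lia).
    assert (hf : RtoC (INR (fact (S n))) = ((INR n + 1) * INR (fact n))%C).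
    { rewrite <- RtoC_plus, <- S_INR, <- RtoC_mult, <- mult_INR. reflexivity. }
    assert (hf0 := fact_nz n).
    assert (e1 : RtoC (1 - / INR (S (S n))) = ((INR n + 1) / INR (S (S n)))%C).
    { rewrite <- RtoC_plus, <- RtoC_div by lra. f_equal. rewrite !S_INR. field. rewrite !S_INR in hN. lra. }
    assert (e2 : (w * (ln (INR n), 0))%C = (RtoC (ln (INR n)) * w)%C) by (rewrite Cmult_comm; reflexivity).
    assert (e3 : ((1 - w) * ln (INR (S (S n))))%C = (ln (INR (S (S n))) - ln (INR (S (S n))) * w)%C) by ring.
    rewrite e1, e2, e3, hf, RtoC_minus.
    replace ((ln (INR (S (S n))) - ln (INR n)) * w)%C
      with (ln (INR (S (S n))) * w - ln (INR n) * w)%C by ring.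
    rewrite !Cexp_minus, Cexp_real, exp_ln by auto.
    assert (nn : (INR n + 1)%C <> 0) by (rewrite <- RtoC_plus; apply RtoC_nz; lra).
    assert (nN := RtoC_nz _ (Rgt_not_eq _ _ hN)).
    field. repeat split; auto using Cexp_nz, Ci_nz. apply RtoC_nz; lra. }
  apply climit_scal, climit_mult; [exact hv|].
  replace (RtoC 1) with (RtoC (1 - 0) * Cexp (RtoC 0 * w))%C.
  2:{ rewrite Cmult_0_l, Cexp_0, Rminus_0_r. ring. }
  apply climit_mult.
  - apply (climit_real (fun n => / INR (S (S n))) (fun t => RtoC (1 - t)) 0).
    + apply (is_lim_seq_incr_1 (fun n => / INR (S n))). apply lim_inv_S.
    + apply contC_RtoC, cont_Rminus; [apply continuous_const | apply continuous_id].
  - apply (climit_real (fun n => ln (INR (S (S n))) - ln (INR n)) (fun t => Cexp (RtoC t * w)) 0).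
    + apply is_lim_seq_incr_1. apply is_lim_seq_le_le with (fun _ => 0) (fun n => 2 * / INR (S n)).
      * intros n. apply ln_ratio_bound.
      * apply is_lim_seq_const.
      * apply lim_scal_0, lim_inv_S.
    + apply contC_Cexp_line.
Qed.

(** * The Mittag-Leffler series as a contour integral *)

(** The ratio x / t^alpha of the geometric expansion of 1 / (t^alpha - x). *)
Definition ratio (alpha : R) (x u : C) : C := (x * Cexp (- alpha * u))%C.

Lemma ratio_small (th a alpha : R) (x : C) : 0 < alpha -> 2 * Cmod x <= exp (alpha * a) ->
  forall u, contour th a u -> contCC (ratio alpha x) u /\ Cmod (ratio alpha x u) <= / 2.
Proof.
  intros hal hx u hu. split.
  - apply contC_mult; [apply continuous_const | apply contC_Cexp_lin].
  - assert (hre := contour_Re th a u hu).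
    unfold ratio. rewrite Cmod_mult, Cmod_Cexp.
    replace (Re (- alpha * u)%C) with (- (alpha * Re u)) by (destruct u; unfold Re; simpl; ring).
    rewrite exp_Ropp. assert (hp := exp_pos (alpha * Re u)).
    apply Rmult_le_reg_r with (exp (alpha * Re u)); [exact hp|].
    rewrite Rmult_assoc, Rinv_l, Rmult_1_r by lra.
    assert (h : exp (alpha * a) <= exp (alpha * Re u)) by (apply exp_le_mono, Rmult_le_compat_l; lra).
    lra.
Qed.

Lemma hankel_kernel_shift (mu s u : C) :
  hankel_kernel (s + mu) u = (hankel_kernel mu u * Cexp (- s * u))%C.
Proof. unfold hankel_kernel. rewrite <- Cexp_plus. f_equal. ring. Qed.

(** The general term of the series is the integral of the kernel of 1/Gamma(mu) times
    powers of the three ratios.  The repeated sums are taken under the integral one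
    after the other, starting from the innermost. *)
Lemma mittag_leffler3_hankel (th a alpha beta gamma : R) (x y z mu : C) :
  PI / 2 < th <= PI -> 0 <= a -> 0 < alpha -> 0 < beta -> 0 < gamma ->
  2 * Cmod x <= exp (alpha * a) -> 2 * Cmod y <= exp (beta * a) -> 2 * Cmod z <= exp (gamma * a) ->
  is_hk th (fun u => hankel_kernel mu u / (2 * PI * Ci) / (1 - ratio gamma z u)
      / (1 - ratio beta y u) / (1 - ratio alpha x u))%C a
    (mittag_leffler3 alpha beta gamma x y z mu).
Proof.
  intros hth ha hal hbe hga hx hy hz. assert (hpi := PI_RGT_0).
  assert (hX := ratio_small th a alpha x hal hx).
  assert (hY := ratio_small th a beta y hbe hy).
  assert (hZ := ratio_small th a gamma z hga hz).
  set (X := ratio alpha x) in *. set (Y := ratio beta y) in *. set (Z := ratio gamma z) in *.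
  destruct (hankel_kernel_tame th a mu hth ha) as [M0 hM0].
  set (K := fun u => (hankel_kernel mu u / (2 * PI * Ci))%C).
  assert (hK : tame th a K (M0 * Cmod (/ (2 * PI * Ci)))).
  { apply (tame_mult th a M0 _ (hankel_kernel mu) (fun _ => / (2 * PI * Ci))%C); auto.
    intros u _. split; [apply continuous_const | lra]. }
  set (M := M0 * Cmod (/ (2 * PI * Ci))) in *.
  assert (term : forall n m p, is_hk th (fun u => K u * X u ^ n * Y u ^ m * Z u ^ p)%C a
    (x ^ n * y ^ m * z ^ p * rGamma (INR n * alpha + INR m * beta + INR p * gamma + mu))%C).
  { intros n m p. set (s := (INR n * alpha + INR m * beta + INR p * gamma)%C).
    assert (h := rGamma_hankel th a (s + mu) hth ha).
    apply (is_hk_scal th a _ (x ^ n * y ^ m * z ^ p / (2 * PI * Ci))%C) in h; [|lra|intros; apply hankel_kernel_cont].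
    replace (x ^ n * y ^ m * z ^ p * rGamma (s + mu))%C
      with (x ^ n * y ^ m * z ^ p / (2 * PI * Ci) * (2 * PI * Ci * rGamma (s + mu)))%C
      by (field; split; [apply Ci_nz | apply RtoC_nz; lra]).
    revert h. apply is_hk_ext; [lra|]. intros u _. rewrite hankel_kernel_shift.
    unfold K, X, Y, Z, ratio. rewrite !Cpow_mult_l, <- !Cexp_nat.
    replace (- s * u)%C with (INR n * (- alpha * u) + INR m * (- beta * u) + INR p * (- gamma * u))%C
      by (unfold s; ring).
    rewrite !Cexp_plus. field. split; [apply Ci_nz | apply RtoC_nz; lra]. }
  assert (hq : 0 <= / 2 < 1) by lra.
  assert (small : forall (W : C -> C) n, (forall u, contour th a u -> contCC W u /\ Cmod (W u) <= / 2) ->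
     forall u, contour th a u -> contCC (fun u => W u ^ n)%C u /\ Cmod (W u ^ n) <= 1).
  { intros W n hW u hu. destruct (pow_small th a (/ 2) W n hW u hu) as [h1 h2]. split; auto.
    apply Rle_trans with ((/ 2) ^ n); auto. rewrite <- (pow1 n). apply pow_incr. lra. }
  assert (T1 : forall n, tame th a (fun u => K u * X u ^ n)%C (M * 1)).
  { intros n. apply tame_mult; auto. }
  assert (T2 : forall n m, tame th a (fun u => K u * X u ^ n * Y u ^ m)%C (M * 1 * 1)).
  { intros n m. apply (tame_mult th a _ _ (fun u => K u * X u ^ n)%C); auto. }
  assert (S1 : forall n m, is_hk th (fun u => K u * X u ^ n * Y u ^ m / (1 - Z u))%C a
    (CSeries (fun p => x ^ n * y ^ m * z ^ p * rGamma (INR n * alpha + INR m * beta + INR p * gamma + mu))%C)).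
  { intros n m. eapply (hk_geometric th a _ (/ 2)); eauto; lra. }
  assert (S2 : forall n, is_hk th (fun u => K u * X u ^ n / (1 - Z u) / (1 - Y u))%C a
    (CSeries (fun m => CSeries (fun p => x ^ n * y ^ m * z ^ p * rGamma (INR n * alpha + INR m * beta + INR p * gamma + mu))%C))).
  { intros n. apply (hk_geometric th a (M * 1 / (1 - / 2)) (/ 2) (fun u => K u * X u ^ n / (1 - Z u))%C Y); auto; try lra.
    - apply (tame_geometric th a _ (/ 2) (fun u => K u * X u ^ n)%C Z); [lra | apply T1 | exact hZ].
    - intros m. generalize (S1 n m). apply is_hk_ext; [lra|]. intros u _. unfold Cdiv. ring. }
  assert (S3 := hk_geometric th a (M / (1 - / 2) / (1 - / 2)) (/ 2) (fun u => K u / (1 - Z u) / (1 - Y u))%C X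
    (fun n => CSeries (fun m => CSeries (fun p => x ^ n * y ^ m * z ^ p * rGamma (INR n * alpha + INR m * beta + INR p * gamma + mu))%C))).
  apply S3; auto; try lra.
  - apply (tame_geometric th a _ (/ 2) (fun u => K u / (1 - Z u))%C Y); [lra| |exact hY].
    apply (tame_geometric th a _ (/ 2) K Z); [lra | exact hK | exact hZ].
  - intros n. generalize (S2 n). apply is_hk_ext; [lra|]. intros u _. unfold Cdiv. ring.
Qed.

(** * Poles and residues in the strip *)

(** The logarithm of the principal value of x^(1/alpha). *)
Definition pole (alpha : R) (x : C) : C := (RtoC (/ alpha) * (ln (Cmod x), Carg x))%C.

Lemma Cexp_Clog (x : C) : x <> 0 -> Cexp (ln (Cmod x), Carg x) = x.
Proof.
  intros hx. assert (hp := proj1 (Cmod_gt_0 x) hx).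
  set (t := Re x / Cmod x).
  assert (ht : -1 <= t <= 1).
  { assert (h := re_le_Cmod x). apply Rabs_le_between in h. unfold t.
    split; apply Rmult_le_reg_r with (Cmod x); auto; unfold Rdiv; rewrite Rmult_assoc, Rinv_l; lra. }
  assert (hs : sqrt (1 - t²) = Rabs (Im x) / Cmod x).
  { assert (h2 := Cmod2_alt x).
    assert (e : 1 - t² = (Rabs (Im x) / Cmod x)²).
    { unfold t, Rsqr.
      transitivity ((Cmod x ^ 2 - Re x ^ 2) / (Cmod x * Cmod x)); [field; lra|].
      assert (h3 : Cmod x ^ 2 = Re x ^ 2 + Im x ^ 2).
      { exact h2. }
      rewrite h3. replace (Im x ^ 2) with (Rabs (Im x) * Rabs (Im x)).
      - field. lra.
      - rewrite <- Rabs_mult, Rabs_right; [ring|nra]. }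
    rewrite e. apply sqrt_Rsqr. apply Rdiv_le_0_compat; auto. apply Rabs_pos. }
  unfold Cexp, Re at 1 2, Im; simpl. rewrite exp_ln by auto.
  unfold Carg. fold t.
  apply injective_projections; simpl.
  - replace (cos (if Rle_dec 0 (Im x) then acos t else - acos t)) with t.
    + change (fst x) with (Re x). unfold t. field. lra.
    + destruct (Rle_dec 0 (Im x)); [|rewrite cos_neg]; now rewrite cos_acos.
  - change (snd x) with (Im x).
    destruct (Rle_dec 0 (Im x)) as [h|h]; [|rewrite sin_neg]; rewrite sin_acos, hs by auto.
    + rewrite Rabs_right by lra. field. lra.
    + rewrite Rabs_left by lra. field. lra.
Qed.

Lemma Rabs_Carg_le_PI (x : C) : Rabs (Carg x) <= PI.
Proof.
  unfold Carg. assert (h := acos_bound (Re x / Cmod x)).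
  destruct (Rle_dec 0 (Im x)); apply Rabs_le; lra.
Qed.

Lemma pole_mult (alpha k : R) (x : C) : alpha <> 0 ->
  (k * pole alpha x)%C = (RtoC (k / alpha) * (ln (Cmod x), Carg x))%C.
Proof.
  intros ha. unfold pole. rewrite RtoC_div, RtoC_inv by auto. field. now apply RtoC_nz.
Qed.

Lemma Cexp_pole (alpha : R) (x : C) : alpha <> 0 -> x <> 0 -> Cexp (alpha * pole alpha x) = x.
Proof.
  intros ha hx. rewrite pole_mult by auto.
  replace (alpha / alpha) with 1 by (field; auto). rewrite Cmult_1_l. now apply Cexp_Clog.
Qed.

(** What remains of e^(alpha u) - x when its zero at [pole alpha x] is divided out. *)
Definition unit_factor (alpha : R) (x u : C) : C :=
  (x * alpha * exp_quot (alpha * (u - pole alpha x)))%C.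

Lemma pole_factor (alpha : R) (x u : C) : alpha <> 0 -> x <> 0 ->
  (Cexp (alpha * u) - x)%C = (unit_factor alpha x u * (u - pole alpha x))%C.
Proof.
  intros ha hx. unfold unit_factor.
  replace (x * alpha * exp_quot (alpha * (u - pole alpha x)) * (u - pole alpha x))%C
    with (x * (alpha * (u - pole alpha x) * exp_quot (alpha * (u - pole alpha x))))%C by ring.
  rewrite exp_quot_spec.
  replace (alpha * (u - pole alpha x))%C with (alpha * u - alpha * pole alpha x)%C by ring.
  rewrite Cexp_minus, Cexp_pole by auto. field. exact hx.
Qed.

(** The other zeros of e^(alpha u) - x have ordinates
    (Carg x + 2 PI k) / alpha with k <> 0, beyond the strip |Im u| <= t. *)
Lemma unit_factor_nz (alpha t : R) (x u : C) : 0 < alpha -> x <> 0 ->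
  alpha * t + Rabs (Carg x) < 2 * PI -> Rabs (Im u) <= t -> unit_factor alpha x u <> 0.
Proof.
  intros ha hx ht hu. unfold unit_factor.
  apply Cmult_neq_0; [apply Cmult_neq_0; auto; apply RtoC_nz; lra|].
  apply exp_quot_nz.
  replace (alpha * (u - pole alpha x))%C with (alpha * u - alpha * pole alpha x)%C by ring.
  rewrite pole_mult by lra. replace (alpha / alpha) with 1 by (field; lra).
  replace (Im (alpha * u - 1 * (ln (Cmod x), Carg x))%C) with (alpha * Im u - Carg x)
    by (destruct u; unfold Im; simpl; ring).
  unfold Rminus. eapply Rle_lt_trans; [apply Rabs_triang|]. rewrite Rabs_Ropp, Rabs_mult, (Rabs_right alpha) by lra.
  assert (alpha * Rabs (Im u) <= alpha * t) by (apply Rmult_le_compat_l; lra). lra.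
Qed.

Lemma unit_factor_pole (alpha : R) (x : C) : unit_factor alpha x (pole alpha x) = (x * alpha)%C.
Proof.
  unfold unit_factor. replace (alpha * (pole alpha x - pole alpha x))%C with (RtoC 0) by ring.
  rewrite exp_quot_0. ring.
Qed.

Lemma holo_unit_factor (D : C -> Prop) (alpha : R) (x : C) : holo D (unit_factor alpha x).
Proof.
  apply holo_mult; [apply holo_const|]. apply holo_exp_quot, holo_mult; [apply holo_const|].
  apply holo_minus; [apply holo_id | apply holo_const].
Qed.

(** The integrand of the theorem in the coordinate u; kappa exceeds the exponent of t
    by 1, the contribution of dt = e^u du. *)
Definition ml_integrand (alpha beta gamma : R) (x y z kappa u : C) : C :=
  (Cexp (Cexp u) * Cexp (kappa * u) /
    ((Cexp (alpha * u) - x) * (Cexp (beta * u) - y) * (Cexp (gamma * u) - z)))%C.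

Definition ml_residue (alpha beta gamma : R) (x y z kappa : C) : C :=
  (1 / alpha * (Cexp (Cexp (pole alpha x)) * Cexp ((kappa - alpha) * pole alpha x)
   / ((Cexp (beta * pole alpha x) - y) * (Cexp (gamma * pole alpha x) - z))))%C.

(** At p the derivative of e^(alpha u) - x is alpha x, and x = e^(alpha p) turns
    e^(kappa p) / x into e^((kappa - alpha) p). *)
Lemma ml_residue_value (alpha beta gamma : R) (x y z kappa : C) :
  alpha <> 0 -> beta <> 0 -> gamma <> 0 -> x <> 0 -> y <> 0 -> z <> 0 ->
  Cexp (beta * pole alpha x) <> y -> Cexp (gamma * pole alpha x) <> z ->
  let p := pole alpha x in
  (Cexp (Cexp p) * Cexp (kappa * p) / (unit_factor alpha x p * unit_factor beta y p * unit_factor gamma z p)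
    / ((p - pole beta y) * (p - pole gamma z)))%C = ml_residue alpha beta gamma x y z kappa.
Proof.
  intros ha hb hc hx hy hz hxy hxz p. unfold ml_residue. fold p.
  fold p in hxy, hxz. apply Cminus_eq_contra in hxy, hxz.
  rewrite (pole_factor beta y p), (pole_factor gamma z p) in * by auto.
  assert (e : Cexp (kappa * p) = (x * Cexp ((kappa - alpha) * p))%C).
  { rewrite <- (Cexp_pole alpha x) at 1 by auto. fold p. rewrite <- Cexp_plus. f_equal. ring. }
  assert (ep : unit_factor alpha x p = (x * alpha)%C) by apply unit_factor_pole.
  rewrite e, ep.
  assert (han := RtoC_nz alpha ha).
  assert (nz : forall s t : C, (s * t)%C <> 0 -> s <> 0 /\ t <> 0).
  { intros s t h. split; intros e'; apply h; rewrite e'; ring. }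
  apply nz in hxy, hxz. field. tauto.
Qed.

Lemma pole_Re (alpha : R) (x : C) : Re (pole alpha x) = ln (Cmod x) / alpha.
Proof. unfold pole, Re; simpl. unfold Rdiv. ring. Qed.

Lemma pole_Im (alpha : R) (x : C) : Im (pole alpha x) = Carg x / alpha.
Proof. unfold pole, Im; simpl. unfold Rdiv. ring. Qed.

(** The pole lies in the open rectangle, and by the last inequality its translates
    by nonzero multiples of 2 PI i / alpha have ordinates larger than th in absolute
    value. *)
Definition pole_inside (a0 a th alpha : R) (x : C) : Prop :=
  0 < alpha /\ x <> 0 /\ alpha * a0 < ln (Cmod x) < alpha * a /\
  Rabs (Carg x) < alpha * th /\ alpha * th + Rabs (Carg x) < 2 * PI.

Lemma pole_inside_rect (a0 a th alpha : R) (x : C) : pole_inside a0 a th alpha x ->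
  a0 < Re (pole alpha x) < a /\ - th < Im (pole alpha x) < th.
Proof.
  intros (ha & _ & h1 & h2 & _). rewrite pole_Re, pole_Im. apply Rabs_def2 in h2.
  assert (hc : forall s t, s < t -> s / alpha < t / alpha).
  { intros s t h. apply Rmult_lt_compat_r; auto. now apply Rinv_0_lt_compat. }
  replace a0 with (alpha * a0 / alpha) by (field; lra).
  replace a with (alpha * a / alpha) by (field; lra).
  replace (- th) with (- (alpha * th) / alpha) by (field; lra).
  replace th with (alpha * th / alpha) at 2 by (field; lra).
  repeat split; apply hc; lra.
Qed.

(** The conditions on the strip are open, so they persist on a slightly wider one. *)
Lemma pole_margin (a0 a th alpha : R) (x : C) : pole_inside a0 a th alpha x ->
  exists m, 0 < m /\ alpha * (th + m) + Rabs (Carg x) < 2 * PI.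
Proof.
  intros (ha & _ & _ & _ & h). exists ((2 * PI - (alpha * th + Rabs (Carg x))) / (2 * alpha)). split.
  - apply Rdiv_lt_0_compat; lra.
  - replace (alpha * (th + (2 * PI - (alpha * th + Rabs (Carg x))) / (2 * alpha)))
     with (alpha * th + (2 * PI - (alpha * th + Rabs (Carg x))) / 2) by (field; lra). lra.
Qed.

Lemma rint_ml (alpha beta gamma a0 a th : R) (x y z kappa : C) :
  pole_inside a0 a th alpha x -> pole_inside a0 a th beta y -> pole_inside a0 a th gamma z ->
  Cexp (beta * pole alpha x) <> y -> Cexp (gamma * pole alpha x) <> z ->
  Cexp (alpha * pole beta y) <> x -> Cexp (gamma * pole beta y) <> z ->
  Cexp (alpha * pole gamma z) <> x -> Cexp (beta * pole gamma z) <> y ->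
  rint (ml_integrand alpha beta gamma x y z kappa) a0 a (- th) th =
  (2 * PI * Ci * (ml_residue alpha beta gamma x y z kappa
     + ml_residue beta alpha gamma y x z kappa + ml_residue gamma alpha beta z x y kappa))%C.
Proof.
  intros px py pz hxy hxz hyx hyz hzx hzy.
  destruct (pole_inside_rect _ _ _ _ _ px) as [rx ix].
  destruct (pole_inside_rect _ _ _ _ _ py) as [ry iy].
  destruct (pole_inside_rect _ _ _ _ _ pz) as [rz iz].
  destruct (pole_margin _ _ _ _ _ px) as [mx [mx1 mx2]].
  destruct (pole_margin _ _ _ _ _ py) as [my [my1 my2]].
  destruct (pole_margin _ _ _ _ _ pz) as [mz [mz1 mz2]].
  destruct px as (ha & nx & _ & _ & bx), py as (hb & ny & _ & _ & by_), pz as (hc & nz & _ & _ & bz).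
  assert (npq : pole alpha x <> pole beta y).
  { intros e. apply hxy. rewrite e. apply Cexp_pole; auto; lra. }
  assert (npr : pole alpha x <> pole gamma z).
  { intros e. apply hxz. rewrite e. apply Cexp_pole; auto; lra. }
  assert (nqr : pole beta y <> pole gamma z).
  { intros e. apply hyz. rewrite e. apply Cexp_pole; auto; lra. }
  set (m := Rmin mx (Rmin my mz)).
  assert (hm : 0 < m) by (repeat apply Rmin_pos; auto).
  assert (hmx : m <= mx) by apply Rmin_l.
  assert (hmy : m <= my) by (eapply Rle_trans; [apply Rmin_r | apply Rmin_l]).
  assert (hmz : m <= mz) by (eapply Rle_trans; [apply Rmin_r | apply Rmin_r]).
  set (h := fun u => (Cexp (Cexp u) * Cexp (kappa * u) /
     (unit_factor alpha x u * unit_factor beta y u * unit_factor gamma z u))%C).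
  assert (hnz : forall u, Rabs (Im u) <= th + m ->
    unit_factor alpha x u <> 0 /\ unit_factor beta y u <> 0 /\ unit_factor gamma z u <> 0).
  { intros u hu. repeat split.
    - apply (unit_factor_nz alpha (th + mx)); auto; lra.
    - apply (unit_factor_nz beta (th + my)); auto; lra.
    - apply (unit_factor_nz gamma (th + mz)); auto; lra. }
  rewrite (rint_ext _ (fun u => h u / ((u - pole alpha x) * (u - pole beta y) * (u - pole gamma z)))%C); try lra.
  2:{ intros u hu.
      assert (hi : Rabs (Im u) <= th + m).
      { destruct hu as [_ [h2 _]]. apply Rabs_le. lra. }
      destruct (hnz u hi) as (u1 & u2 & u3).
      assert (hn : forall v, a0 < Re v < a -> - th < Im v < th -> (u - v)%C <> 0).
      { intros v hv1 hv2. apply Cminus_eq_contra. intros ->. destruct hu as [h1 [h2 h3]]. lra. }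
      unfold ml_integrand, h.
      rewrite (pole_factor alpha x u), (pole_factor beta y u), (pole_factor gamma z u) by (auto; lra).
      field. repeat split; auto. }
  rewrite (cauchy_rect3 h m a0 a (- th) th (pole alpha x) (pole beta y) (pole gamma z)); auto.
  - f_equal. f_equal; [f_equal|].
    + unfold h. apply ml_residue_value; auto; lra.
    + rewrite <- (ml_residue_value beta alpha gamma y x z kappa) by (auto; lra).
      unfold h. f_equal. f_equal. ring.
    + rewrite <- (ml_residue_value gamma alpha beta z x y kappa) by (auto; lra).
      unfold h. f_equal. f_equal. ring.
  - apply holo_div.
    + apply holo_mult; apply holo_Cexp; [apply holo_Cexp, holo_id|].
      apply holo_mult; [apply holo_const | apply holo_id].
    + apply holo_mult; [apply holo_mult|]; apply holo_unit_factor.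
    + intros u e [_ hi]. assert (hi' : Rabs (Im u) <= th + m) by (apply Rabs_le; lra).
      destruct (hnz u hi') as (u1 & u2 & u3).
      revert e. apply Cmult_neq_0; [now apply Cmult_neq_0 | auto].
Qed.

(** * The contour omega in the logarithmic coordinate *)

Lemma lim_log_p (lam : R) : 0 < lam ->
  filterlim (fun r => ln r / lam) (Rbar_locally p_infty) (Rbar_locally p_infty).
Proof.
  intros hl P [M hM]. exists (exp (lam * M)). intros r hr. apply hM.
  assert (h := ln_increasing _ _ (exp_pos _) hr). rewrite ln_exp in h.
  apply Rmult_lt_reg_l with lam; auto. replace (lam * (ln r / lam)) with (ln r) by (field; lra). exact h.
Qed.

(** The substitution r = e^(lam rho), with dr/r = lam d rho. *)
Lemma ray_integral_log (lam eps y : R) (g : R -> C) (G : C -> C) (l : C) :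
  0 < lam -> 0 < eps ->
  (forall r, 0 < r -> (g r * r)%C = G (ln r / lam, y)) ->
  (forall r, ln eps / lam <= r -> contCC G (r, y)) ->
  climit (hint G y (ln eps / lam)) (Rbar_locally p_infty) l ->
  ray_integral eps g = (lam * l)%C.
Proof.
  intros hlam heps hg hc hl. unfold ray_integral.
  assert (hI : forall b, eps <= b -> isRIC g eps b (lam * hint G y (ln eps / lam) (ln b / lam))%C).
  { intros b hb.
    assert (hcomp := is_RInt_comp (V := C_R_CompleteNormedModule) (fun r => G (r, y))
      (fun r => ln r / lam) (fun r => / (lam * r)) eps b).
    match type of hcomp with _ -> _ -> ?X => assert (hX : X) end.
    { apply hcomp.
      - intros r. rewrite Rmin_left, Rmax_right by lra. intros hr. apply contC_h, hc.
        apply Rmult_le_compat_r; [left; now apply Rinv_0_lt_compat|]. apply ln_le; lra.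
      - intros r. rewrite Rmin_left, Rmax_right by lra. intros hr.
        assert (0 < lam * r) by (apply Rmult_lt_0_compat; lra). split.
        + auto_derive; [lra|]. field. lra.
        + apply (ex_derive_continuous (V := R_NormedModule)). auto_derive. lra. }
    apply (isRIC_scal _ _ _ lam) in hX.
    apply (is_RInt_ext (V := C_R_NormedModule) (fun t => Cmult lam (scal (/ (lam * t)) (G (ln t / lam, y) : C_R_NormedModule)))); [|exact hX].
    intros r. rewrite Rmin_left, Rmax_right by lra. intros hr.
    rewrite scal_R_Cmult, <- hg by lra.
    assert (n1 := RtoC_nz lam ltac:(lra)). assert (n2 := RtoC_nz r ltac:(lra)).
    rewrite RtoC_inv, RtoC_mult by (apply Rgt_not_eq, Rmult_lt_0_compat; lra).
    asC. field. auto. }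
  apply (is_RInt_gen_unique (V := C_R_CompleteNormedModule)).
  intros P hP.
  assert (hlim : climit (fun b => lam * hint G y (ln eps / lam) (ln b / lam))%C (Rbar_locally p_infty) (lam * l)%C).
  { apply climit_scal. exact (filterlim_comp _ _ _ _ _ _ _ _ (lim_log_p lam hlam) hl). }
  apply (Filter_prod _ _ _ (fun a => a = eps)
    (fun b => eps <= b /\ P (lam * hint G y (ln eps / lam) (ln b / lam))%C)).
  - reflexivity.
  - apply filter_and; [apply near_infty | exact (hlim P hP)].
  - intros a b -> [hb hPb]. exists (lam * hint G y (ln eps / lam) (ln b / lam))%C.
    split; [now apply hI | exact hPb].
Qed.

Lemma arc_integral_log (lam eta : R) (g : R -> C) (G : C -> C) (x : R) :
  0 < lam -> 0 <= eta ->
  (forall t, g t = Cmult Ci (G (x, t / lam))) ->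
  (forall t, - (eta / lam) <= t <= eta / lam -> contCC G (x, t)) ->
  RIC g (- eta) eta = (lam * vint G x (- (eta / lam)) (eta / lam))%C.
Proof.
  intros hlam heta hg hc. apply RIC_unique.
  assert (hq : forall s t, s <= t -> s / lam <= t / lam).
  { intros s t h. apply Rmult_le_compat_r; auto. left; now apply Rinv_0_lt_compat. }
  assert (hcomp := is_RInt_comp (V := C_R_CompleteNormedModule) (fun t => G (x, t))
      (fun t => t / lam) (fun _ => / lam) (- eta) eta).
  match type of hcomp with _ -> _ -> ?X => assert (hX : X) end.
  { apply hcomp.
    - intros t. rewrite Rmin_left, Rmax_right by lra. intros ht. apply contC_v, hc.
      replace (- (eta / lam)) with (- eta / lam) by (unfold Rdiv; ring). split; apply hq; lra.
    - intros t _. split; [auto_derive; auto; field; lra | apply continuous_const]. }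
  apply (isRIC_scal _ _ _ (lam * Ci)%C) in hX.
  unfold vint. replace (- (eta / lam)) with (- eta / lam) by (unfold Rdiv; ring).
  rewrite Cmult_assoc.
  apply (is_RInt_ext (V := C_R_NormedModule) (fun t => Cmult (lam * Ci) (scal (/ lam) (G (x, t / lam) : C_R_NormedModule)))); [|exact hX].
  intros t _. rewrite scal_R_Cmult, hg, RtoC_inv by lra.
  assert (n1 := RtoC_nz lam ltac:(lra)). asC. field. auto.
Qed.

Lemma hankel_integral_log (lam eps eta : R) (F : R -> R -> C) (G : C -> C) (l1 l2 : C) :
  0 < lam -> 0 < eps -> 0 <= eta ->
  (forall r t, 0 < r -> (F r t * (r * Cexp (Ci * t)))%C = G (ln r / lam, t / lam)) ->
  (forall u, contour (eta / lam) (ln eps / lam) u -> contCC G u) ->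
  climit (hint G (- (eta / lam)) (ln eps / lam)) (Rbar_locally p_infty) l1 ->
  climit (hint G (eta / lam) (ln eps / lam)) (Rbar_locally p_infty) l2 ->
  hankel_integral eps eta F =
    (lam * (- l1 + vint G (ln eps / lam) (- (eta / lam)) (eta / lam) + l2))%C.
Proof.
  intros hlam heps heta hF hc h1 h2. unfold hankel_integral.
  rewrite (ray_integral_log lam eps (- (eta / lam)) _ G l1); auto.
  2:{ intros r hr. replace (- (eta / lam)) with (- eta / lam) by (unfold Rdiv; ring).
      rewrite <- hF by auto. ring. }
  2:{ intros r hr. now apply hc, contour_h. }
  rewrite (ray_integral_log lam eps (eta / lam) _ G l2); auto.
  2:{ intros r hr. rewrite <- hF by auto. ring. }
  2:{ intros r hr. now apply hc, contour_h. }
  rewrite (arc_integral_log lam eta _ G (ln eps / lam)); auto.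
  - ring.
  - intros t. rewrite <- hF by auto. ring.
  - intros t ht. now apply hc, contour_v.
Qed.

Lemma ray_move (f : C -> C) (y a0 a : R) (l : C) : a0 <= a ->
  (forall r, a0 <= r -> contCC f (r, y)) ->
  climit (hint f y a) (Rbar_locally p_infty) l ->
  climit (hint f y a0) (Rbar_locally p_infty) (hint f y a0 a + l)%C.
Proof.
  intros h hc hl.
  apply (filterlim_ext_loc (F := Rbar_locally p_infty) (fun b => hint f y a0 a + hint f y a b)%C).
  - generalize (near_infty a). apply filter_imp. intros b hb. symmetry. apply hint_Chasles; auto.
    intros r hr. apply hc. lra.
  - apply climit_plus; [apply climit_const | exact hl].
Qed.

Lemma pole_inside_nz (a0 a th alpha : R) (x u : C) : 0 <= th -> pole_inside a0 a th alpha x ->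
  contour th a0 u -> (Cexp (alpha * u) - x)%C <> 0.
Proof.
  intros hth hp hu. destruct (pole_inside_rect _ _ _ _ _ hp) as [h1 h2].
  destruct hp as (ha & hx & _ & _ & hb). rewrite pole_factor by (auto; lra).
  apply Cmult_neq_0.
  - apply (unit_factor_nz alpha th); auto. now apply (contour_Im th a0).
  - apply Cminus_eq_contra. intros ->. destruct hu as [[h3 [h4|h4]]|[h3 h4]]; lra.
Qed.

Lemma ml_integrand_cont (a0 a th alpha beta gamma : R) (x y z kappa u : C) : 0 <= th ->
  pole_inside a0 a th alpha x -> pole_inside a0 a th beta y -> pole_inside a0 a th gamma z ->
  contour th a0 u -> contCC (ml_integrand alpha beta gamma x y z kappa) u.
Proof.
  intros hth px py pz hu.
  assert (n1 := pole_inside_nz _ _ _ _ _ _ hth px hu).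
  assert (n2 := pole_inside_nz _ _ _ _ _ _ hth py hu).
  assert (n3 := pole_inside_nz _ _ _ _ _ _ hth pz hu).
  assert (hc : forall (k : R) (c : C), contCC (fun u => Cexp (k * u) - c)%C u).
  { intros k c. apply contC_minus; [apply contC_Cexp_lin | apply continuous_const]. }
  apply contC_mult.
  - apply contC_mult; [apply contC_Cexp, contC_Cexp, continuous_id | apply contC_Cexp_lin].
  - apply contC_inv; [apply contC_mult; [apply contC_mult|]; apply hc|].
    apply Cmult_neq_0; auto. now apply Cmult_neq_0.
Qed.

(** The contour is first placed at an abscissa a where the series converges, and then
    moved to a0 at the cost of the integral around a rectangle. *)
Lemma ml_log_form (a0 th alpha beta gamma : R) (x y z mu : C) :
  PI / 2 < th <= PI ->
  (forall a, ln (Cmod x) < alpha * a -> ln (Cmod y) < beta * a -> ln (Cmod z) < gamma * a ->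
     pole_inside a0 a th alpha x /\ pole_inside a0 a th beta y /\ pole_inside a0 a th gamma z) ->
  0 < alpha -> 0 < beta -> 0 < gamma -> x <> 0 -> y <> 0 -> z <> 0 ->
  Cexp (beta * pole alpha x) <> y -> Cexp (gamma * pole alpha x) <> z ->
  Cexp (alpha * pole beta y) <> x -> Cexp (gamma * pole beta y) <> z ->
  Cexp (alpha * pole gamma z) <> x -> Cexp (beta * pole gamma z) <> y ->
  let kappa := (alpha + beta + gamma + 1 - mu)%C in
  let G := ml_integrand alpha beta gamma x y z kappa in
  exists l1 l2 : C,
    (forall u, contour th a0 u -> contCC G u) /\
    climit (hint G (- th) a0) (Rbar_locally p_infty) l1 /\
    climit (hint G th a0) (Rbar_locally p_infty) l2 /\
    mittag_leffler3 alpha beta gamma x y z mu =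
    (ml_residue alpha beta gamma x y z kappa + ml_residue beta alpha gamma y x z kappa
      + ml_residue gamma alpha beta z x y kappa
      + 1 / (2 * PI * Ci) * (- l1 + vint G a0 (- th) th + l2))%C.
Proof.
  intros hth hpi hal hbe hga nx ny nz hxy hxz hyx hyz hzx hzy kappa G.
  assert (hp := PI_RGT_0).
  (* a is chosen so that each of the three ratios has modulus at most 1/2 *)
  set (A := fun (k : R) (w : C) => Rabs (ln (2 * Cmod w)) / k).
  assert (hA0 : forall (k : R) (w : C), 0 < k -> 0 <= A k w).
  { intros k w hk. apply Rdiv_le_0_compat; auto. apply Rabs_pos. }
  set (a := Rabs a0 + A alpha x + A beta y + A gamma z).
  assert (p1 := hA0 alpha x hal). assert (p2 := hA0 beta y hbe). assert (p3 := hA0 gamma z hga).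
  assert (p0 := Rabs_pos a0).
  assert (haa : a0 <= a) by (unfold a; assert (h := Rle_abs a0); lra).
  assert (ha0 : 0 <= a) by (unfold a; lra).
  assert (hbig : forall (k : R) (w : C), 0 < k -> w <> 0 -> A k w <= a ->
     2 * Cmod w <= exp (k * a) /\ ln (Cmod w) < k * a).
  { intros k w hk hw h. assert (hm := proj1 (Cmod_gt_0 w) hw).
    assert (h1 : ln (2 * Cmod w) <= k * a).
    { apply Rle_trans with (k * A k w); [|apply Rmult_le_compat_l; lra].
      unfold A. replace (k * (Rabs (ln (2 * Cmod w)) / k)) with (Rabs (ln (2 * Cmod w))) by (field; lra).
      apply Rle_abs. }
    split.
    - rewrite <- (exp_ln (2 * Cmod w)) by lra. now apply exp_le_mono.
    - apply Rlt_le_trans with (ln (2 * Cmod w)); auto. apply ln_increasing; lra. }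
  destruct (hbig alpha x hal nx ltac:(unfold a; lra)) as [bx lx].
  destruct (hbig beta y hbe ny ltac:(unfold a; lra)) as [by_ ly].
  destruct (hbig gamma z hga nz ltac:(unfold a; lra)) as [bz lz].
  destruct (hpi a lx ly lz) as (px & py & pz).
  assert (hcont : forall u, contour th a0 u -> contCC G u).
  { intros u hu. apply (ml_integrand_cont a0 a th); auto; lra. }
  assert (hE := mittag_leffler3_hankel th a alpha beta gamma x y z mu hth ha0 hal hbe hga bx by_ bz).
  set (Q := fun u => (hankel_kernel mu u / (2 * PI * Ci) / (1 - ratio gamma z u)
      / (1 - ratio beta y u) / (1 - ratio alpha x u))%C) in *.
  assert (rx := ratio_small th a alpha x hal bx).
  assert (ry := ratio_small th a beta y hbe by_).
  assert (rz := ratio_small th a gamma z hga bz).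
  destruct (hankel_kernel_tame th a mu hth ha0) as [M hM].
  assert (hQ : exists M', tame th a Q M').
  { assert (t0 : tame th a (fun u => hankel_kernel mu u / (2 * PI * Ci))%C (M * Cmod (/ (2 * PI * Ci)))).
    { apply (tame_mult th a M _ (hankel_kernel mu) (fun _ => / (2 * PI * Ci))%C); auto.
      intros u _. split; [apply continuous_const | lra]. }
    assert (t1 := tame_geometric _ _ _ (/ 2) _ _ ltac:(lra) t0 rz).
    assert (t2 := tame_geometric _ _ _ (/ 2) _ _ ltac:(lra) t1 ry).
    assert (t3 := tame_geometric _ _ _ (/ 2) _ _ ltac:(lra) t2 rx).
    eexists. exact t3. }
  destruct hQ as [M' hQ].
  assert (hGQ : forall u, contour th a u -> G u = (2 * PI * Ci * Q u)%C).
  { intros u hu.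
    assert (hn : forall (k : R) (w : C), 0 < k -> contCC (ratio k w) u /\ Cmod (ratio k w u) <= / 2 ->
       (Cexp (k * u) - w)%C <> 0 /\ (1 - ratio k w u)%C = ((Cexp (k * u) - w) / Cexp (k * u))%C).
    { intros k w hk [_ h].
      assert (e : (1 - ratio k w u)%C = ((Cexp (k * u) - w) / Cexp (k * u))%C).
      { unfold ratio. replace (- k * u)%C with (- (k * u))%C by ring. rewrite Cexp_opp. field. apply Cexp_nz. }
      split; auto. intros e0. destruct (geometric_den (/ 2) _ ltac:(lra) h) as [_ h1].
      apply h1. rewrite e, e0. unfold Cdiv. ring. }
    destruct (hn alpha x hal (rx u hu)) as [x1 x2].
    destruct (hn beta y hbe (ry u hu)) as [y1 y2].
    destruct (hn gamma z hga (rz u hu)) as [z1 z2].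
    unfold G, Q, ml_integrand, hankel_kernel. rewrite x2, y2, z2.
    replace (kappa * u)%C with (alpha * u + beta * u + gamma * u + (1 - mu) * u)%C by (unfold kappa; ring).
    rewrite !Cexp_plus. field. repeat split; auto using Cexp_nz, Ci_nz. apply RtoC_nz; lra. }
  assert (hQc : forall u, contour th a u -> contCC Q u) by (intros u hu; now apply hQ).
  assert (hray : forall y0, (y0 = th \/ y0 = - th) ->
    exists l, climit (hint G y0 a0) (Rbar_locally p_infty) l).
  { intros y0 hy0.
    assert (hcy : forall b r, b <= r -> contour th b (r, y0)).
    { intros b r hr. left. split; [exact hr | exact hy0]. }
    destruct (ray_converges G y0 a (Cmod (2 * PI * Ci) * M')) as [l hl].
    { intros r hr. split; [apply hcont, hcy; lra|].
      rewrite (hGQ _ (hcy a r hr)), Cmod_mult, Rmult_assoc.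
      apply Rmult_le_compat_l; [apply Cmod_ge_0|]. apply (hQ (r, y0)), hcy, hr. }
    eexists. apply (ray_move G y0 a0 a l); auto. }
  destruct (hray (- th) (or_intror eq_refl)) as [l1 h1].
  destruct (hray th (or_introl eq_refl)) as [l2 h2].
  exists l1, l2. split; [exact hcont|]. split; [exact h1|]. split; [exact h2|].
  assert (hk := is_hk_of_rays th a0 G l1 l2 h1 h2).
  assert (hGa : is_hk th G a (2 * PI * Ci * mittag_leffler3 alpha beta gamma x y z mu)%C).
  { apply (is_hk_ext th a (fun u => 2 * PI * Ci * Q u)%C); [lra| |].
    - intros u hu. symmetry. now apply hGQ.
    - apply is_hk_scal; auto; lra. }
  assert (hmv := is_hk_move th a0 a G _ haa hcont hGa).
  rewrite (is_hk_unique _ _ _ _ _ hk hmv). unfold G.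
  rewrite (rint_ml alpha beta gamma a0 a th x y z kappa); auto.
  field. split; [apply Ci_nz | apply RtoC_nz; lra].
Qed.

(** * The integral representation *)

(** If eta/s <= PI, then |Carg x| < eta/s already gives eta/s + |Carg x| < 2 PI.
    Otherwise this is the single-sheet condition for the neighbouring argument,
    Carg x - 2 PI or Carg x + 2 PI according to the sign of Carg x. *)
Lemma Omega_plus_pole (alpha s lam eps eta : R) (x : C) :
  0 < alpha -> 0 < s -> lam = alpha * s -> 0 < eps ->
  Omega_plus (Rpower eps (1 / s)) (eta / s) x ->
  (PI < eta / s -> single_sheet (eta / s) x) ->
  x <> 0 /\ forall a, ln (Cmod x) < alpha * a -> pole_inside (ln eps / lam) a (eta / lam) alpha x.
Proof.
  intros ha hs -> heps [h1 h2] hsheet.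
  assert (hp : 0 < Rpower eps (1 / s)) by apply exp_pos.
  assert (hx : x <> 0) by (apply Cmod_gt_0; lra).
  split; [exact hx|]. intros a hal.
  assert (e : alpha * (eta / (alpha * s)) = eta / s) by (field; lra).
  repeat split; auto.
  - apply ln_increasing in h1; auto. unfold Rpower in h1. rewrite ln_exp in h1.
    replace (alpha * (ln eps / (alpha * s))) with (1 / s * ln eps) by (field; lra). exact h1.
  - now rewrite e.
  - rewrite e. destruct (Rle_dec (eta / s) PI) as [h|h]; [lra|].
    assert (hA := Rabs_Carg_le_PI x).
    destruct (Rle_dec 0 (Carg x)) as [hc|hc].
    + assert (h3 := hsheet ltac:(lra) (-1)%Z ltac:(discriminate)).
      rewrite Rabs_right in hA by lra. rewrite Rabs_left1 in h3 by lra.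
      rewrite Rabs_right by lra. lra.
    + assert (h3 := hsheet ltac:(lra) 1%Z ltac:(discriminate)).
      rewrite Rabs_left in hA by lra. rewrite Rabs_right in h3 by lra.
      rewrite Rabs_left by lra. lra.
Qed.

Lemma Cpower_pole (alpha k : R) (x : C) : alpha <> 0 ->
  Cpower x (k / alpha)%R = Cexp (k * pole alpha x).
Proof. intros h. unfold Cpower, polar_power. now rewrite pole_mult. Qed.

Lemma ml_residue_power (alpha beta gamma : R) (x y z mu : C) : alpha <> 0 ->
  ml_residue alpha beta gamma x y z (alpha + beta + gamma + 1 - mu) =
  (1 / alpha
     * (Cexp (Cpower x (1 / alpha)%R)
        * Cpower x ((beta + gamma + 1 - mu) / alpha)
        / ((Cpower x (beta / alpha)%R - y) * (Cpower x (gamma / alpha)%R - z))))%C.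
Proof.
  intros h. rewrite !Cpower_pole by auto. unfold ml_residue. rewrite Cmult_1_l.
  replace ((alpha + beta + gamma + 1 - mu - alpha) * pole alpha x)%C
    with ((beta + gamma + 1 - mu) / alpha * (ln (Cmod x), Carg x))%C; [reflexivity|].
  unfold pole. rewrite RtoC_inv by auto. field. now apply RtoC_nz.
Qed.

Lemma polar_power_log (lam r t : R) (k : C) : lam <> 0 ->
  polar_power r t k = Cexp (k * lam * (ln r / lam, t / lam)).
Proof.
  intros h. unfold polar_power. f_equal. rewrite <- Cmult_assoc. f_equal.
  unfold Cmult, RtoC; simpl. f_equal; field; auto.
Qed.

Theorem lemma3p2 (alpha beta gamma : R) (mu : C) (eps eta : R) (x y z : C)
    (halpha : 0 < alpha < 2) (hbeta : 0 < beta < 2) (hgamma : 0 < gamma < 2)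
    (habc : alpha * beta * gamma < 2)
    (heps : 0 < eps)
    (heta : PI * (alpha * beta * gamma) / 2 < eta
            <= Rmin PI (PI * (alpha * beta * gamma)))
    (hx : Omega_plus (Rpower eps (1 / (beta * gamma))) (eta / (beta * gamma)) x)
    (hy : Omega_plus (Rpower eps (1 / (alpha * gamma))) (eta / (alpha * gamma)) y)
    (hz : Omega_plus (Rpower eps (1 / (alpha * beta))) (eta / (alpha * beta)) z)
    (* the denominators of the three residue terms do not vanish *)
    (hxy : Cpower x (beta / alpha)%R <> y)
    (hxz : Cpower x (gamma / alpha)%R <> z)
    (hyx : Cpower y (alpha / beta)%R <> x)
    (hyz : Cpower y (gamma / beta)%R <> z)
    (hzx : Cpower z (alpha / gamma)%R <> x)
    (hzy : Cpower z (beta / gamma)%R <> y)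
    (* the integrand has no pole on the contour, and none but the three principal
       ones to its right; this can only fail for opening angles above PI *)
    (hx1 : PI < eta / (beta * gamma) -> single_sheet (eta / (beta * gamma)) x)
    (hy1 : PI < eta / (alpha * gamma) -> single_sheet (eta / (alpha * gamma)) y)
    (hz1 : PI < eta / (alpha * beta) -> single_sheet (eta / (alpha * beta)) z) :
  mittag_leffler3 alpha beta gamma x y z mu =
  (1 / alpha
     * (Cexp (Cpower x (1 / alpha)%R)
        * Cpower x ((beta + gamma + 1 - mu) / alpha)
        / ((Cpower x (beta / alpha)%R - y) * (Cpower x (gamma / alpha)%R - z)))
   + 1 / beta
     * (Cexp (Cpower y (1 / beta)%R)
        * Cpower y ((alpha + gamma + 1 - mu) / beta)
        / ((Cpower y (alpha / beta)%R - x) * (Cpower y (gamma / beta)%R - z)))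
   + 1 / gamma
     * (Cexp (Cpower z (1 / gamma)%R)
        * Cpower z ((alpha + beta + 1 - mu) / gamma)
        / ((Cpower z (alpha / gamma)%R - x) * (Cpower z (beta / gamma)%R - y)))
   + 1 / (2 * PI * Ci) * (1 / (alpha * beta * gamma)%R)
     * hankel_integral eps eta
         (fun r theta =>
            Cexp (polar_power r theta (1 / (alpha * beta * gamma))%R)
            * polar_power r theta
                ((alpha + beta + gamma + 1 - mu) / (alpha * beta * gamma)%R - 1)
            / ((polar_power r theta (1 / (beta * gamma))%R - x)
               * (polar_power r theta (1 / (alpha * gamma))%R - y)
               * (polar_power r theta (1 / (alpha * beta))%R - z))))%C.
Proof.
  destruct halpha as [ha _], hbeta as [hb _], hgamma as [hc _].
  assert (hpi := PI_RGT_0).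
  set (lam := alpha * beta * gamma) in *.
  assert (hbc : 0 < beta * gamma) by now apply Rmult_lt_0_compat.
  assert (hac : 0 < alpha * gamma) by now apply Rmult_lt_0_compat.
  assert (hab : 0 < alpha * beta) by now apply Rmult_lt_0_compat.
  assert (hlam : 0 < lam) by now apply Rmult_lt_0_compat.
  destruct (Omega_plus_pole alpha (beta * gamma) lam eps eta x) as [nx px]; auto; [unfold lam; ring|].
  destruct (Omega_plus_pole beta (alpha * gamma) lam eps eta y) as [ny py]; auto; [unfold lam; ring|].
  destruct (Omega_plus_pole gamma (alpha * beta) lam eps eta z) as [nz pz]; auto; [unfold lam; ring|].
  assert (hth : PI / 2 < eta / lam <= PI).
  { destruct heta as [h1 h2]. assert (h3 := Rmin_r PI (PI * lam)).
    split; apply Rmult_lt_reg_r with lam || apply Rmult_le_reg_r with lam; auto;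
      replace (eta / lam * lam) with eta by (field; lra); lra. }
  assert (heta0 : 0 <= eta).
  { destruct heta as [h1 _]. assert (0 < PI * lam) by now apply Rmult_lt_0_compat. lra. }
  rewrite Cpower_pole in hxy, hxz, hyx, hyz, hzx, hzy by lra.
  destruct (ml_log_form (ln eps / lam) (eta / lam) alpha beta gamma x y z mu hth)
    as (l1 & l2 & hcont & hl1 & hl2 & hE); auto.
  set (kappa := (alpha + beta + gamma + 1 - mu)%C) in *.
  rewrite (hankel_integral_log lam eps eta _ (ml_integrand alpha beta gamma x y z kappa) l1 l2); auto.
  - rewrite hE. unfold kappa.
    (* each residue lists its own parameter first in the exponent *)
    replace (alpha + beta + gamma + 1 - mu)%C with (beta + alpha + gamma + 1 - mu)%C at 2 by ring.
    replace (alpha + beta + gamma + 1 - mu)%C with (gamma + alpha + beta + 1 - mu)%C at 2 by ring.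
    rewrite !ml_residue_power by lra.
    assert (nl := RtoC_nz lam ltac:(lra)).
    set (R1 := (1 / alpha * _)%C). set (R2 := (1 / beta * _)%C). set (R3 := (1 / gamma * _)%C).
    field. repeat split; auto using Ci_nz. apply RtoC_nz; lra.
  - intros r t hr. set (u := (ln r / lam, t / lam) : C).
    assert (nl := RtoC_nz lam ltac:(lra)).
    rewrite !(polar_power_log lam r t) by lra. fold u.
    assert (es : (RtoC r * Cexp (Ci * t))%C = Cexp (lam * u)).
    { unfold u. replace (RtoC lam * (ln r / lam, t / lam)%R)%C with (ln r + Ci * t)%C.
      - rewrite Cexp_plus, Cexp_real, exp_ln by auto. reflexivity.
      - unfold Cmult, Cplus, RtoC, Ci; simpl. f_equal; field; lra. }
    rewrite es, <- !RtoC_mult.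
    replace (1 / lam * lam) with 1 by (field; lra).
    replace (1 / (beta * gamma) * lam) with alpha by (unfold lam; field; lra).
    replace (1 / (alpha * gamma) * lam) with beta by (unfold lam; field; lra).
    replace (1 / (alpha * beta) * lam) with gamma by (unfold lam; field; lra).
    rewrite Cmult_1_l. unfold ml_integrand.
    replace ((kappa / lam - 1) * lam * u)%C with (kappa * u - lam * u)%C by (field; auto).
    rewrite Cexp_minus.
    (* away from the contour the denominator may vanish, so it is kept as a factor *)
    unfold Cdiv. set (i := (/ (_ * _ * _))%C). field. apply Cexp_nz.
Qed.
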